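(* Let $\varphi\in C^1(\overline{\mathbb{D}^2})$ be such that the functions $z\mapsto\varphi(z,e^{i\theta})$ and $w\mapsto\varphi(e^{i\theta},w)$ are harmonic on $\mathbb{D}$ for all $\theta\in[0,2\pi]$. Then the Hankel operator $H_\varphi:A^2(\mathbb{D}^2)\to L^2(\mathbb{D}^2)$ satisfies the essential norm estimate $$\|H_\varphi\|_e\geq\sup_{F\in\Gamma_{b\mathbb{D}^2}}\left\{\frac{|F'(0)|}{\sqrt{2}}\inf_{\xi\in\mathbb{D}}\left\{|(\varphi\circ F)_{\overline{\xi}}(\xi)|\right\}\right\}.$$
   Context: $\mathbb{D}$ is the open unit disk in $\mathbb{C}$, $\mathbb{D}^2=\mathbb{D}\times\mathbb{D}\subset\mathbb{C}^2$ is the bidisk, and $b\mathbb{D}^2$ is its (topological) boundary. Functions are complex-valued; $f_{\overline{\xi}}=\partial f/\partial\overline{\xi}$. $A^2(\mathbb{D}^2)$ is the Bergman space of holomorphic functions on $\mathbb{D}^2$ that are square integrable with respect to the volume (Lebesgue) measure $dV$, and $P:L^2(\mathbb{D}^2)\to A^2(\mathbb{D}^2)$ is the orthogonal (Bergman) projection. For $\varphi\in L^\infty(\mathbb{D}^2)$ the Hankel operator $H_\varphi:A^2(\mathbb{D}^2)\to L^2(\mathbb{D}^2)$ is $H_\varphi f=(I-P)(\varphi f)$. The essential norm of a bounded linear operator $T:X\to Y$ between normed linear spaces is $\|T\|_e=\inf\{\|T-K\|: K:X\to Y\text{ a compact linear operator}\}$. The set of linear parametrizations of circular affine nontrivial analytic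 disks in the boundary is $$\Gamma_{b\mathbb{D}^2}=\{F:\mathbb{D}\to b\mathbb{D}^2:\ F(\xi)=\xi z+p\text{ for some }p\in b\mathbb{D}^2,\ z\in\mathbb{C}^2\setminus\{0\}\},$$ so that $F'(0)=z$ and $|F'(0)|$ is its Euclidean norm. *)

(* Defs.v *)
From HB Require Import structures.
From mathcomp Require Import all_boot all_order all_algebra complex.
From mathcomp Require Import all_classical all_reals all_analysis.
From mathcomp Require Import measurable_realfun ring.

Set Implicit Arguments.
Unset Strict Implicit.
Unset Printing Implicit Defensive.
Import Order.TTheory GRing.Theory Num.Theory.
Import numFieldNormedType.Exports.
Import Normc.
Local Open Scope classical_set_scope.
Local Open Scope ring_scope.
Local Open Scope complex_scope.

(* R[i] is a normed module over itself (topology of C, complex derivatives);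
   its alias Rcomplex R is a normed module over R (real derivatives).  Both
   carry the topology of the modulus. *)
HB.instance Definition _ (R : realType) := NormedModule.copy R[i] R[i]^o.

HB.instance Definition _ (R : realType) :=
  PseudoMetric.copy (Rcomplex R) (pseudoMetric_normed (Rcomplex R)).
HB.instance Definition _ (R : realType) := isPointed.Build (Rcomplex R) 0.
HB.instance Definition _ (R : realType) :=
  NormedZmod_PseudoMetric_eq.Build R (Rcomplex R) erefl.

Lemma Rcomplex_normrZ (R : realType) (l : R) (x : Rcomplex R) :
  `|l *: x| = `|l| * `|x|.
Proof.
rewrite -[LHS]/(normc (l *: x)) -[`|x|]/(normc x).
by case: x => a b /=; rewrite !exprMn -mulrDr sqrtrM ?sqr_ge0// sqrtr_sqr.
Qed.

HB.instance Definition _ (R : realType) :=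
  PseudoMetricNormedZmod_Lmodule_isNormedModule.Build R (Rcomplex R)
    (@Rcomplex_normrZ R).

Section complex_measure.
Variable R : realType.

Definition complex_pair (z : R[i]) : R * R := (complex.Re z, complex.Im z).
Definition pair_complex (p : R * R) : R[i] := p.1 +i* p.2.

Lemma pair_complexK : cancel pair_complex complex_pair.
Proof. by case. Qed.

Lemma complex_pairK : cancel complex_pair pair_complex.
Proof. by case. Qed.

(* The Borel sets of C, transported from the plane. *)
Definition complex_measurable : set (set R[i]) :=
  [set A | (measurable : set (set (measurableTypeR R * measurableTypeR R)))
             (pair_complex @^-1` A)].

Let complex_measurable0 : complex_measurable set0.
Proof. by rewrite /complex_measurable /= preimage_set0. Qed.

Let complex_measurableC A :
  complex_measurable A -> complex_measurable (~` A).
Proof. by rewrite /complex_measurable /= preimage_setC; exact: measurableC. Qed.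

Let complex_measurable_bigcup (F : (set R[i])^nat) :
  (forall k, complex_measurable (F k)) -> complex_measurable (\bigcup_k F k).
Proof.
move=> mF; rewrite /complex_measurable /= preimage_bigcup.
exact: bigcupT_measurable.
Qed.

HB.instance Definition _ := @isMeasurable.Build default_measure_display R[i]
  complex_measurable complex_measurable0 complex_measurableC
  complex_measurable_bigcup.

Lemma measurable_pair_complex :
  measurable_fun setT (pair_complex : measurableTypeR R * measurableTypeR R -> R[i]).
Proof. by move=> _ A mA; rewrite setTI. Qed.

Lemma measurable_complex_pair :
  measurable_fun setT (complex_pair : R[i] -> measurableTypeR R * measurableTypeR R).
Proof.
move=> _ A mA; rewrite setTI /measurable/= /complex_measurable/=.
by rewrite -comp_preimage (_ : _ \o _ = id)//; apply/funext; exact: pair_complexK.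
Qed.

Definition complex_lebesgue (A : set R[i]) : \bar R :=
  pushforward (@lebesgue_measure R \x @lebesgue_measure R)%E pair_complex A.

Local Notation m2 := (@lebesgue_measure R \x @lebesgue_measure R)%E.

Let complex_lebesgue0 : complex_lebesgue set0 = 0%E.
Proof. by rewrite /complex_lebesgue /pushforward preimage_set0 measure0. Qed.

Let complex_lebesgue_ge0 A : (0 <= complex_lebesgue A)%E.
Proof. by rewrite /complex_lebesgue /pushforward; apply: measure_ge0. Qed.

Let complex_lebesgue_sigma_additive : semi_sigma_additive complex_lebesgue.
Proof.
move=> F mF tF mUF; rewrite /complex_lebesgue /pushforward preimage_bigcup.
apply: measure_semi_sigma_additive => //.
apply/trivIsetP => /= i j _ _ ij; rewrite -preimage_setI.
by move/trivIsetP : tF => /(_ _ _ _ _ ij) ->//; rewrite preimage_set0.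
Qed.

HB.instance Definition _ := isMeasure.Build _ _ _ complex_lebesgue
  complex_lebesgue0 complex_lebesgue_ge0 complex_lebesgue_sigma_additive.

(* The library proof is referred to by name because, on a product measure, the
   canonical sigma-finite structure is shadowed by that of subprobabilities. *)
Let complex_lebesgue_sigma_finite : sigma_finite setT complex_lebesgue.
Proof.
have [F TF mF] : sigma_finite setT m2 
  by exact: lebesgue_integral_fubini.product_measure_sigma_finite_subproof.
exists (fun n => complex_pair @^-1` F n).
  by rewrite -preimage_bigcup -TF preimage_setT.
move=> k; have [mFk Fkoo] := mF k; split.
  by rewrite -[X in measurable X]setTI; exact: measurable_complex_pair.
rewrite /complex_lebesgue /pushforward -comp_preimage.
by rewrite (_ : _ \o _ = id)//; apply/funext; exact: pair_complexK.
Qed.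

HB.instance Definition _ := Measure_isSigmaFinite.Build _ _ _ complex_lebesgue
  complex_lebesgue_sigma_finite.

Definition volume : set (R[i] * R[i]) -> \bar R :=
  (complex_lebesgue \x complex_lebesgue)%E.

HB.instance Definition _ := Measure.on volume.
HB.instance Definition _ := Measure_isSigmaFinite.Build _ _ _ volume
  (lebesgue_integral_fubini.product_measure_sigma_finite_subproof complex_lebesgue complex_lebesgue).

End complex_measure.

Section domains.
Variable R : realType.

Definition disk : set R[i] := [set z | `|z| < 1].

Definition bidisk : set (R[i] * R[i]) := disk `*` disk.

Lemma measurable_disk : measurable disk.
Proof.
rewrite /measurable/= /complex_measurable/=.
pose g (p : measurableTypeR R * measurableTypeR R) : R := p.1 ^+ 2 + p.2 ^+ 2.
have mg : measurable_fun setT g.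
  apply: measurable_funD; apply: measurable_funX.
  - exact: measurable_fst.
  - exact: measurable_snd.
rewrite (_ : _ @^-1` _ = g @^-1` `]-oo, 1[%classic).
  by rewrite -[X in measurable X]setTI; exact: mg.
apply/funext => -[a b]; rewrite /disk/= normc_def/= in_itv/=.
by rewrite -[1]/(1%:C) ltcR -{1}sqrtr1 ltr_sqrt.
Qed.

Lemma measurable_bidisk : measurable bidisk.
Proof. by apply: measurableX; exact: measurable_disk. Qed.

End domains.

Section square_integrable.
Variable R : realType.
Local Notation C := R[i].
Local Notation C2 := (R[i] * R[i])%type.
Local Notation V := (@volume R).
Local Notation D2 := (@bidisk R).
Implicit Types f g : C2 -> C.

Definition sq_integral f : \bar R := (\int[V]_(p in D2) (normc (f p) ^+ 2)%:E)%E.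

Definition square_integrable : {pred C2 -> C} := fun f =>
  `[< [/\ measurable_fun D2 (fun p => complex.Re (f p)),
          measurable_fun D2 (fun p => complex.Im (f p)) &
          (sq_integral f < +oo)%E] >].

Lemma sqr_normcE (z : C) : normc z ^+ 2 = complex.Re z ^+ 2 + complex.Im z ^+ 2.
Proof. by case: z => a b; rewrite /= sqr_sqrtr// addr_ge0// sqr_ge0. Qed.

Lemma normc_ge0 (z : C) : 0 <= normc z.
Proof. by case: z => a b; exact: sqrtr_ge0. Qed.

Lemma measurable_normc2 f :
  measurable_fun D2 (fun p => complex.Re (f p)) ->
  measurable_fun D2 (fun p => complex.Im (f p)) ->
  measurable_fun D2 (fun p => normc (f p) ^+ 2).
Proof.
move=> mr mi; rewrite (_ : (fun p => _) =
    (fun p => complex.Re (f p) ^+ 2 + complex.Im (f p) ^+ 2)); last first.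
  by apply/funext => p; rewrite sqr_normcE.
by apply: measurable_funD; exact: measurable_funX.
Qed.

Lemma sq_integral_ge0 f : (0 <= sq_integral f)%E.
Proof. by apply: integral_ge0 => p _; rewrite lee_fin sqr_ge0. Qed.

Lemma sq_integralE f : f \in square_integrable ->
  ((fine (sq_integral f))%:E = sq_integral f)%E.
Proof.
by move=> /asboolP[_ _ foo]; rewrite fineK// ge0_fin_numE// sq_integral_ge0.
Qed.

(* Integrated form of |a + b|^2 <= (1 + t)|a|^2 + (1 + 1/t)|b|^2. *)
Lemma sq_integralD f g (t : R) : 0 < t ->
  f \in square_integrable -> g \in square_integrable ->
  (sq_integral (f + g)%R <=
   (1 + t)%:E * sq_integral f + (1 + t^-1)%:E * sq_integral g)%E.
Proof.
move=> t0 /asboolP[fr fi _] /asboolP[gr gi _].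
have mf := measurable_normc2 fr fi; have mg := measurable_normc2 gr gi.
have t1 : 0 <= 1 + t by rewrite addr_ge0// ltW.
have t2 : 0 <= 1 + t^-1 by rewrite addr_ge0// invr_ge0 ltW.
rewrite -!ge0_integralZl//=; last 6 first.
- exact: measurable_bidisk.
- exact/measurable_EFinP.
- by move=> p _; rewrite lee_fin sqr_ge0.
- exact: measurable_bidisk.
- exact/measurable_EFinP.
- by move=> p _; rewrite lee_fin sqr_ge0.
rewrite -ge0_integralD//=; last 5 first.
- exact: measurable_bidisk.
- by move=> p _; rewrite mule_ge0// lee_fin sqr_ge0.
- by apply/measurable_EFinP; apply: measurable_funM.
- by move=> p _; rewrite mule_ge0// lee_fin sqr_ge0.
- by apply/measurable_EFinP; apply: measurable_funM.
apply: ge0_le_integral => //=.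
- exact: measurable_bidisk.
- by move=> p _; rewrite lee_fin sqr_ge0.
- apply/measurable_EFinP; apply: (@measurable_normc2 (f + g)).
  + rewrite (_ : (fun p => _) = fun p => complex.Re (f p) + complex.Re (g p)).
      exact: measurable_funD.
    by apply/funext => p; rewrite -[(f + g) p]/(f p + g p); case: (f p); case: (g p).
  + rewrite (_ : (fun p => _) = fun p => complex.Im (f p) + complex.Im (g p)).
      exact: measurable_funD.
    by apply/funext => p; rewrite -[(f + g) p]/(f p + g p); case: (f p); case: (g p).
- by apply/measurable_EFinP; apply: measurable_funD; apply: measurable_funM.
- move=> p _; rewrite lee_fin.
  have key (a b : R) : (a + b) ^+ 2 <= (1 + t) * a ^+ 2 + (1 + t^-1) * b ^+ 2.
    rewrite -subr_ge0 [leRHS](_ : _ = t * (a - t^-1 * b) ^+ 2); first by rewrite mulr_ge0 ?sqr_ge0 ?ltW.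
    have tn : t != 0 by rewrite gt_eqF.
    by field.
  apply: le_trans (key _ _); rewrite ler_sqr ?nnegrE ?addr_ge0//; try exact: normc_ge0.
  exact: le_normcD.
Qed.

Lemma sq_integralZ (a : C) f : f \in square_integrable ->
  sq_integral (a *: f) = ((normc a ^+ 2)%:E * sq_integral f)%E.
Proof.
move=> /asboolP[fr fi _]; rewrite -ge0_integralZl ?lee_fin ?sqr_ge0//; last 3 first.
- exact: measurable_bidisk.
- by apply/measurable_EFinP; exact: measurable_normc2.
- by move=> p _; rewrite lee_fin sqr_ge0.
by apply: eq_integral => p _; rewrite -EFinM -exprMn -normcM.
Qed.

Lemma square_integrable_submod : submod_closed square_integrable.
Proof.
split=> [|a f g sf sg].
  apply/asboolP; split; [exact: measurable_cst|exact: measurable_cst|].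
  rewrite (_ : sq_integral 0 = 0%E) ?ltry//.
  by apply: integral0_eq => p _; rewrite [normc _]normc0 expr0n.
suff saf : a *: f \in square_integrable.
  have /asboolP[r1 i1 oo1] := saf; have /asboolP[r2 i2 oo2] := sg.
  apply/asboolP; split.
  - rewrite (_ : (fun p => _) =
        fun p => complex.Re ((a *: f) p) + complex.Re (g p)).
      exact: measurable_funD.
    apply/funext => p; rewrite -[(_ + g) p]/((a *: f) p + g p).
    by case: ((a *: f) p); case: (g p).
  - rewrite (_ : (fun p => _) =
        fun p => complex.Im ((a *: f) p) + complex.Im (g p)).
      exact: measurable_funD.
    apply/funext => p; rewrite -[(_ + g) p]/((a *: f) p + g p).
    by case: ((a *: f) p); case: (g p).
  - apply: le_lt_trans (sq_integralD ltr01 saf sg) _.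
    rewrite -(sq_integralE saf) -(sq_integralE sg) -!EFinM -EFinD.
    exact: ltry.
have /asboolP[fr fi _] := sf; apply/asboolP; split.
- rewrite (_ : (fun p => _) = fun p =>
      complex.Re a * complex.Re (f p) - complex.Im a * complex.Im (f p)).
    by apply: measurable_funB; apply: measurable_funM.
  apply/funext => p; rewrite -[(_ *: f) p]/(a * f p).
  by case: a; case: (f p).
- rewrite (_ : (fun p => _) = fun p =>
      complex.Re a * complex.Im (f p) + complex.Im a * complex.Re (f p)).
    by apply: measurable_funD; apply: measurable_funM.
  apply/funext => p; rewrite -[(_ *: f) p]/(a * f p).
  by case: a; case: (f p).
- by rewrite sq_integralZ// -(sq_integralE sf) -EFinM ltry.
Qed.

HB.instance Definition _ := GRing.isSubmodClosed.Build C (C2 -> C)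
  square_integrable square_integrable_submod.

(* Only the values on the bidisk are relevant; the rest is forgotten when
   passing to the quotient L2. *)
Record L2fun := MkL2fun {
  L2fun_val :> C2 -> C;
  L2fun_valP : L2fun_val \in square_integrable }.

HB.instance Definition _ := [isSub for L2fun_val].
HB.instance Definition _ := [Choice of L2fun by <:].
HB.instance Definition _ := [SubChoice_isSubLmodule of L2fun by <:].

Definition L2eq (f g : L2fun) : bool := `[< f = g %[ae V in D2] >].

Let L2eq_refl : reflexive L2eq.
Proof. by move=> f; apply/asboolP; exact: ae_eq_refl. Qed.

Let L2eq_sym : symmetric L2eq.
Proof. by move=> f g; apply/asboolP/asboolP; exact: ae_eq_sym. Qed.

Let L2eq_trans : transitive L2eq.
Proof.
by move=> f g h /asboolP fg /asboolP gh; apply/asboolP; exact: ae_eq_trans gh.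
Qed.

Canonical L2eq_equiv := EquivRel L2eq L2eq_refl L2eq_sym L2eq_trans.

Local Open Scope quotient_scope.

Definition L2 : Type := {eq_quot L2eq}.
HB.instance Definition _ := Choice.on L2.
HB.instance Definition _ := EqQuotient.on L2.

Lemma L2eqP (f g : L2fun) : \pi_L2 f = \pi_L2 g <-> f = g %[ae V in D2].
Proof.
by split=> [/eqmodP/asboolP//|fg]; apply/eqmodP/asboolP.
Qed.

Lemma L2reprP (f : L2fun) : repr (\pi_L2 f) = f %[ae V in D2].
Proof. by apply/L2eqP; rewrite reprK. Qed.

Definition L2add (x y : L2) : L2 := \pi_L2 (repr x + repr y).
Definition L2opp (x : L2) : L2 := \pi_L2 (- repr x).
Definition L2scale (a : C) (x : L2) : L2 := \pi_L2 (a *: repr x).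

Lemma L2addE (f g : L2fun) : L2add (\pi_L2 f) (\pi_L2 g) = \pi_L2 (f + g).
Proof.
apply/L2eqP; apply: filterS2 (L2reprP f) (L2reprP g) => p fp gp /= Dp.
by rewrite -![(_ + _) p]/(_ p + _ p) fp ?gp.
Qed.

Lemma L2oppE (f : L2fun) : L2opp (\pi_L2 f) = \pi_L2 (- f).
Proof.
apply/L2eqP; apply: filterS (L2reprP f) => p fp /= Dp.
by rewrite -![(- _) p]/(- _ p) fp.
Qed.

Lemma L2scaleE a (f : L2fun) : L2scale a (\pi_L2 f) = \pi_L2 (a *: f).
Proof.
apply/L2eqP; apply: filterS (L2reprP f) => p fp /= Dp.
by rewrite -![(_ *: _) p]/(_ * _ p) fp.
Qed.

Let L2addA : associative L2add.
Proof.
elim/quotW=> f; elim/quotW=> g; elim/quotW=> h.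
rewrite (L2addE g h) (L2addE f g) (L2addE f) (L2addE _ h); congr (\pi_L2 _).
exact: addrA.
Qed.

Let L2addC : commutative L2add.
Proof. by move=> x y; rewrite /L2add addrC. Qed.

Let L2add0 : left_id (\pi_L2 0) L2add.
Proof. by elim/quotW=> f; rewrite (L2addE 0 f) add0r. Qed.

Let L2addN : left_inverse (\pi_L2 0) L2opp L2add.
Proof. by elim/quotW=> f; rewrite (L2oppE f) (L2addE (- f) f) addNr. Qed.

HB.instance Definition _ :=
  GRing.isZmodule.Build L2 L2addA L2addC L2add0 L2addN.

Lemma L2_piD : {morph \pi_L2 : f g / f + g}.
Proof. by move=> f g; rewrite -(L2addE f g). Qed.

Let L2scaleA a b x : L2scale a (L2scale b x) = L2scale (a * b) x.
Proof. by elim/quotW: x => f; rewrite (L2scaleE b f) (L2scaleE a) (L2scaleE (a * b) f) scalerA. Qed.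

Let L2scale1 : left_id 1 L2scale.
Proof. by elim/quotW=> f; rewrite (L2scaleE 1 f) scale1r. Qed.

Let L2scaleDr : right_distributive L2scale +%R.
Proof.
move=> a; elim/quotW=> f; elim/quotW=> g; rewrite -L2_piD.
by rewrite (L2scaleE a (f + g)) (L2scaleE a f) (L2scaleE a g) -L2_piD scalerDr.
Qed.

Let L2scaleDl x : {morph L2scale^~ x : a b / a + b}.
Proof. move=> a b; elim/quotW: x => f.
by rewrite (L2scaleE (a + b) f) (L2scaleE a f) (L2scaleE b f) -L2_piD scalerDl. Qed.

HB.instance Definition _ := GRing.Zmodule_isLmodule.Build C L2
  L2scaleA L2scale1 L2scaleDr L2scaleDl.

Lemma L2_piZ a : {morph \pi_L2 : f / a *: f}.
Proof. by move=> f; rewrite -(L2scaleE a f). Qed.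


Definition L2norm (x : L2) : R := Num.sqrt (fine (sq_integral (repr x))).

Lemma L2normE (f : L2fun) : L2norm (\pi_L2 f) = Num.sqrt (fine (sq_integral f)).
Proof.
congr (Num.sqrt (fine _)).
have /asboolP[r1 i1 _] := valP (repr (\pi_L2 f)).
have /asboolP[r2 i2 _] := valP f.
apply: ge0_ae_eq_integral => //=.
- exact: measurable_bidisk.
- by apply/measurable_EFinP; exact: measurable_normc2.
- by apply/measurable_EFinP; exact: measurable_normc2.
- by move=> p _; rewrite lee_fin sqr_ge0.
- by move=> p _; rewrite lee_fin sqr_ge0.
- by apply: filterS (L2reprP f) => p fp Dp; rewrite fp.
Qed.

Let L2normD x y : L2norm (x + y) <= L2norm x + L2norm y.
Proof.
elim/quotW: x => f; elim/quotW: y => g; rewrite -L2_piD !L2normE.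
have sf := L2fun_valP f; have sg := L2fun_valP g.
set a := fine (sq_integral f); set b := fine (sq_integral g).
have a0 : 0 <= a by apply/fine_ge0/sq_integral_ge0.
have b0 : 0 <= b by apply/fine_ge0/sq_integral_ge0.
apply/ler_addgt0Pr => e e0.
set u := Num.sqrt a + e / 2; set v := Num.sqrt b + e / 2.
have u0 : 0 < u by rewrite ltr_wpDl ?sqrtr_ge0// divr_gt0.
have v0 : 0 < v by rewrite ltr_wpDl ?sqrtr_ge0// divr_gt0.
have au : a <= u ^+ 2.
  rewrite -(sqr_sqrtr a0) ler_sqr ?nnegrE ?sqrtr_ge0 ?(ltW u0)//.
  by rewrite lerDl divr_ge0// ltW.
have bv : b <= v ^+ 2.
  rewrite -(sqr_sqrtr b0) ler_sqr ?nnegrE ?sqrtr_ge0 ?(ltW v0)//.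
  by rewrite lerDl divr_ge0// ltW.
rewrite (_ : _ + _ + e = u + v); last by rewrite /u /v; field.
have t0 : 0 < v / u by rewrite divr_gt0.
have := sq_integralD t0 sf sg.
rewrite -(sq_integralE sf) -(sq_integralE sg) -(sq_integralE (L2fun_valP (f + g))).
rewrite -!EFinM -EFinD lee_fin -/a -/b => h.
have uv0 : 0 <= u + v by rewrite addr_ge0// ltW.
rewrite -[u + v]ger0_norm// -sqrtr_sqr ler_wsqrtr//.
apply: (le_trans h); rewrite invf_div.
apply: (@le_trans _ _ ((1 + v / u) * u ^+ 2 + (1 + u / v) * v ^+ 2)).
  by rewrite lerD// ler_wpM2l// addr_ge0// divr_ge0 ?(ltW u0) ?(ltW v0).
rewrite le_eqVlt; apply/orP; left; apply/eqP; field.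
by rewrite !gt_eqF.
Qed.

Let L2normZ (a : C) x : L2norm (a *: x) = normc a * L2norm x.
Proof.
elim/quotW: x => f; rewrite -L2_piZ !L2normE [sq_integral _]sq_integralZ; last first.
  exact: L2fun_valP.
rewrite fineM//; last first.
  by rewrite -(sq_integralE (L2fun_valP f)).
by rewrite /= sqrtrM ?sqr_ge0// sqrtr_sqr ger0_norm// normc_ge0.
Qed.

Let L2norm_eq0 x : L2norm x = 0 -> x = 0.
Proof.
elim/quotW: x => f; rewrite L2normE => /eqP.
rewrite sqrtr_eq0 => f0; apply/L2eqP.
have {}f0 : sq_integral f = 0%E.
  apply/eqP; rewrite eq_le sq_integral_ge0 andbT.
  by rewrite -(sq_integralE (L2fun_valP f)) lee_fin.
have /asboolP[fr fi _] := valP f.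
have mf : measurable_fun D2 (fun p => (normc (f p) ^+ 2)%:E).
  by apply/measurable_EFinP; exact: measurable_normc2.
have /(ae_eq_integral_abs V (@measurable_bidisk R) mf) :
    (\int[V]_(p in D2) `|(normc (f p) ^+ 2)%:E|)%E = 0%E.
  rewrite -[RHS]f0; apply: eq_integral => p _.
  by rewrite gee0_abs// lee_fin sqr_ge0.
apply: filterS => p /= + Dp => /(_ Dp) [] /eqP.
by rewrite sqrf_eq0 => /eqP; exact: eq0_normc.
Qed.

Let L2normCD x y : (L2norm (x + y))%:C <= (L2norm x)%:C + (L2norm y)%:C.
Proof. by rewrite -rmorphD/= lecR. Qed.

Let L2normCZ (a : C) x : (L2norm (a *: x))%:C = `|a| * (L2norm x)%:C.
Proof. by rewrite L2normZ rmorphM. Qed.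

Let L2normC_eq0 x : (L2norm x)%:C = 0 -> x = 0.
Proof. by move=> [/L2norm_eq0]. Qed.

HB.instance Definition _ :=
  Lmodule_isNormed.Build C L2 L2normCD L2normCZ L2normC_eq0.

Definition complex_integral (h : C2 -> C) : C :=
  (\int[V]_(p in D2) complex.Re (h p)) +i* (\int[V]_(p in D2) complex.Im (h p)).

Definition L2dot (x y : L2) : C :=
  complex_integral (fun p => repr x p * conjc (repr y p)).

(* The class of f, with junk value 0 when f is not square integrable on the
   bidisk. *)
Definition to_L2 (f : C2 -> C) : L2 := \pi_L2 (insubd (0 : L2fun) f).

Definition holomorphic_on_bidisk (f : C2 -> C) : Prop :=
  forall p, D2 p -> differentiable f p.

(* A^2 is realised as the subspace of those classes of L^2 that have a
   holomorphic representative, with the norm of L^2.  Holomorphic means complex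
   differentiable, as a function of two complex variables, at every point. *)
Definition bergman : {pred L2} := fun x =>
  `[< exists2 f : L2fun, holomorphic_on_bidisk f & x = \pi_L2 f >].

Lemma bergman_submod : submod_closed bergman.
Proof.
split=> [|a x y /asboolP[f hf ->] /asboolP[g hg ->]].
  by apply/asboolP; exists 0 => // p _; exact: differentiable_cst.
apply/asboolP; exists (a *: f + g); last by rewrite L2_piD L2_piZ.
move=> p Dp; apply: differentiableD; last exact: hg.
by apply: differentiableZ; exact: hf.
Qed.

HB.instance Definition _ := GRing.isSubmodClosed.Build C L2
  bergman bergman_submod.

Record A2 := MkA2 { A2_val :> L2; A2_valP : A2_val \in bergman }.

HB.instance Definition _ := [isSub for A2_val].
HB.instance Definition _ := [Choice of A2 by <:].
HB.instance Definition _ := [SubChoice_isSubLmodule of A2 by <:].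

Let A2normD (x y : A2) : `|(x + y : A2) : L2| <= `|x : L2| + `|y : L2|.
Proof. exact: ler_normD. Qed.

Let A2normZ (a : C) (x : A2) : `|(a *: x : A2) : L2| = `|a| * `|x : L2|.
Proof. exact: normrZ. Qed.

Let A2norm_eq0 (x : A2) : `|x : L2| = 0 -> x = 0.
Proof. by move=> /normr0_eq0 x0; exact: val_inj. Qed.

HB.instance Definition _ :=
  Lmodule_isNormed.Build C A2 A2normD A2normZ A2norm_eq0.

(* Orthogonal projection onto A^2: the element h of A^2 such that g - h is
   orthogonal to A^2.  It is unique, and exists since A^2 is closed in L^2; the
   default value 0 is never used. *)
Definition bergman_proj (g : L2) : A2 :=
  xget 0 [set h : A2 | forall k : A2, L2dot (g - A2_val h) (A2_val k) = 0].

(* Multiplication by phi does not depend on the representative of f, and it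
   maps A^2 to L^2 when phi is bounded and measurable on the bidisk. *)
Definition hankel (phi : C2 -> C) (f : A2) : L2 :=
  let g := to_L2 (fun p => phi p * repr (A2_val f) p) in
  g - A2_val (bergman_proj g).

End square_integrable.

Section essential_norm.
Variables (R : realType) (X Y : normedModType R[i]).

Definition unit_ball : set X := [set x | `|x| <= 1].

Definition op_norm (T : X -> Y) : \bar R :=
  ereal_sup [set (complex.Re `|T x|)%:E | x in unit_ball].

Definition compact_operator (K : X -> Y) : Prop :=
  linear K /\ compact (closure (K @` unit_ball)).

Definition essential_norm (T : X -> Y) : \bar R :=
  ereal_inf [set op_norm (T \- K) | K in compact_operator].

End essential_norm.

Section differential_calculus.
Variable R : realType.
Local Notation C := R[i].
Local Notation C2 := (R[i] * R[i])%type.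
Local Notation RC := (Rcomplex R).

Definition partial_x (f : C -> C) (z : C) : C := 'D_(1 : RC) (f : RC -> RC) z.
Definition partial_y (f : C -> C) (z : C) : C := 'D_('i : RC) (f : RC -> RC) z.

(* Wirtinger derivative in the conjugate variable. *)
Definition dbar (f : C -> C) (z : C) : C :=
  2^-1 * (partial_x f z + 'i * partial_y f z).

(* For A open: both real first-order partial derivatives exist and are
   continuous on A. *)
Definition C1_on (A : set C) (f : C -> C) : Prop :=
  forall v : RC, v = 1 \/ v = 'i -> forall z, A z ->
    derivable (f : RC -> RC) z v /\
    {for z, continuous ('D_v (f : RC -> RC) : RC -> RC)}.

(* Twice continuously differentiable with vanishing Laplacian. *)
Definition harmonic_on (A : set C) (f : C -> C) : Prop :=
  [/\ C1_on A f, C1_on A (partial_x f), C1_on A (partial_y f) &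
      forall z, A z ->
        partial_x (partial_x f) z + partial_y (partial_y f) z = 0].

(* C^1 up to the boundary: phi is continuous on the closed bidisk and its four
   real first-order partial derivatives exist on the open bidisk and extend
   continuously to the closed one.  Values of phi elsewhere are irrelevant. *)
Definition C1_closed_bidisk (phi : C2 -> C) : Prop :=
  {within closure (@bidisk R), continuous phi} /\
  forall v : RC * RC,
    v \in [:: (1, 0); ('i, 0); (0, 1); (0, 'i)] ->
    exists2 g : C2 -> C, {within closure (@bidisk R), continuous g} &
      forall p, bidisk p ->
        derivable (phi : RC * RC -> RC) p v /\
        'D_v (phi : RC * RC -> RC) p = g p.

Definition boundary (T : topologicalType) (A : set T) : set T :=
  closure A `\` interior A.

(* F is given by its affine extension to C, but only its restriction to the unit
   disk is required to take values in the boundary. *)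
Definition circular_disks : set (C -> C2) :=
  [set F | exists p z : C2, [/\ boundary (@bidisk R) p, z != 0,
     F = (fun xi => xi *: z + p) & F @` (@disk R) `<=` boundary (@bidisk R)]].

Definition euclidean_norm (z : C2) : R :=
  Num.sqrt (normc z.1 ^+ 2 + normc z.2 ^+ 2).

Definition cis (t : R) : C := cos t +i* sin t.

End differential_calculus.

(* Main.v *)
Require Import Defs.
From HB Require Import structures.
From mathcomp Require Import all_boot all_order all_algebra complex.
From mathcomp Require Import all_classical all_reals all_analysis.
From mathcomp Require Import measurable_realfun ring lra.

Set Implicit Arguments.
Unset Strict Implicit.
Unset Printing Implicit Defensive.
Import Order.TTheory GRing.Theory Num.Theory.
Import numFieldNormedType.Exports.
Import Normc.
Local Open Scope classical_set_scope.
Local Open Scope ring_scope.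
Local Open Scope complex_scope.

(* A circular disk in the boundary of the bidisk is constant, equal to some om
   with |om| = 1, in one coordinate, and is xi |-> a * xi + b in the other one.
   With g := phi (_, om), the dbar-derivative of phi \o F at 0 is
   conj a * dbar g b, so it suffices to bound |dbar g b| * |a|^2 / sqrt 2 by the
   norm of H_phi - K for K compact.  For r < |a|^2, test H_phi - K on normalized
   powers f_j of the peak function (w + om) / 2 and pair the result, bilinearly,
   with e_j (z, w) := c (z - b) chi(|z - b|^2) conj(f_j(w)) 1_{|w - om| < 1/(j+1)}
   where chi(s) := 1 - (s / r)^(n+1) on [0, r], 0 beyond, and |c| = 1.
   - By Cauchy's theorem on disks centred at b, e_j annihilates the Bergman
     space, so the projection in H_phi disappears.
   - The supports of the e_j shrink to a null set, so e_j tends weakly to 0 and,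
     K being compact, K f_j disappears in the limit.
   - As |f_j|^2 concentrates at om, phi may be replaced by g; as g is harmonic,
     Green's formula gives
     \int g (z - b) chi = dbar g b * \int |z - b|^2 chi.
   Both integral identities reduce to a divergence theorem for differentiable
   fields with continuous divergence, proved by Goursat's bisection. *)

(** The constant |a|^2 / sqrt 2 is the L^2 norm of z - b on the disk |z - b| < |a|, relative to that
    of 1 on the whole unit disk, where the f_j are constant in z. Of the two factors |a|, one is
    |F'(0)| and the other comes from the chain rule. The indicator of that disk would be the natural
    weight, but it leaves boundary terms and may reach the unit circle, where g is not known to be
    harmonic. The weight chi vanishes at its edge and is supported inside the unit disk, so all
    fields extend by zero; the loss disappears as n grows and r tends to |a|^2. The projection is
    not explicit and K is arbitrary, so both are handled on the side of the e_j. Green's formula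
    alone does not evaluate \int g (z - b) chi: it shows that this integral scales like r^2, and a
    first-order expansion of g at b for small r then gives the value. Holomorphy means mere complex
    differentiability, with no continuity of the derivative; hence the bisection. *)

Section complex_modulus.
Variable R : realType.
Implicit Types z w : R[i].

Lemma complex_normrE z : `|z| = (normc z)%:C.
Proof. by []. Qed.

Lemma sqr_normcJ z : (normc z ^+ 2)%:C = z * conjc z.
Proof. by rewrite sqr_normcE; case: z => a b; apply/eqP; rewrite eq_complex/=; apply/andP; split; apply/eqP; ring. Qed.

Lemma normc_le_ReIm z : normc z <= `|complex.Re z| + `|complex.Im z|.
Proof.
rewrite -ler_sqr ?nnegrE ?addr_ge0 ?normc_ge0//.
rewrite sqr_normcE -(real_normK (num_real (complex.Re z))).
rewrite -(real_normK (num_real (complex.Im z))).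
have := mulr_ge0 (normr_ge0 (complex.Re z)) (normr_ge0 (complex.Im z)); nra.
Qed.

Lemma normRe_le z : `|complex.Re z| <= normc z.
Proof. by rewrite -lecR -complex_normrE; exact: normc_ge_Re. Qed.

Lemma normIm_le z : `|complex.Im z| <= normc z.
Proof.
rewrite -ler_sqr ?nnegrE ?normc_ge0// sqr_normcE -(real_normK (num_real (complex.Im z))).
by rewrite lerDr sqr_ge0.
Qed.

Lemma normc_real (x : R) : normc x%:C = `|x|.
Proof. by rewrite /= expr0n addr0 sqrtr_sqr. Qed.

Lemma normcB_sym z w : normc (z - w) = normc (w - z).
Proof. by rewrite -normcN opprB. Qed.

Lemma conjcB z w : conjc (z - w) = conjc z - conjc w.
Proof. exact: rmorphB. Qed.

Lemma normc_conj z : normc (conjc z) = normc z.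
Proof. by case: z => a b /=; rewrite sqrrN. Qed.

Lemma normcX z n : normc (z ^+ n) = normc z ^+ n.
Proof. by elim: n => [|n IH]; rewrite ?expr0 ?normc1// !exprS normcM IH. Qed.

Lemma normc_gt0 z : (0 < normc z) = (z != 0).
Proof.
rewrite lt_def normc_ge0 andbT; apply/idP/idP; apply: contraNN => /eqP.
  by move=> ->; rewrite normc0.
by move/eq0_normc => ->.
Qed.

Lemma normcB_tri z w x : normc (z - x) <= normc (z - w) + normc (w - x).
Proof. by rewrite (_ : z - x = (z - w) + (w - x)) ?le_normcD//; ring. Qed.

Lemma le_dist_normc z w : `|normc z - normc w| <= normc (z - w).
Proof.
have h1 := normcB_tri z w 0; have h2 := normcB_tri w z 0.
rewrite !subr0 in h1 h2; rewrite (normcB_sym w z) in h2.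
by rewrite ler_norml; apply/andP; split; lra.
Qed.

Lemma complex_ReIm (a : R[i]) : a = (complex.Re a)%:C + 'i%C * (complex.Im a)%:C.
Proof. exact: complexE. Qed.

End complex_modulus.

(** * Continuity with real tolerances *)

Section continuity.
Variable R : realType.
Local Notation C := R[i].
Implicit Types (f g : C -> C) (z w : C).

(** The norm of [R[i]] is complex-valued; real tolerances in [normc] spare a conversion in every
    estimate. *)
Definition ccontinuous f z := forall e : R, 0 < e ->
  exists2 d, 0 < d & forall w, normc (w - z) < d -> normc (f w - f z) < e.

Lemma ccontinuousP f z : {for z, continuous f} <-> ccontinuous f z.
Proof.
split=> [cf e e0|cf].
  have e0' : 0 < e%:C :> C by rewrite -[0]/(0%:C) ltcR.
  have /cvgrPdist_lt/(_ _ e0') := cf.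
  move=> /nbhs_ballP[/= d d0 H].
  have d1 : d = (complex.Re d)%:C by rewrite RRe_real// gtr0_real.
  rewrite d1 -[0]/(0%:C) ltcR in d0.
  exists (complex.Re d) => // w wz.
  have := H w; rewrite normcB_sym -ltcR -complex_normrE; apply.
  by rewrite -ball_normE/= d1 complex_normrE ltcR normcB_sym.
rewrite /prop_for /continuous_at.
apply: (proj2 (@cvgrPdist_lt _ _ _ (nbhs z) _ f (f z))) => e e0.
have e1 : e = (complex.Re e)%:C by rewrite RRe_real// gtr0_real.
rewrite e1 -[0]/(0%:C) ltcR in e0.
have [d d0 H] := cf _ e0.
rewrite -nbhs_ballE; exists d%:C; first by rewrite /= -[0]/(0%:C) ltcR.
move=> w; rewrite -ball_normE/= complex_normrE ltcR => zw.
by rewrite e1 complex_normrE ltcR normcB_sym H// normcB_sym.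
Qed.

Lemma ccontinuousD f g z : ccontinuous f z -> ccontinuous g z ->
  ccontinuous (fun w => f w + g w) z.
Proof. by move=> /ccontinuousP cf /ccontinuousP cg; apply/ccontinuousP; exact: (cvgD cf cg). Qed.

Lemma ccontinuousM f g z : ccontinuous f z -> ccontinuous g z ->
  ccontinuous (fun w => f w * g w) z.
Proof. by move=> /ccontinuousP cf /ccontinuousP cg; apply/ccontinuousP; exact: (cvgM cf cg). Qed.

Lemma ccontinuous_cst (c : C) z : ccontinuous (fun=> c) z.
Proof. by apply/ccontinuousP; exact: cst_continuous. Qed.

Lemma ccontinuous_id z : ccontinuous id z.
Proof. by move=> e e0; exists e. Qed.

Lemma ccontinuous_Re f z : ccontinuous f z -> ccontinuous (fun w => (complex.Re (f w))%:C) z.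
Proof.
move=> cf e e0; have [d d0 H] := cf e e0; exists d => // w /H.
apply: le_lt_trans; rewrite -rmorphB normc_real.
by rewrite (_ : _ - _ = complex.Re (f w - f z)) ?normRe_le// raddfB.
Qed.

End continuity.

(** * Real differentiability *)

Section real_differentiability.
Variable R : realType.
Local Notation C := R[i].
Implicit Types (f g : C -> C) (z w : C).

(* Caratheodory form of real differentiability: the factorization makes the
   product rule purely algebraic. *)
Definition rdiff f z (fx fy : C) := exists A B : C -> C,
  [/\ ccontinuous A z, ccontinuous B z, A z = fx, B z = fy &
      forall w, f w = f z + A w * (complex.Re (w - z))%:C + B w * (complex.Im (w - z))%:C].

(** For the converse, the remainder [r w] is multiplied by 1 = (Re (w - z) ^ 2 + Im (w - z) ^ 2) /
    |w - z| ^ 2, and each of the two terms is absorbed into one factor. *)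
Lemma rdiffP f z fx fy : rdiff f z fx fy <->
  forall e : R, 0 < e -> exists2 d, 0 < d & forall w, normc (w - z) < d ->
   normc (f w - f z - fx * (complex.Re (w - z))%:C - fy * (complex.Im (w - z))%:C)
     <= e * normc (w - z).
Proof.
split=> [[A [B [cA cB Az Bz fE]]] e e0|H].
  have e2 : 0 < e / 2 by rewrite divr_gt0.
  have [dA dA0 HA] := cA _ e2; have [dB dB0 HB] := cB _ e2.
  exists (Num.min dA dB); first by rewrite lt_min dA0.
  move=> w; rewrite lt_min => /andP[/HA{}HA /HB{}HB].
  rewrite fE -Az -Bz [X in normc X](_ : _ = (A w - A z) * (complex.Re (w - z))%:C + (B w - B z) * (complex.Im (w - z))%:C); last by ring.
  apply: le_trans (le_normcD _ _) _; rewrite !normcM !normc_real.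
  have h1 := normRe_le (w - z); have h2 := normIm_le (w - z).
  have h3 := normc_ge0 (w - z); have h4 := normc_ge0 (A w - A z); have h5 := normc_ge0 (B w - B z).
  have i1 : normc (A w - A z) * `|complex.Re (w - z)| <= e / 2 * normc (w - z).
    by apply: ler_pM => //; exact: ltW.
  have i2 : normc (B w - B z) * `|complex.Im (w - z)| <= e / 2 * normc (w - z).
    by apply: ler_pM => //; exact: ltW.
  lra.
pose r w := f w - f z - fx * (complex.Re (w - z))%:C - fy * (complex.Im (w - z))%:C.
(* At w = z the inverse of 0 is 0, so the corrections to [fx] and [fy] vanish there. *)
pose q w : R := (normc (w - z) ^+ 2)^-1.
have key u (e : R) w : 0 <= e -> normc (r w) <= e * normc (w - z) ->
    `|u| <= normc (w - z) -> normc (r w * (u * q w)%:C) <= e.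
  move=> e0 rw uw; have [wz|wz] := eqVneq w z.
    by rewrite /q wz subrr normc0 expr0n/= invr0 mulr0 (_ : 0%:C = 0)// mulr0 normc0.
  have n0 : 0 < normc (w - z) by rewrite normc_gt0 subr_eq0.
  rewrite normcM normc_real normrM /q (@ger0_norm _ (_ ^-1)) ?invr_ge0 ?sqr_ge0//.
  rewrite mulrA ler_pdivrMr ?exprn_gt0// expr2 mulrA.
  by apply: ler_pM => //; exact: normc_ge0.
have qz : q z = 0 by rewrite /q subrr normc0 expr0n/= invr0.
have cont (u : C -> R) c : (forall w, `|u w| <= normc (w - z)) ->
    ccontinuous (fun w => c + r w * (u w * q w)%:C) z.
  move=> uw e e0; have e2 : 0 < e / 2 by rewrite divr_gt0.
  have [d d0 Hd] := H _ e2; exists d => // w wd.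
  rewrite qz mulr0 (_ : 0%:C = 0)// mulr0 addr0.
  rewrite [c + _]addrC addrK (le_lt_trans (key _ _ _ (ltW e2) (Hd _ wd) (uw _)))//.
  by rewrite ltr_pdivrMr// ltr_pMr// ltr1n.
exists (fun w => fx + r w * (complex.Re (w - z) * q w)%:C).
exists (fun w => fy + r w * (complex.Im (w - z) * q w)%:C).
split.
- by apply: cont => w; exact: normRe_le.
- by apply: cont => w; exact: normIm_le.
- by rewrite qz mulr0 (_ : 0%:C = 0)// mulr0 addr0.
- by rewrite qz mulr0 (_ : 0%:C = 0)// mulr0 addr0.
move=> w; have [->|wz] := eqVneq w z.
  by rewrite subrr (_ : (complex.Re 0)%:C = 0)// !mulr0 !addr0.
have qw : (complex.Re (w - z))%:C ^+ 2 * (q w)%:C + (complex.Im (w - z))%:C ^+ 2 * (q w)%:C = 1.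
  rewrite -!rmorphXn -!rmorphM -rmorphD/= -mulrDl -sqr_normcE mulfV//.
  by rewrite expf_neq0// gt_eqF// normc_gt0 subr_eq0.
rewrite [LHS](_ : _ = f z + fx * (complex.Re (w - z))%:C + fy * (complex.Im (w - z))%:C + r w); last by rewrite /r; ring.
by rewrite -{1}[r w]mulr1 -qw !rmorphM/=; ring.
Qed.

Lemma rdiff_near f g z fx fy (d : R) : 0 < d ->
  (forall w, normc (w - z) < d -> f w = g w) -> rdiff f z fx fy -> rdiff g z fx fy.
Proof.
move=> d0 fg /rdiffP H; apply/rdiffP => e /H[d' d'0 {}H].
exists (Num.min d d'); first by rewrite lt_min d0.
move=> w; rewrite lt_min => /andP[wd wd']; rewrite -!fg//; first exact: H.
by rewrite subrr normc0.
Qed.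

Lemma rdiff_ccontinuous f z fx fy : rdiff f z fx fy -> ccontinuous f z.
Proof.
move=> [A [B [cA cB _ _ fE]]]; rewrite (funext fE).
apply: ccontinuousD; first apply: ccontinuousD; first exact: ccontinuous_cst.
  apply: ccontinuousM => //; apply: ccontinuous_Re.
  by apply: ccontinuousD; [exact: ccontinuous_id|exact: ccontinuous_cst].
apply: ccontinuousM => //.
have -> : (fun w => (complex.Im (w - z))%:C) = (fun w => (complex.Re (- 'i%C * (w - z)))%:C).
  by apply/funext => w; congr _%:C; case: (w - z) => a b /=; ring.
apply: ccontinuous_Re; apply: ccontinuousM; first exact: ccontinuous_cst.
by apply: ccontinuousD; [exact: ccontinuous_id|exact: ccontinuous_cst].
Qed.

Lemma rdiff_cst (c : C) z : rdiff (fun=> c) z 0 0.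
Proof.
exists (fun=> 0), (fun=> 0); split=> //; try exact: ccontinuous_cst.
by move=> w; rewrite !mul0r !addr0.
Qed.

Lemma rdiff_id z : rdiff id z 1 'i%C.
Proof.
exists (fun=> 1), (fun=> 'i%C); split=> //; try exact: ccontinuous_cst.
by move=> w; rewrite -addrA mul1r -complex_ReIm addrC subrK.
Qed.

Lemma rdiff_conj z : rdiff (fun w => conjc w) z 1 (- 'i%C).
Proof.
exists (fun=> 1), (fun=> - 'i%C); split=> //; try exact: ccontinuous_cst.
move=> w; rewrite -{1}[w](subrK z) rmorphD/= addrC -addrA; congr (_ + _).
by case: (w - z) => a b; apply/eqP; rewrite eq_complex/=; apply/andP; split; apply/eqP; ring.
Qed.

Lemma rdiffD f g z fx fy gx gy : rdiff f z fx fy -> rdiff g z gx gy ->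
  rdiff (fun w => f w + g w) z (fx + gx) (fy + gy).
Proof.
move=> [A [B [cA cB <- <- fE]]] [A' [B' [cA' cB' <- <- gE]]].
exists (fun w => A w + A' w), (fun w => B w + B' w); split => //.
- exact: ccontinuousD.
- exact: ccontinuousD.
- by move=> w; rewrite fE gE; ring.
Qed.

Lemma rdiffM f g z fx fy gx gy : rdiff f z fx fy -> rdiff g z gx gy ->
  rdiff (fun w => f w * g w) z (fx * g z + f z * gx) (fy * g z + f z * gy).
Proof.
move=> df dg; have cg := rdiff_ccontinuous dg.
move: df dg => [A [B [cA cB <- <- fE]]] [A' [B' [cA' cB' <- <- gE]]].
exists (fun w => A w * g w + f z * A' w), (fun w => B w * g w + f z * B' w); split => //.
- by apply: ccontinuousD; apply: ccontinuousM => //; exact: ccontinuous_cst.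
- by apply: ccontinuousD; apply: ccontinuousM => //; exact: ccontinuous_cst.
- by move=> w; rewrite {1}fE mulrDl mulrDl {1}gE; ring.
Qed.

Lemma rdiffZ (c : C) f z fx fy : rdiff f z fx fy ->
  rdiff (fun w => c * f w) z (c * fx) (c * fy).
Proof.
by move=> df; have := rdiffM (rdiff_cst c z) df; rewrite !mul0r !add0r.
Qed.

Lemma rdiffB f g z fx fy gx gy : rdiff f z fx fy -> rdiff g z gx gy ->
  rdiff (fun w => f w - g w) z (fx - gx) (fy - gy).
Proof.
move=> df dg; have := rdiffD df (rdiffZ (-1) dg).
by rewrite !mulN1r; under eq_fun do rewrite mulN1r.
Qed.

Lemma rdiff_eq f z fx fy fx' fy' : rdiff f z fx fy -> fx = fx' -> fy = fy' ->
  rdiff f z fx' fy'.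
Proof. by move=> + <- <-. Qed.

Lemma rdiff_compR (K : R -> R) (dK : R) (s : C -> R) z sx sy :
  rdiff (fun w => (s w)%:C) z sx sy -> is_derive (s z) 1 K dK ->
  rdiff (fun w => (K (s w))%:C) z (dK%:C * sx) (dK%:C * sy).
Proof.
move=> ds dKs; have cs := rdiff_ccontinuous ds.
(* Caratheodory factor of the outer function; with it the chain rule is a product of factors. *)
pose k t := if t == s z then dK else (K t - K (s z)) / (t - s z).
have ck (e : R) : 0 < e -> exists2 d : R, 0 < d & forall t : R, `|t - s z| < d -> `|k t - dK| < e.
  move=> e0; have [/cvg_ex[/= l Hl] dl] := dKs.
  have {dl}dl : l = dK by rewrite -dl; apply/esym/cvg_lim.
  move: Hl; rewrite dl => /cvgrPdist_lt/(_ e e0); rewrite /prop_near1 /within/= near_simpl.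
  move=> /nbhs_ballP[d/= d0 Hd]; exists d => // t td.
  rewrite /k; case: eqP => [_|/eqP tz]; first by rewrite subrr normr0.
  have := Hd (t - s z); rewrite /ball/= sub0r normrN => /(_ td).
  rewrite subr_eq0 => /(_ tz); rewrite /GRing.scale/= mulr1 subrK.
  by rewrite mulrC => h; rewrite distrC.
have cks : ccontinuous (fun w => (k (s w))%:C) z.
  move=> e /ck[d d0 Hd]; have [d' d'0 Hd'] := cs _ d0.
  exists d' => // w /Hd'; rewrite -!rmorphB !normc_real => /Hd.
  by rewrite [k (s z)]/k eqxx.
move: ds => [A [B [cA cB <- <- sE]]].
exists (fun w => (k (s w))%:C * A w), (fun w => (k (s w))%:C * B w); split => //.
- exact: ccontinuousM.
- exact: ccontinuousM.
- by rewrite /k eqxx.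
- by rewrite /k eqxx.
move=> w; have -> : (K (s w))%:C = (K (s z))%:C + (k (s w))%:C * ((s w)%:C - (s z)%:C).
  rewrite -rmorphB -rmorphM -rmorphD/=; congr _%:C.
  rewrite /k; case: eqP => [->|/eqP nz]; first by rewrite subrr mulr0 addr0.
  by rewrite divfK ?subr_eq0// addrC subrK.
by rewrite [X in X - _]sE; ring.
Qed.

(** The differential is multiplication by the complex derivative, so its value at 'i is 'i times its
    value at 1: the Cauchy-Riemann equations. *)
Lemma rdiff_holomorphic (F : C -> C) (z : C) : derivable F z 1 ->
  rdiff F z (derive1 F z) ('i%C * derive1 F z).
Proof.
move=> dF; apply/rdiffP => e e0.
have e0' : 0 < e%:C :> C by rewrite -[0]/(0%:C) ltcR.
move/cvg_ex : dF => [/= l Hl].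
have -> : derive1 F z = l by rewrite derive1E; apply/cvg_lim.
move: Hl => /cvgrPdist_lt/(_ _ e0'); rewrite /prop_near1 /within/= near_simpl.
move=> /nbhs_ballP[d/= d0 Hd].
have d1 : d = (complex.Re d)%:C by rewrite RRe_real// gtr0_real.
rewrite d1 -[0]/(0%:C) ltcR in d0; exists (complex.Re d) => // w wd.
rewrite [X in normc X](_ : _ = F w - F z - l * (w - z)); last first.
  rewrite {3}(complex_ReIm (w - z)); ring.
have [->|wz] := eqVneq w z; first by rewrite !subrr mulr0 subr0 normc0 mulr0.
have := Hd (w - z); rewrite -ball_normE/= sub0r normrN d1 complex_normrE ltcR => /(_ wd).
rewrite subr_eq0 => /(_ wz); rewrite /GRing.scale/= mulr1 subrK complex_normrE ltcR => h.
rewrite [X in normc X](_ : _ = - ((l - (w - z)^-1 * (F w - F z)) * (w - z))); last first.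
  by field; rewrite subr_eq0.
by rewrite normcN normcM ler_wpM2r ?normc_ge0// ltW.
Qed.

(** Derivative along [v] at real steps, stated in [R[i]] so that the alias [Rcomplex R] does not
    enter the estimates. *)
Definition has_dderiv f z v (D : C) := forall e : R, 0 < e ->
  exists2 d, 0 < d & forall h : R, `|h| < d ->
    normc (f (z + h%:C * v) - f z - h%:C * D) <= e * `|h|.

Lemma derivable_has_dderiv f z v :
  derivable (f : Rcomplex R -> Rcomplex R) z (v : Rcomplex R) ->
  has_dderiv f z v ('D_(v : Rcomplex R) (f : Rcomplex R -> Rcomplex R) z).
Proof.
move=> df e e0; move/cvg_ex : df => [/= l Hl].
have -> : 'D_(v : Rcomplex R) (f : Rcomplex R -> Rcomplex R) z = l by apply/cvg_lim.
move: Hl => /cvgrPdist_lt/(_ _ e0); rewrite /prop_near1 /within/= near_simpl.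
move=> /nbhs_ballP[d/= d0 Hd]; exists d => // h hd.
have scE (x : R) (y : C) : x%:C * y = (x *: (y : Rcomplex R)).
  by case: y => a b; apply/eqP; rewrite eq_complex/= !mul0r subr0 addr0 !eqxx.
have [->|h0] := eqVneq h 0.
  by rewrite (_ : 0%:C = 0)// !mul0r addr0 subrr subr0 normc0 normr0 mulr0.
have := Hd h; rewrite /ball/= sub0r normrN => /(_ hd h0) {}Hd.
rewrite [X in normc X](_ : _ = - (h%:C * (l - h^-1 *: (f (h *: v + z) - f z : Rcomplex R)))); last first.
  rewrite -scE -scE [_ + z]addrC (rmorphV) ?unitfE//=; field.
  by apply/eqP => -[/eqP]; rewrite (negbTE h0).
by rewrite normcN normcM normc_real mulrC ler_wpM2r// ltW.
Qed.

Lemma is_derive_eps (k : R -> R) (x dk : R) :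
  (forall e : R, 0 < e -> exists2 d : R, 0 < d & forall h : R, `|h| < d ->
     `|k (x + h) - k x - h * dk| <= e * `|h|) -> is_derive x 1 k dk.
Proof.
move=> H.
have : (fun h => h^-1 *: ((k \o shift x) (h *: 1) - k x)) @ 0^' --> dk.
  apply/cvgrPdist_le => e e0; have [d d0 Hd] := H _ e0.
  rewrite /prop_near1 /within/= near_simpl; apply/nbhs_ballP; exists d => //= h.
  rewrite /ball/= sub0r normrN => hd h0.
  rewrite [X in `|X|](_ : _ = - (h^-1 * (k (x + h) - k x - h * dk))); last first.
    by rewrite /GRing.scale/= mulr1 [h + x]addrC; field.
  rewrite normrN normrM normfV -ler_pdivlMl ?invr_gt0 ?normr_gt0// invrK.
  by rewrite [leRHS]mulrC; exact: Hd.
by move=> Hc; apply: DeriveDef; [apply/cvg_ex; exists dk|apply/cvg_lim].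
Qed.

Lemma MVT_le (k dk : R -> R) (m e u : R) :
  (forall t : R, `|t| <= `|u| -> is_derive t 1 k (dk t) /\ `|dk t - m| <= e) ->
  `|k u - k 0 - m * u| <= e * `|u|.
Proof.
move=> H; have [u0|u0] := leP 0 u.
  have [c cu ->] : exists2 c, c \in `[0, u]%R & k u - k 0 = dk c * (u - 0).
    apply: MVT_segment => // [x|].
      rewrite in_itv/= => /andP[x0 xu]; suff /H[] : `|x| <= `|u| by [].
      by rewrite !ger0_norm// ltW.
    apply: derivable_within_continuous => x; rewrite in_itv/= => /andP[x0 xu].
    by have [[]] : is_derive x 1 k (dk x) /\ `|dk x - m| <= e by apply: H; rewrite !ger0_norm.
  move: cu; rewrite in_itv/= => /andP[c0 cu]; rewrite subr0 -mulrBl normrM ler_wpM2r//.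
  by suff /H[] : `|c| <= `|u| by []; rewrite !ger0_norm.
have [c cu E] : exists2 c, c \in `[u, 0]%R & k 0 - k u = dk c * (0 - u).
  apply: MVT_segment => // [|x|]; first exact: ltW.
    rewrite in_itv/= => /andP[xu x0]; suff /H[] : `|x| <= `|u| by [].
    by rewrite !ltr0_norm// lerN2 ltW.
  apply: derivable_within_continuous => x; rewrite in_itv/= => /andP[xu x0].
  by have [[]] : is_derive x 1 k (dk x) /\ `|dk x - m| <= e by apply: H; rewrite (ltr0_norm u0) ler0_norm// lerN2.
move: cu; rewrite in_itv/= => /andP[cu c0].
rewrite (_ : _ - m * u = (dk c - m) * u); last by rewrite -(opprB (k 0)) E; ring.
rewrite normrM ler_wpM2r//.
by suff /H[] : `|c| <= `|u| by []; rewrite (ltr0_norm u0) ler0_norm// lerN2.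
Qed.

(** The mean value theorem fails for complex values; it is applied to the real and the imaginary
    part, which costs the factor 2. *)
Lemma dderiv_path_le f z v (D : R -> C) (m : C) (e u : R) :
  (forall t : R, `|t| <= `|u| -> has_dderiv f (z + t%:C * v) v (D t) /\ normc (D t - m) <= e) ->
  normc (f (z + u%:C * v) - f z - u%:C * m) <= 2 * e * `|u|.
Proof.
move=> H.
have ReB (x y : C) : complex.Re (x - y) = complex.Re x - complex.Re y by rewrite raddfB.
have ImB (x y : C) : complex.Im (x - y) = complex.Im x - complex.Im y by rewrite raddfB.
have ReZ (x : R) (y : C) : complex.Re (x%:C * y) = x * complex.Re y.
  by case: y => a b /=; rewrite mul0r subr0.
have ImZ (x : R) (y : C) : complex.Im (x%:C * y) = x * complex.Im y.
  by case: y => a b /=; rewrite mul0r addr0.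
have dRe (t : R) : `|t| <= `|u| -> is_derive t 1 (fun t => complex.Re (f (z + t%:C * v))) (complex.Re (D t))
   /\ `|complex.Re (D t) - complex.Re m| <= e.
  move=> /H[Ht Dm]; split; last by rewrite -ReB; apply: le_trans Dm; exact: normRe_le.
  apply: is_derive_eps => e' /Ht[d d0 {}Ht]; exists d => // h /Ht.
  apply: le_trans; rewrite -ReZ -!ReB; apply: le_trans (normRe_le _) _.
  by rewrite rmorphD/= mulrDl addrA.
have dIm (t : R) : `|t| <= `|u| -> is_derive t 1 (fun t => complex.Im (f (z + t%:C * v))) (complex.Im (D t))
   /\ `|complex.Im (D t) - complex.Im m| <= e.
  move=> /H[Ht Dm]; split; last by rewrite -ImB; apply: le_trans Dm; exact: normIm_le.
  apply: is_derive_eps => e' /Ht[d d0 {}Ht]; exists d => // h /Ht.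
  apply: le_trans; rewrite -ImZ -!ImB; apply: le_trans (normIm_le _) _.
  by rewrite rmorphD/= mulrDl addrA.
have := MVT_le dRe; have := MVT_le dIm.
rewrite (_ : 0%:C = 0)// mul0r addr0 ![_ m * u]mulrC -ReZ -ImZ -!ReB -!ImB.
have := normc_le_ReIm (f (z + u%:C * v) - f z - u%:C * m).
set a := normc _; set b := `| _ |; set c := `| _ |; lra.
Qed.

(** From z to w one moves along a horizontal and then a vertical segment. On each, the relevant
    partial derivative stays within e / 4 of its value at z; the factor 2 of [dderiv_path_le] and
    the two segments add up to e. *)
Lemma C1_rdiff (A : set C) f z (r : R) : C1_on A f -> 0 < r ->
  (forall w, normc (w - z) < r -> A w) ->
  rdiff f z (partial_x f z) (partial_y f z).
Proof.
move=> fC1 r0 rA; apply/rdiffP => e e0.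
have Az : A z by apply: rA; rewrite subrr normc0.
have e4 : 0 < e / 4 by rewrite divr_gt0.
have part (v : Rcomplex R) : v = 1 \/ v = 'i%C -> exists2 d, 0 < d & forall w, normc (w - z) < d ->
   has_dderiv f w v ('D_v (f : Rcomplex R -> Rcomplex R) w) /\
   normc ('D_v (f : Rcomplex R -> Rcomplex R) w - 'D_v (f : Rcomplex R -> Rcomplex R) z : C) <= e / 4.
  move=> hv; have [_] := fC1 v hv z Az.
  move=> /cvgrPdist_lt/(_ _ e4) /nbhs_ballP[d/= d0 Hd].
  exists (Num.min d r); first by rewrite lt_min d0.
  move=> w; rewrite lt_min => /andP[wd wr]; split.
    by apply: derivable_has_dderiv; have [] := fC1 v hv w (rA _ wr).
  rewrite normcB_sym ltW// Hd// -ball_normE/= -[`|_|]/(normc (z - w)) normcB_sym//.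
have [d1 d10 H1] := part 1 (or_introl erefl).
have [d2 d20 H2] := part 'i%C (or_intror erefl).
exists (Num.min d1 d2); first by rewrite lt_min d10.
move=> w; rewrite lt_min => /andP[wd1 wd2].
set u := complex.Re (w - z); set v := complex.Im (w - z).
have hu : `|u| <= normc (w - z) by exact: normRe_le.
have hv : `|v| <= normc (w - z) by exact: normIm_le.
have wE : w = z + u%:C * 1 + v%:C * 'i%C.
  by rewrite mulr1 -addrA [v%:C * _]mulrC -complex_ReIm addrC subrK.
have i1 : normc (f (z + u%:C * 1) - f z - u%:C * partial_x f z) <= 2 * (e / 4) * `|u|.
  apply: (@dderiv_path_le f z 1 (fun t => partial_x f (z + t%:C * 1))) => t tu; apply: H1.
  rewrite [X in normc X](_ : _ = t%:C); last by ring.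
  by rewrite normc_real; apply: le_lt_trans tu _; exact: le_lt_trans wd1.
have i2 : normc (f (z + u%:C * 1 + v%:C * 'i%C) - f (z + u%:C * 1) - v%:C * partial_y f z) <= 2 * (e / 4) * `|v|.
  apply: (@dderiv_path_le f _ 'i%C (fun t => partial_y f (z + u%:C * 1 + t%:C * 'i%C))) => t tv; apply: H2.
  rewrite (_ : _ - z = u +i* t); last first.
    rewrite [LHS](_ : _ = u%:C + t%:C * 'i%C); last by ring.
    by apply/eqP; rewrite eq_complex/= !mul0r !mulr0 mulr1 subr0 !addr0 add0r !eqxx.
  apply: le_lt_trans wd2; rewrite -ler_sqr ?nnegrE ?normc_ge0// !sqr_normcE/= lerD2l.
  by rewrite -(real_normK (num_real t)) -[leRHS](real_normK (num_real _)) ler_sqr ?nnegrE.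
have -> : f w - f z - partial_x f z * u%:C - partial_y f z * v%:C =
  (f (z + u%:C * 1) - f z - u%:C * partial_x f z) +
  (f (z + u%:C * 1 + v%:C * 'i%C) - f (z + u%:C * 1) - v%:C * partial_y f z).
  by rewrite -wE; ring.
apply: le_trans (le_normcD _ _) _; apply: le_trans (lerD i1 i2) _.
by have := normc_ge0 (w - z); nra.
Qed.

End real_differentiability.

(** * Measurability from a countable base *)

Section measurable_basis.
Variable R : realType.

(** A countable base of measurable sets, the link between the sigma-algebra and the metric through
    which continuity yields measurability, also on products. *)
Definition measurable_basis d (X : measurableType d) (dist : X -> X -> R) :=
  exists (I : countType) (A : I -> set X), (forall i, measurable (A i)) /\
    forall x e, 0 < e -> exists2 i, A i x & forall y, A i y -> dist y x < e.

Lemma measurable_basisR : @measurable_basis _ (measurableTypeR R) (fun x y => `|x - y|).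
Proof.
exists (rat * rat)%type, (fun q => `](ratr q.1 - ratr q.2 : R), (ratr q.1 + ratr q.2)[%classic).
split=> [i|x e e0]; first exact: measurable_itv.
have [r] := @rat_in_itvoo R (e / 4) (e / 2) ltac:(lra).
have [q] := @rat_in_itvoo R (x - e / 4) (x + e / 4) ltac:(lra).
rewrite !in_itv/= => /andP[q1 q2] /andP[r1 r2]; exists (q, r) => /=.
  by rewrite in_itv/=; apply/andP; split; lra.
by move=> y; rewrite in_itv/= => /andP[y1 y2]; rewrite ltr_norml; apply/andP; split; lra.
Qed.

Lemma measurable_basisX d1 (X : measurableType d1) (dX : X -> X -> R)
    d2 (Y : measurableType d2) (dY : Y -> Y -> R) :
  measurable_basis dX -> measurable_basis dY ->
  measurable_basis (fun p q : X * Y => Num.max (dX p.1 q.1) (dY p.2 q.2)).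
Proof.
move=> [I [A [mA HA]]] [J [B [mB HB]]].
exists (I * J)%type, (fun i => A i.1 `*` B i.2); split=> [i|[x y] e e0].
  exact: measurableX.
have [i Aix Hi] := HA x e e0; have [j Bjy Hj] := HB y e e0.
exists (i, j) => // -[x' y'] [/= /Hi h1 /Hj h2]; by rewrite gt_max h1.
Qed.

Lemma measurable_basisC : measurable_basis (fun z w : R[i] => normc (z - w)).
Proof.
have [I [A [mA HA]]] := measurable_basisX measurable_basisR measurable_basisR.
exists I, (fun i => @complex_pair R @^-1` A i); split=> [i|z e e0].
  by rewrite -[X in measurable X]setTI; exact: measurable_complex_pair.
have [i Ai Hi] := HA (complex_pair z) (e / 2) ltac:(lra).
exists i => // w /Hi; rewrite gt_max/= => /andP[h1 h2].
apply: le_lt_trans (normc_le_ReIm _) _.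
rewrite !raddfB/=; lra.
Qed.

(** Within D, the set where f > a is the union of the countably many base sets on whose trace f
    exceeds a. *)
Lemma measurable_basis_fun d (X : measurableType d) (dist : X -> X -> R)
    (D : set X) (f : X -> R) : measurable_basis dist -> measurable D ->
  (forall x, D x -> forall e, 0 < e -> exists2 d, 0 < d &
     forall y, D y -> dist y x < d -> `|f y - f x| < e) ->
  measurable_fun D f.
Proof.
move=> [I [A [mA HA]]] mD cf.
apply: (measurability _ (RGenOInfty.measurableE R)) => _ [_ [a ->] <-].
pose J i := forall y, D y -> A i y -> a < f y.
have -> : D `&` f @^-1` `]a, +oo[%classic = D `&` \bigcup_i (if `[< J i >] then A i else set0).
  rewrite eqEsubset; split=> x [Dx]; rewrite /= in_itv/= ?andbT => fx; split => //.
    have [e e0 He] := cf x Dx (f x - a) ltac:(lra).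
    have [i Ai Hi] := HA x e e0; exists i => //; case: asboolP => // -[y Dy /Hi yx].
    by have := He y Dy yx; rewrite ltr_norml => /andP[]; lra.
  by case: fx => i _; case: asboolP => // Ji Ai; exact: Ji.
apply: measurableI => //; apply: countable_bigcupT_measurable => [|i]; first exact: countableP.
by case: ifP.
Qed.

End measurable_basis.

(** * The divergence theorem *)

Section quarter_bisection.
Variable R : realType.

(** Goursat's argument for an additive square function: if J is nonzero on some square, quarters can
    be chosen so that |J| loses at most a factor 4 at each step, while near the limit point |J| is
    at most a small multiple of the area, which itself loses exactly a factor 4. *)
Lemma quarter_bisection (J : R -> R -> R -> R) :
  (forall a c l, 0 < l -> J a c l = J a c (l / 2) + J (a + l / 2) c (l / 2)
     + J a (c + l / 2) (l / 2) + J (a + l / 2) (c + l / 2) (l / 2)) ->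
  (forall x y e, 0 < e -> exists2 d, 0 < d & forall a c l, 0 < l -> l < d ->
     a <= x <= a + l -> c <= y <= c + l -> `|J a c l| <= e * l ^+ 2) ->
  forall a c l, 0 < l -> J a c l = 0.
Proof.
move=> Jadd Jloc a0 c0 l0 l00; apply/eqP; apply: contraT => J0.
(* A triple is a lower left corner and a side length. By additivity one of the four quarters carries
   at least a quarter of |J|. *)
have step (s : R * R * R) : exists t : R * R * R, 0 < s.2 -> t.2 = s.2 / 2 /\ [/\
    s.1.1 <= t.1.1, t.1.1 + t.2 <= s.1.1 + s.2, s.1.2 <= t.1.2, t.1.2 + t.2 <= s.1.2 + s.2 &
    `|J s.1.1 s.1.2 s.2| <= 4 * `|J t.1.1 t.1.2 t.2|].
  case: s => -[a c] l /=; have [l0'|] := boolP (0 < l); last by exists (a, c, l).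
  have := Jadd a c l l0'.
  set J1 := J a c (l / 2); set J2 := J (a + l / 2) c (l / 2).
  set J3 := J a (c + l / 2) (l / 2); set J4 := J (a + l / 2) (c + l / 2) (l / 2) => E.
  have [h1|h1] := leP `|J a c l| (4 * `|J1|).
    by exists (a, c, l / 2) => _ /=; split => //; split => //; lra.
  have [h2|h2] := leP `|J a c l| (4 * `|J2|).
    by exists (a + l / 2, c, l / 2) => _ /=; split => //; split => //; lra.
  have [h3|h3] := leP `|J a c l| (4 * `|J3|).
    by exists (a, c + l / 2, l / 2) => _ /=; split => //; split => //; lra.
  have [h4|h4] := leP `|J a c l| (4 * `|J4|).
    by exists (a + l / 2, c + l / 2, l / 2) => _ /=; split => //; split => //; lra.
  exfalso; have := ler_normD (J1 + J2 + J3) J4; have := ler_normD (J1 + J2) J3.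
  have := ler_normD J1 J2; rewrite E in h1 h2 h3 h4; lra.
have [f Hf] := choice step.
pose s n := iter n f (a0, c0, l0).
have sl n : (s n).2 = l0 / 2 ^+ n /\ 0 < (s n).2.
  elim: n => [|n [IH1 IH2]]; first by rewrite /s/= expr0 divr1.
  have [E _] := Hf _ IH2; rewrite -/(s n.+1) in E.
  by rewrite /s/= -/(s n) E {1}IH1 exprS; split; [field; rewrite expf_neq0|lra].
have mono n m : (s n).1.1 <= (s (n + m)%N).1.1 /\ (s (n + m)%N).1.1 + (s (n + m)%N).2 <= (s n).1.1 + (s n).2 /\
   (s n).1.2 <= (s (n + m)%N).1.2 /\ (s (n + m)%N).1.2 + (s (n + m)%N).2 <= (s n).1.2 + (s n).2.
  elim: m => [|m [IH1 [IH2 [IH3 IH4]]]]; first by rewrite addn0.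
  have [_ [h1 h2 h3 h4 _]] := Hf _ (sl (n + m)%N).2.
  by rewrite addnS /s/= -/(s (n + m)%N); split; [|split; [|split]]; lra.
have nest n m : (s n).1.1 <= (s m).1.1 + (s m).2 /\ (s n).1.2 <= (s m).1.2 + (s m).2.
  have [l1 l1'] := sl (maxn n m).
  have := mono n (m - n)%N; have := mono m (n - m)%N.
  rewrite -!maxnE [maxn m n]maxnC => -[_ [h1 [_ h2]]] [h3 [_ [h4 _]]]; split; lra.
(* The suprema of the corner coordinates give a point common to all the nested squares. *)
pose X := range (fun n => (s n).1.1); pose Y := range (fun n => (s n).1.2).
have hX m : (s m).1.1 <= sup X <= (s m).1.1 + (s m).2.
  apply/andP; split.
    apply: ub_le_sup; last by exists m.
    by exists ((s 0%N).1.1 + (s 0%N).2) => _ [n _ <-]; have [] := nest n 0%N.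
  apply: ge_sup; first by exists (s 0%N).1.1, 0%N.
  by move=> _ [n _ <-]; have [] := nest n m.
have hY m : (s m).1.2 <= sup Y <= (s m).1.2 + (s m).2.
  apply/andP; split.
    apply: ub_le_sup; last by exists m.
    by exists ((s 0%N).1.2 + (s 0%N).2) => _ [n _ <-]; have [] := nest n 0%N.
  apply: ge_sup; first by exists (s 0%N).1.2, 0%N.
  by move=> _ [n _ <-]; have [] := nest n m.
have Jn n : `|J a0 c0 l0| <= 4 ^+ n * `|J (s n).1.1 (s n).1.2 (s n).2|.
  elim: n => [|n IH]; first by rewrite expr0 mul1r.
  have [_ [_ _ _ _ h]] := Hf _ (sl n).2.
  apply: le_trans IH _; rewrite exprSr -mulrA ler_wpM2l ?exprn_ge0//.
have J00 : 0 < `|J a0 c0 l0| by rewrite normr_gt0.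
(* As 4 ^ n (l0 / 2 ^ n) ^ 2 = l0 ^ 2, this tolerance turns the local bound into |J| <= |J| / 2. *)
have [d d0 Hd] := Jloc (sup X) (sup Y) (`|J a0 c0 l0| / (2 * l0 ^+ 2)) ltac:(by rewrite divr_gt0// mulr_gt0// exprn_gt0).
have [n Hn] : exists n, l0 / 2 ^+ n < d.
  have [n _ Hn] : \forall n \near \oo, l0 / 2 ^+ n < d.
    have : (fun n => l0 * (2^-1) ^+ n) @ \oo --> l0 * 0.
      by apply: cvgMr; apply: cvg_expr; rewrite ger0_norm//; lra.
    rewrite mulr0 => /cvgrPdist_lt/(_ _ d0); apply: filterS => n.
    rewrite sub0r normrN ger0_norm ?exprVn// divr_ge0// ?exprn_ge0// ltW//.
  by exists n; apply: Hn => /=.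
have [ln ln0] := sl n.
have := Hd _ _ _ ln0 ltac:(by rewrite ln) (hX n) (hY n).
move=> h; have := Jn n; apply: contraTT => _; rewrite -ltNge.
apply: (@le_lt_trans _ _ (4 ^+ n * (`|J a0 c0 l0| / (2 * l0 ^+ 2) * (s n).2 ^+ 2))).
  by rewrite ler_wpM2l ?exprn_ge0.
rewrite ln expr_div_n -exprM mulnC exprM -[2 ^+ 2 in X in X < _]/(2 ^+ 2).
rewrite (_ : 2 ^+ 2 = 4 :> R); last by ring.
rewrite (_ : 4 ^+ n * _ = `|J a0 c0 l0| / 2); first lra.
field; apply/andP; split; last by rewrite gt_eqF.
by rewrite expf_neq0// pnatr_eq0.
Qed.

End quarter_bisection.

Section divergence.
Variable R : realType.
Local Notation mu := (@lebesgue_measure R).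
Local Notation m2 := (mu \x mu)%E.
Local Notation T2 := (measurableTypeR R * measurableTypeR R)%type.
Implicit Types f P Q W : R * R -> R.

Definition pcontinuous f := forall p e, 0 < e -> exists2 d : R, 0 < d &
  forall q, Num.max `|q.1 - p.1| `|q.2 - p.2| < d -> `|f q - f p| < e.

Lemma pcontinuous_measurable f : pcontinuous f ->
  measurable_fun setT (f : measurableTypeR R * measurableTypeR R -> R).
Proof.
move=> cf; apply: (measurable_basis_fun (measurable_basisX (@measurable_basisR R) (@measurable_basisR R))) => //.
by move=> p _ e /(cf p)[d d0 Hd]; exists d => // q _; exact: Hd.
Qed.

Lemma pcontinuous_continuous f : pcontinuous f -> continuous f.
Proof.
move=> cf p; apply/cvgrPdist_lt => e /(cf p)[d d0 Hd].
exists (ball p.1 d, ball p.2 d) => /=; first by split; exact: nbhsx_ballx.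
move=> q [/= q1 q2]; rewrite distrC; apply: Hd.
by rewrite gt_max; apply/andP; split; rewrite distrC.
Qed.

Lemma pcontinuous_slice1 f x : pcontinuous f -> continuous (fun y => f (x, y)).
Proof.
move=> cf y; apply/cvgrPdist_lt => e /(cf (x, y))[d d0 Hd].
apply/nbhs_ballP; exists d => // z /= yz; rewrite distrC; apply: Hd => /=.
by rewrite subrr normr0 gt_max d0 distrC.
Qed.

Lemma pcontinuous_slice2 f y : pcontinuous f -> continuous (fun x => f (x, y)).
Proof.
move=> cf x; apply/cvgrPdist_lt => e /(cf (x, y))[d d0 Hd].
apply/nbhs_ballP; exists d => // z /= yz; rewrite distrC; apply: Hd => /=.
by rewrite subrr normr0 gt_max d0 distrC andbT.
Qed.

Lemma lebesgue_seg (a l : R) : 0 < l -> mu `]a, (a + l)] = l%:E.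
Proof. by move=> l0; rewrite lebesgue_measure_itv/= lte_fin ltrDl l0 -EFinD addrAC subrr add0r. Qed.

(** Half-open, so that the four quarters of a square form a partition of it. *)
Definition rect (a c l : R) : set T2 := `]a, (a + l)] `*` `]c, (c + l)].

Lemma measurable_rect a c l : measurable (rect a c l).
Proof. by apply: measurableX; exact: measurable_itv. Qed.

Lemma rect_measure a c l : 0 < l -> m2 (rect a c l) = (l ^+ 2)%:E.
Proof.
move=> l0; rewrite product_measure1E//= !lebesgue_measure_itv/= !lte_fin !ltrDl l0.
by rewrite -!EFinD -EFinM; congr EFin; ring.
Qed.

Lemma integrable_rect f a c l : 0 < l -> pcontinuous f ->
  m2.-integrable (rect a c l) (EFin \o f).
Proof.
move=> l0 cf; apply: measurable_bounded_integrable.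
- exact: measurable_rect.
- by rewrite [ltLHS](rect_measure a c l0) ltry.
- by apply: measurable_funS (pcontinuous_measurable cf).
- have cK : compact (`[a, a + l] `*` `[c, c + l] : set (R * R)).
    by apply: compact_setX; exact: segment_compact.
  have := continuous_compact (continuous_subspaceT (pcontinuous_continuous cf)) cK.
  move=> /compact_bounded[M [Mr HM]]; exists M; split => // y /HM H /= p [].
  rewrite /= !in_itv/= => /andP[/ltW p1 p2] /andP[/ltW p3 p4].
  by apply: H; exists p => //; split; rewrite /= in_itv/= ?p1 ?p3.
Qed.

Lemma integrable_seg (f : R -> R) a l : continuous f ->
  mu.-integrable `]a, (a + l)] (EFin \o f).
Proof.
move=> cf; have : mu.-integrable `[a, (a + l)]%classic (EFin \o f).
  by apply: continuous_compact_integrable;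
    [exact: segment_compact|exact: continuous_subspaceT].
apply: integrableS => //.
by apply: subset_itvr; rewrite bnd_simp.
Qed.

Lemma Rintegral_near_cst d (T : measurableType d) (nu : {measure set T -> \bar R})
    (A : set T) (f : T -> R) (m k e : R) : measurable A -> nu A = m%:E ->
  nu.-integrable A (EFin \o f) -> (forall x, A x -> `|f x - k| <= e) ->
  `|\int[nu]_(x in A) f x - k * m| <= e * m.
Proof.
move=> mA Am fi fk.
have ci c : nu.-integrable A (EFin \o cst c).
  by apply: measurable_bounded_integrable => //; [rewrite Am ltry|
    exists `|c|; split; [exact: normr_real|move=> x /ltW h y _]].
have hc c : \int[nu]_(x in A) c = c * m by rewrite Rintegral_cst// Am.
have h1 : \int[nu]_(x in A) f x <= (k + e) * m.
  rewrite -hc; apply: le_Rintegral => // [|x /fk]; first exact: ci.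
  by rewrite ler_norml => /andP[]; lra.
have h2 : (k - e) * m <= \int[nu]_(x in A) f x.
  rewrite -hc; apply: le_Rintegral => // [|x /fk]; first exact: ci.
  by rewrite ler_norml => /andP[]; lra.
by rewrite ler_norml; apply/andP; split; lra.
Qed.

Definition pdiff P p px py := forall e : R, 0 < e -> exists2 d : R, 0 < d &
  forall q, Num.max `|q.1 - p.1| `|q.2 - p.2| < d ->
  `|P q - P p - px * (q.1 - p.1) - py * (q.2 - p.2)| <= e * (`|q.1 - p.1| + `|q.2 - p.2|).

Lemma Rintegral_seg_split (f : R -> R) a l : 0 < l -> continuous f ->
  \int[mu]_(x in `]a, (a + l)]) f x = \int[mu]_(x in `]a, (a + l / 2)]) f x +
    \int[mu]_(x in `](a + l / 2), (a + l / 2 + l / 2)]) f x.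
Proof.
move=> l0 cf; have -> : a + l / 2 + l / 2 = a + l by field.
rewrite -Rintegral_setU//.
- by congr Rintegral; rewrite -itv_bndbnd_setU// bnd_simp; lra.
- rewrite -itv_bndbnd_setU ?bnd_simp; [exact: integrable_seg|lra|lra].
- apply/disj_setPS => x [/=]; rewrite !in_itv/=; lra.
Qed.

Lemma Rintegral_rect_split f a c l : 0 < l -> pcontinuous f ->
  \int[m2]_(p in rect a c l) f p = \int[m2]_(p in rect a c (l / 2)) f p +
   \int[m2]_(p in rect (a + l / 2) c (l / 2)) f p + \int[m2]_(p in rect a (c + l / 2) (l / 2)) f p
   + \int[m2]_(p in rect (a + l / 2) (c + l / 2) (l / 2)) f p.
Proof.
move=> l0 cf; have l20 : 0 < l / 2 by lra.
have E : rect a c l = ((rect a c (l / 2) `|` rect (a + l / 2) c (l / 2)) `|`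
    rect a (c + l / 2) (l / 2)) `|` rect (a + l / 2) (c + l / 2) (l / 2).
  apply/seteqP; split=> [[x y]|[x y]].
    move=> [/=]; rewrite !in_itv/= => /andP[x1 x2] /andP[y1 y2].
    have [hx|hx] := leP x (a + l / 2); have [hy|hy] := leP y (c + l / 2).
    - by left; left; left; split; rewrite /= in_itv/=; lra.
    - by left; right; split; rewrite /= in_itv/=; lra.
    - by left; left; right; split; rewrite /= in_itv/=; lra.
    - by right; split; rewrite /= in_itv/=; lra.
  by move=> [[[]|]|] [/=]; rewrite !in_itv/= => /andP[x1 x2] /andP[y1 y2]; split; rewrite /= in_itv/=; lra.
have I := integrable_rect a c l0 cf.
have mr := measurable_rect.
have S (A : set T2) : measurable A -> A `<=` rect a c l -> m2.-integrable A (EFin \o f).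
  by move=> mA AS; exact: (integrableS (measurable_rect a c l) mA AS I).
have D A B : (forall p, A p -> B p -> False) -> [disjoint A & B].
  by move=> AB; apply/disj_setPS => p [/AB].
rewrite E in S; rewrite {1}E.
have U1 := measurableU _ _ (mr a c (l / 2)) (mr (a + l / 2) c (l / 2)).
have U2 := measurableU _ _ U1 (mr a (c + l / 2) (l / 2)).
rewrite Rintegral_setU//; last 2 first.
- by apply: S => //; exact: measurableU.
- apply: D => -[x y] [[|]|] [/=]; rewrite !in_itv/= => /andP[x1 x2] /andP[y1 y2] [/=];
  rewrite !in_itv/= => /andP[? ?] /andP[? ?]; lra.
rewrite Rintegral_setU//; last 2 first.
- by apply: S => // p pA; left.
- apply: D => -[x y] [|] [/=]; rewrite !in_itv/= => /andP[x1 x2] /andP[y1 y2] [/=];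
  rewrite !in_itv/= => /andP[? ?] /andP[? ?]; lra.
rewrite Rintegral_setU//.
- by apply: S => // p pA; left; left.
- apply: D => -[x y] [/=]; rewrite !in_itv/= => /andP[x1 x2] /andP[y1 y2] [/=];
  rewrite !in_itv/= => /andP[? ?] /andP[? ?]; lra.
Qed.

Variables (P Q W px py qx qy : R * R -> R).
Hypothesis dP : forall p, pdiff P p (px p) (py p).
Hypothesis dQ : forall p, pdiff Q p (qx p) (qy p).
Hypothesis divW : forall p, px p + qy p = W p.
Hypothesis cW : pcontinuous W.

Let pdiff_pcontinuous f fx fy : (forall p, pdiff f p (fx p) (fy p)) -> pcontinuous f.
Proof.
move=> df p e e0; have [d d0 Hd] := df p 1 ltr01.
pose M := `|fx p| + `|fy p| + 2.
have M0 : 0 < M by rewrite /M; have := normr_ge0 (fx p); have := normr_ge0 (fy p); lra.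
exists (Num.min d (e / M)); first by rewrite lt_min d0 divr_gt0.
move=> q; rewrite lt_min => /andP[/Hd{}Hd]; rewrite ltr_pdivlMr// mul1r in Hd *.
set u := q.1 - p.1 in Hd *; set v := q.2 - p.2 in Hd *; set m := Num.max _ _ => mM.
have um : `|u| <= m by rewrite le_max lexx.
have vm : `|v| <= m by rewrite le_max lexx orbT.
have m0 : 0 <= m by apply: le_trans um.
have -> : f q - f p = (f q - f p - fx p * u - fy p * v) + (fx p * u + fy p * v) by ring.
apply: le_lt_trans (ler_normD _ _) _; apply: le_lt_trans mM.
have := ler_normD (fx p * u) (fy p * v); rewrite !normrM.
have : `|fx p| * `|u| <= `|fx p| * m by rewrite ler_wpM2l.
have : `|fy p| * `|v| <= `|fy p| * m by rewrite ler_wpM2l.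
rewrite /M; lra.
Qed.

Let cP := pdiff_pcontinuous dP.
Let cQ := pdiff_pcontinuous dQ.

(** Defect of the divergence identity: the outward flux minus the integral of the divergence. *)
Let J a c l := \int[mu]_(y in `]c, (c + l)]) (P (a + l, y) - P (a, y)) +
  \int[mu]_(x in `]a, (a + l)]) (Q (x, c + l) - Q (x, c)) -
  \int[m2]_(p in rect a c l) W p.

Let Jadd a c l : 0 < l -> J a c l = J a c (l / 2) + J (a + l / 2) c (l / 2)
     + J a (c + l / 2) (l / 2) + J (a + l / 2) (c + l / 2) (l / 2).
Proof.
move=> l0; have l20 : 0 < l / 2 by lra.
have cP1 x := pcontinuous_slice1 (x := x) cP.
have cQ2 y := pcontinuous_slice2 (y := y) cQ.
rewrite /J (Rintegral_rect_split _ _ l0 cW).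
have E b : b + l / 2 + l / 2 = b + l by field.
have BP x y b r : 0 < r -> \int[mu]_(t in `]b, (b + r)]) (P (x, t) - P (y, t)) =
   \int[mu]_(t in `]b, (b + r)]) P (x, t) - \int[mu]_(t in `]b, (b + r)]) P (y, t).
  by move=> r0; apply: RintegralB => //; exact: integrable_seg.
have BQ x y b r : 0 < r -> \int[mu]_(t in `]b, (b + r)]) (Q (t, x) - Q (t, y)) =
   \int[mu]_(t in `]b, (b + r)]) Q (t, x) - \int[mu]_(t in `]b, (b + r)]) Q (t, y).
  by move=> r0; apply: RintegralB => //; exact: integrable_seg.
rewrite !BP// !BQ// !E.
rewrite (@Rintegral_seg_split (fun t => P (a + l, t)) c l l0)//.
rewrite (@Rintegral_seg_split (fun t => P (a, t)) c l l0)//.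
rewrite (@Rintegral_seg_split (fun t => Q (t, c + l)) a l l0)//.
rewrite (@Rintegral_seg_split (fun t => Q (t, c)) a l l0)// !E.
ring.
Qed.

(** For the first-order parts of P and Q at (x, y) and the constant W (x, y) the defect is zero. The
    remainders cost 4 (e / 9) l ^ 2 for each pair of opposite sides, and the variation of W costs (e
    / 9) l ^ 2. Only differentiability at the point and continuity of the divergence enter. *)
Let Jloc x y e : 0 < e -> exists2 d : R, 0 < d & forall a c l, 0 < l -> l < d ->
  a <= x <= a + l -> c <= y <= c + l -> `|J a c l| <= e * l ^+ 2.
Proof.
move=> e0; have e9 : 0 < e / 9 by lra.
have [d1 d10 H1] := dP (x, y) e9; have [d2 d20 H2] := dQ (x, y) e9.
have [d3 d30 H3] := cW (x, y) e9.
exists (Num.min d1 (Num.min d2 d3)); first by rewrite !lt_min d10 d20.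
move=> a c l l0; rewrite !lt_min => /andP[ld1 /andP[ld2 ld3]] /andP[ax xa] /andP[cy yc].
set p0 := (x, y) in H1 H2 H3.
have near u v : a <= u <= a + l -> c <= v <= c + l ->
    `|u - x| <= l /\ `|v - y| <= l.
  move=> /andP[? ?] /andP[? ?]; split; rewrite ler_norml; lra.
have nearm u v d : a <= u <= a + l -> c <= v <= c + l -> l < d ->
    Num.max `|(u, v).1 - p0.1| `|(u, v).2 - p0.2| < d.
  move=> hu hv ld; have [h1 h2] := near _ _ hu hv.
  by rewrite gt_max/= (le_lt_trans h1 ld) (le_lt_trans h2 ld).
have a1 : a <= a <= a + l by lra.
have a2 : a <= a + l <= a + l by lra.
have c1 : c <= c <= c + l by lra.
have c2 : c <= c + l <= c + l by lra.
have B1 : `|\int[mu]_(y in `]c, (c + l)]) (P (a + l, y) - P (a, y)) - px p0 * l * l| <= 4 * (e / 9) * l * l.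
  apply: Rintegral_near_cst => //.
  - exact: lebesgue_seg.
  - apply: integrable_seg => z; apply: (@continuousB _ _ _ (fun y => P (a + l, y)) (fun y => P (a, y)));
    exact: pcontinuous_slice1.
  move=> v; rewrite /= in_itv/= => /andP[/ltW v1 v2].
  have hv : c <= v <= c + l by rewrite v1.
  have := H1 (a + l, v) (nearm _ _ _ a2 hv ld1); have := H1 (a, v) (nearm _ _ _ a1 hv ld1).
  have [h1 h2] := near _ _ a1 hv; have [h3 h4] := near _ _ a2 hv.
  set f1 := P (a + l, v); set f2 := P (a, v) => /= k1 k2.
  have i1 : e / 9 * (`|a - x| + `|v - y|) <= e / 9 * (l + l) by rewrite ler_pM2l// lerD.
  have i2 : e / 9 * (`|a + l - x| + `|v - y|) <= e / 9 * (l + l) by rewrite ler_pM2l// lerD.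
  move: (le_trans k1 i1) (le_trans k2 i2); rewrite !ler_norml; lra.
have B2 : `|\int[mu]_(x in `]a, (a + l)]) (Q (x, c + l) - Q (x, c)) - qy p0 * l * l| <= 4 * (e / 9) * l * l.
  apply: Rintegral_near_cst => //.
  - exact: lebesgue_seg.
  - apply: integrable_seg => z; apply: (@continuousB _ _ _ (fun x => Q (x, c + l)) (fun x => Q (x, c)));
    exact: pcontinuous_slice2.
  move=> u; rewrite /= in_itv/= => /andP[/ltW u1 u2].
  have hu : a <= u <= a + l by rewrite u1.
  have := H2 (u, c + l) (nearm _ _ _ hu c2 ld2); have := H2 (u, c) (nearm _ _ _ hu c1 ld2).
  have [h1 h2] := near _ _ hu c1; have [h3 h4] := near _ _ hu c2.
  set f1 := Q (u, c + l); set f2 := Q (u, c) => /= k1 k2.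
  have i1 : e / 9 * (`|u - x| + `|c - y|) <= e / 9 * (l + l) by rewrite ler_pM2l// lerD.
  have i2 : e / 9 * (`|u - x| + `|c + l - y|) <= e / 9 * (l + l) by rewrite ler_pM2l// lerD.
  move: (le_trans k1 i1) (le_trans k2 i2); rewrite !ler_norml; lra.
have B3 : `|\int[m2]_(p in rect a c l) W p - W p0 * l ^+ 2| <= e / 9 * l ^+ 2.
  apply: Rintegral_near_cst => //; [exact: measurable_rect|exact: rect_measure|exact: integrable_rect|].
  move=> [u v] [/=]; rewrite !in_itv/= => /andP[/ltW u1 u2] /andP[/ltW v1 v2].
  by apply/ltW/H3/nearm => //; apply/andP.
move: B1 B2 B3; rewrite /J -(divW p0) !ler_norml expr2; lra.
Qed.

Theorem divergence_square a c l : 0 < l ->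
  \int[m2]_(p in rect a c l) W p =
  \int[mu]_(y in `]c, (c + l)]) (P (a + l, y) - P (a, y)) +
  \int[mu]_(x in `]a, (a + l)]) (Q (x, c + l) - Q (x, c)).
Proof.
by move=> l0; apply/esym/eqP; rewrite -subr_eq0; apply/eqP; exact: (quarter_bisection Jadd Jloc).
Qed.

End divergence.

Section complex_divergence.
Variable R : realType.
Local Notation C := R[i].
Local Notation mu := (@lebesgue_measure R).
Local Notation m2 := (mu \x mu)%E.
Local Notation T2 := (measurableTypeR R * measurableTypeR R)%type.
Local Notation cl := (@complex_lebesgue R).
Implicit Types f P Q W : C -> C.

Lemma ccontinuous_measurable (D : set C) f : measurable D ->
  (forall z, D z -> ccontinuous f z) ->
  measurable_fun D (fun z => complex.Re (f z)).
Proof.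
move=> mD cf; apply: (measurable_basis_fun (@measurable_basisC R)) => //.
move=> z Dz e /(cf z Dz)[d d0 Hd]; exists d => // w _ /Hd.
by apply: le_lt_trans; rewrite -raddfB/=; exact: normRe_le.
Qed.

Lemma normc_le_max (p q : R * R) :
  normc (pair_complex p - pair_complex q) <= 2 * Num.max `|p.1 - q.1| `|p.2 - q.2|.
Proof.
apply: le_trans (normc_le_ReIm _) _; rewrite mulr_natl mulr2n.
by apply: lerD; rewrite /= le_max lexx ?orbT.
Qed.

Lemma ccontinuous_pcontinuous f : (forall z, ccontinuous f z) ->
  pcontinuous (fun p => complex.Re (f (pair_complex p))).
Proof.
move=> cf p e /(cf (pair_complex p))[d d0 Hd]; exists (d / 2); first lra.
move=> q qp; rewrite -raddfB; apply: le_lt_trans (normRe_le _) _; apply: Hd.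
by apply: le_lt_trans (normc_le_max _ _) _; lra.
Qed.

Lemma rdiff_pdiff f fx fy p : rdiff f (pair_complex p) fx fy ->
  pdiff (fun p => complex.Re (f (pair_complex p))) p (complex.Re fx) (complex.Re fy).
Proof.
move=> /rdiffP df e e0; have [d d0 Hd] := df e e0; exists (d / 2); first lra.
move=> q qp; have /Hd h : normc (pair_complex q - pair_complex p) < d.
  by apply: le_lt_trans (normc_le_max _ _) _; lra.
have ReM (a : C) (x : R) : complex.Re (a * x%:C) = complex.Re a * x.
  by case: a => u v /=; rewrite mulr0 subr0.
apply: (@le_trans _ _ (e * normc (pair_complex q - pair_complex p))); last first.
  by rewrite ler_wpM2l ?(ltW e0)//; exact: normc_le_ReIm.
apply: le_trans (le_trans (normRe_le _) h).
have ReB (x y : C) : complex.Re (x - y) = complex.Re x - complex.Re y by rewrite raddfB.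
by rewrite !ReB !ReM.
Qed.

Lemma preimage_disk_rect : @pair_complex R @^-1` (@disk R) `<=` rect (-1) (-1) 2.
Proof.
move=> [x y]; rewrite /disk/= complex_normrE -[1]/(1%:C) ltcR => h.
have := le_lt_trans (normRe_le (x +i* y)) h; have := le_lt_trans (normIm_le (x +i* y)) h.
rewrite /= !ltr_norml => /andP[? ?] /andP[? ?].
by split; rewrite /= in_itv/=; lra.
Qed.

Lemma diskE (z : C) : @disk R z = (normc z < 1).
Proof. by rewrite /disk/= complex_normrE -[1]/(1%:C) ltcR. Qed.

Lemma measurable_preimage_disk : measurable (@pair_complex R @^-1` (@disk R) : set T2).
Proof. exact: measurable_disk. Qed.

Lemma integrable_disk f : (forall z, ccontinuous f z) ->
  cl.-integrable (@disk R) (EFin \o (fun z => complex.Re (f z))).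
Proof.
move=> cf; have h : (pushforward m2 (@pair_complex R)).-integrable (@disk R)
    (EFin \o (fun z => complex.Re (f z))); last exact: h.
apply: integrable_pushforward.
- exact: measurable_pair_complex.
- by apply/measurable_EFinP; exact: ccontinuous_measurable.
- apply: (integrableS (@measurable_rect R (-1) (-1) 2) measurable_preimage_disk preimage_disk_rect).
  by apply: (@integrable_rect R (fun p => complex.Re (f (pair_complex p)))) => //; exact: ccontinuous_pcontinuous.
- exact: measurable_disk.
Qed.

Lemma Rintegral_disk f : (forall z, ccontinuous f z) ->
  (forall z, 1 <= normc z -> f z = 0) ->
  \int[cl]_(z in @disk R) complex.Re (f z) =
  \int[m2]_(p in rect (-1) (-1) 2) complex.Re (f (pair_complex p)).
Proof.
move=> cf f0.
have -> : \int[cl]_(z in @disk R) complex.Re (f z) =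
    \int[m2]_(p in @pair_complex R @^-1` (@disk R)) complex.Re (f (pair_complex p)).
  rewrite /Rintegral; congr fine.
  have h : (\int[pushforward m2 (@pair_complex R)]_(z in @disk R) (complex.Re (f z))%:E =
    \int[m2]_(p in @pair_complex R @^-1` (@disk R)) (complex.Re (f (pair_complex p)))%:E)%E; last exact: h.
  apply: integral_pushforward.
  - exact: measurable_pair_complex.
  - by apply/measurable_EFinP; exact: ccontinuous_measurable.
  - apply: (integrableS (@measurable_rect R (-1) (-1) 2) measurable_preimage_disk preimage_disk_rect).
    by apply: (@integrable_rect R (fun p => complex.Re (f (pair_complex p)))) => //; exact: ccontinuous_pcontinuous.
  - exact: measurable_disk.
rewrite Rintegral_mkcond [RHS]Rintegral_mkcond; apply: eq_Rintegral => p _.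
rewrite !patchE; case: ifPn => [|pD]; first by rewrite inE => /preimage_disk_rect pr; rewrite mem_set.
rewrite f0 ?if_same// leNgt; apply: contraNN pD => pD; apply: mem_set.
by rewrite /preimage/= diskE.
Qed.

(** The sides of the enclosing square lie outside the open unit disk, where the field vanishes, so
    there is no flux. *)
Theorem complex_divergence P Q W (Px Py Qx Qy : C -> C) :
  (forall z, rdiff P z (Px z) (Py z)) -> (forall z, rdiff Q z (Qx z) (Qy z)) ->
  (forall z, Px z + Qy z = W z) -> (forall z, ccontinuous W z) ->
  (forall z, 1 <= normc z -> [/\ P z = 0, Q z = 0 & W z = 0]) ->
  \int[cl]_(z in @disk R) complex.Re (W z) = 0.
Proof.
move=> dP dQ divW cW z0; rewrite Rintegral_disk//; last by move=> z /z0[].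
rewrite (@divergence_square R (fun p => complex.Re (P (pair_complex p))) (fun p => complex.Re (Q (pair_complex p))) _
   (fun p => complex.Re (Px (pair_complex p))) (fun p => complex.Re (Py (pair_complex p)))
   (fun p => complex.Re (Qx (pair_complex p))) (fun p => complex.Re (Qy (pair_complex p)))) //.
- have P0 y : P (1 +i* y) = 0 /\ P ((-1) +i* y) = 0.
    split; [have [] := z0 (1 +i* y)|have [] := z0 ((-1) +i* y)] => //.
    + by apply: le_trans (normRe_le _); rewrite /= normr1.
    + by apply: le_trans (normRe_le _); rewrite /= normrN1.
  have Q0 x : Q (x +i* 1) = 0 /\ Q (x +i* (-1)) = 0.
    split; [have [] := z0 (x +i* 1)|have [] := z0 (x +i* (-1))] => //.
    + by apply: le_trans (normIm_le _); rewrite /= normr1.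
    + by apply: le_trans (normIm_le _); rewrite /= normrN1.
  have e2 : -1 + 2 = 1 :> R by ring.
  rewrite e2 /pair_complex/= (_ : (fun y => _) = fun=> 0); last first.
    by apply/funext => y; have [-> ->] := P0 y; rewrite subrr.
  rewrite (_ : (fun x => _ - _) = fun=> 0); last first.
    by apply/funext => x; have [-> ->] := Q0 x; rewrite subrr.
  by rewrite !Rintegral_cst// !mul0r addr0.
- by move=> p; exact: rdiff_pdiff.
- by move=> p; exact: rdiff_pdiff.
- by move=> p; rewrite -divW raddfD.
- exact: ccontinuous_pcontinuous.
Qed.

End complex_divergence.

(** * Gluing differentiable functions of a real variable *)

Section gluing.
Variable R : realType.

Lemma is_derive_epsP (k : R -> R) (x dk : R) : is_derive x 1 k dk <->
  (forall e : R, 0 < e -> exists2 d : R, 0 < d & forall h : R, `|h| < d ->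
     `|k (x + h) - k x - h * dk| <= e * `|h|).
Proof.
split; last exact: is_derive_eps.
move=> [/cvg_ex[/= l Hl] dl] e e0; have {}dl : l = dk by rewrite -dl; apply/esym/cvg_lim.
move: Hl; rewrite dl => /cvgrPdist_lt/(_ e e0); rewrite /prop_near1 /within/= near_simpl.
move=> /nbhs_ballP[d/= d0 Hd]; exists d => // h hd.
have [->|h0] := eqVneq h 0; first by rewrite addr0 subrr mul0r subr0 normr0 mulr0.
have := Hd h; rewrite /ball/= sub0r normrN => /(_ hd h0).
rewrite /GRing.scale/= mulr1 [h + x]addrC => /ltW Hh.
rewrite [X in `|X|](_ : _ = - ((dk - h^-1 * (k (x + h) - k x)) * h)); last by field.
by rewrite normrN normrM ler_wpM2r.
Qed.

Lemma is_derive_glue (f g df dg : R -> R) (a : R) :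
  (forall s : R, s <= a -> is_derive s 1 f (df s)) ->
  (forall s : R, a <= s -> is_derive s 1 g (dg s)) -> f a = g a -> df a = dg a ->
  forall s : R, is_derive s 1 (fun s => if s <= a then f s else g s) (if s <= a then df s else dg s).
Proof.
move=> Hf Hg fga dfga s; apply/is_derive_epsP => e e0.
have [sa|sa|sa] := ltgtP s a.
- have [d d0 Hd] := (is_derive_epsP f s (df s)).1 (Hf s (ltW sa)) e e0.
  exists (Num.min d (a - s)); first by rewrite lt_min d0 subr_gt0.
  move=> h; rewrite lt_min => /andP[/Hd hd]; rewrite ltr_norml => /andP[_ h2].
  by rewrite ifT//; lra.
- have [d d0 Hd] := (is_derive_epsP g s (dg s)).1 (Hg s (ltW sa)) e e0.
  exists (Num.min d (s - a)); first by rewrite lt_min d0 subr_gt0.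
  move=> h; rewrite lt_min => /andP[/Hd hd]; rewrite ltr_norml => /andP[h1 _].
  by rewrite ifF//; apply/negbTE; rewrite -ltNge; lra.
- rewrite sa; have [d d0 Hd] := (is_derive_epsP f a (df a)).1 (Hf a (lexx _)) e e0.
  have [d' d'0 Hd'] := (is_derive_epsP g a (dg a)).1 (Hg a (lexx _)) e e0.
  exists (Num.min d d'); first by rewrite lt_min d0.
  move=> h; rewrite lt_min => /andP[/Hd hd /Hd' hd'].
  by case: ifP => // _; rewrite fga dfga.
Qed.

End gluing.

(** * Cutoff functions and their integrals *)

Section cutoff.
Variables (R : realType) (n : nat).
Implicit Types r s : R.

Lemma is_derive_pow (s : R) m : is_derive s 1 (fun s => s ^+ m.+1) (m.+1%:R * s ^+ m).
Proof.
have := is_deriveX m.+1 (is_derive_id s (1 : R)).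
by rewrite fctE /GRing.scale/= mulr1.
Qed.

Lemma is_derive_poly2 (a b c s : R) m :
  is_derive s 1 (fun s => a + b * s + c * s ^+ m.+1) (b + c * (m.+1%:R * s ^+ m)).
Proof.
have h := is_derive_pow s m; apply: is_derive_eq.
by rewrite /GRing.scale/=; ring.
Qed.

Lemma is_derive_invX (c s : R) m : s != 0 ->
  is_derive s 1 (fun s => c / s ^+ m.+1) (- c * m.+1%:R / s ^+ m.+2).
Proof.
move=> s0; have h := is_derive_pow s m.
have sm : s ^+ m.+1 != 0 by rewrite expf_neq0.
have hV : is_derive s 1 (fun s => (s ^+ m.+1)^-1) (- (s ^+ m.+1) ^- 2 *: (m.+1%:R * s ^+ m)).
  exact: is_deriveV.
apply: is_derive_eq; rewrite /GRing.scale/= !exprS; field.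
by rewrite s0 expf_neq0.
Qed.

Let n2 : 2 + n%:R != 0 :> R.
Proof. by rewrite -natrD pnatr_eq0. Qed.

Let n3 : 3 + n%:R != 0 :> R.
Proof. by rewrite -natrD pnatr_eq0. Qed.

(** On [0, r] it increases with n to the indicator of [0, r), and it is continuous across r for
    every n. *)
Definition cutoff r s := if s <= r then 1 - (s / r) ^+ n.+1 else 0.

(** The integration constant makes this primitive of [cutoff] vanish at r, so that it is
    differentiable when continued by 0. *)
Definition cutoff_prim r s :=
  if s <= r then - (r * n.+1%:R / n.+2%:R) + 1 * s + (- (r ^+ n.+1 * n.+2%:R)^-1) * s ^+ n.+2
  else 0.

Lemma is_derive_cutoff_prim r s : 0 < r -> is_derive s 1 (cutoff_prim r) (cutoff r s).
Proof.
move=> r0; have rn0 : r ^+ n != 0 by rewrite expf_neq0// gt_eqF.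
have r0' : r != 0 by rewrite gt_eqF.
have -> : cutoff r s = if s <= r then
   1 + - (r ^+ n.+1 * n.+2%:R)^-1 * (n.+2%:R * s ^+ n.+1) else 0.
  rewrite /cutoff; case: ifP => // _; rewrite expr_div_n !exprS.
  by field; rewrite ?rn0 ?r0' ?n2 ?n3.
refine (@is_derive_glue _
  (fun s => - (r * n.+1%:R / n.+2%:R) + 1 * s + (- (r ^+ n.+1 * n.+2%:R)^-1) * s ^+ n.+2) (fun=> 0)
  (fun s => 1 + - (r ^+ n.+1 * n.+2%:R)^-1 * (n.+2%:R * s ^+ n.+1)) (fun=> 0) r _ _ _ _ s).
- move=> x _; exact: is_derive_poly2.
- by rewrite /= !exprS; field; rewrite ?rn0 ?r0' ?n2 ?n3.
- by rewrite /= !exprS; field; rewrite ?rn0 ?r0' ?n2 ?n3.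
Qed.

Lemma cutoff_prim0 r s : 0 < r -> r <= s -> cutoff_prim r s = 0.
Proof.
move=> r0; rewrite /cutoff_prim le_eqVlt => /predU1P[<-|rs]; last by rewrite leNgt rs.
have rn0 : r ^+ n != 0 by rewrite expf_neq0// gt_eqF.
have r0' : r != 0 by rewrite gt_eqF.
by rewrite lexx !exprS; field; rewrite ?rn0 ?r0' ?n2 ?n3.
Qed.

Lemma cutoff0 r s : 0 < r -> r <= s -> cutoff r s = 0.
Proof.
move=> r0; rewrite /cutoff le_eqVlt => /predU1P[<-|rs]; last by rewrite leNgt rs.
by rewrite lexx divff ?gt_eqF// expr1n subrr.
Qed.

Lemma cutoff_ge0 r s : 0 < r -> 0 <= s -> 0 <= cutoff r s.
Proof.
move=> r0 s0; rewrite /cutoff; case: ifP => // sr; rewrite subr_ge0 exprn_ile1//.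
  by rewrite divr_ge0// ltW.
by rewrite ler_pdivrMr// mul1r.
Qed.

Lemma cutoff_le1 r s : 0 < r -> 0 <= s -> cutoff r s <= 1.
Proof.
move=> r0 s0; rewrite /cutoff; case: ifP => // sr.
by rewrite gerBl exprn_ge0// divr_ge0// ltW.
Qed.

(* [green r] solves [2 k + s k' = cutoff r s / r ^+ 2] for [k = green' r], that is
   [Delta (z * green r (|z| ^+ 2)) = 4 z cutoff r (|z| ^+ 2) / r ^+ 2]; it equals
   [- c / s] for [s >= r] whatever [r] is. *)
Let c : R := n.+1%:R / (2 * n.+3%:R).

Definition green r s :=
  if s <= r then (- c / r - r^-1 * (2^-1 - (n.+2%:R * n.+3%:R)^-1)) + (2 * r ^+ 2)^-1 * s
     + (- (r ^+ n.+3 * (n.+2%:R * n.+3%:R))^-1) * s ^+ n.+2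
  else - c / s ^+ 1.

Definition green1 r s :=
  if s <= r then (2 * r ^+ 2)^-1 + 0 * s + (- (r ^+ n.+3 * n.+3%:R)^-1) * s ^+ n.+1
  else c / s ^+ 2.

Definition green2 r s :=
  if s <= r then 0 + (- (r ^+ n.+3 * n.+3%:R)^-1) * (n.+1%:R * s ^+ n)
  else - c * 2%:R / s ^+ 3.

Lemma is_derive_green r s : 0 < r -> is_derive s 1 (green r) (green1 r s).
Proof.
move=> r0; have rn0 : r ^+ n != 0 by rewrite expf_neq0// gt_eqF.
have r0' : r != 0 by rewrite gt_eqF.
have -> : green1 r s = if s <= r then (2 * r ^+ 2)^-1 +
   (- (r ^+ n.+3 * (n.+2%:R * n.+3%:R))^-1) * (n.+2%:R * s ^+ n.+1) else - - c * 1%:R / s ^+ 2.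
  rewrite /green1; case: ifP => _; last by rewrite opprK mulr1.
  by rewrite mul0r addr0 !exprS; field; rewrite ?rn0 ?r0' ?n2 ?n3.
refine (@is_derive_glue _
  (fun s => (- c / r - r^-1 * (2^-1 - (n.+2%:R * n.+3%:R)^-1)) + (2 * r ^+ 2)^-1 * s
     + (- (r ^+ n.+3 * (n.+2%:R * n.+3%:R))^-1) * s ^+ n.+2) (fun s => - c / s ^+ 1)
  (fun s => (2 * r ^+ 2)^-1 + (- (r ^+ n.+3 * (n.+2%:R * n.+3%:R))^-1) * (n.+2%:R * s ^+ n.+1)) (fun s => - - c * 1%:R / s ^+ 2) r _ _ _ _ s).
- move=> x _; exact: is_derive_poly2.
- by move=> x xr; apply: is_derive_invX; rewrite gt_eqF// (lt_le_trans r0).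
- by rewrite /= /c !exprS; field; rewrite ?rn0 ?r0' ?n2 ?n3.
- by rewrite /= /c !exprS; field; rewrite ?rn0 ?r0' ?n2 ?n3.
Qed.

Lemma is_derive_green1 r s : 0 < r -> is_derive s 1 (green1 r) (green2 r s).
Proof.
move=> r0; have rn0 : r ^+ n != 0 by rewrite expf_neq0// gt_eqF.
have r0' : r != 0 by rewrite gt_eqF.
refine (@is_derive_glue _
  (fun s => (2 * r ^+ 2)^-1 + 0 * s + (- (r ^+ n.+3 * n.+3%:R)^-1) * s ^+ n.+1) (fun s => c / s ^+ 2)
  (fun s => 0 + (- (r ^+ n.+3 * n.+3%:R)^-1) * (n.+1%:R * s ^+ n)) (fun s => - c * 2%:R / s ^+ 3) r _ _ _ _ s).
- move=> x _; exact: is_derive_poly2.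
- by move=> x xr; apply: is_derive_invX; rewrite gt_eqF// (lt_le_trans r0).
- by rewrite /= /c !exprS; field; rewrite ?rn0 ?r0' ?n2 ?n3.
- by rewrite /= /c !exprS; field; rewrite ?rn0 ?r0' ?n2 ?n3.
Qed.

Lemma green_eq r s : 0 < r -> 2 * green1 r s + s * green2 r s = cutoff r s / r ^+ 2.
Proof.
move=> r0; have rn0 : r ^+ n != 0 by rewrite expf_neq0// gt_eqF.
have r0' : r != 0 by rewrite gt_eqF.
rewrite /green1 /green2 /cutoff; case: ifPn => [_|]; last first.
  rewrite -ltNge => rs; have s0 : s != 0 by rewrite gt_eqF// (lt_trans r0).
  by rewrite mul0r; field; rewrite ?n3 ?s0.
by rewrite expr_div_n !exprS; field; rewrite ?rn0 ?r0' ?n2 ?n3.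
Qed.

Lemma green_out r s : 0 < r -> r <= s -> [/\ green r s = - c / s,
   green1 r s = c / s ^+ 2 & green2 r s = - c * 2 / s ^+ 3].
Proof.
move=> r0; have rn0 : r ^+ n != 0 by rewrite expf_neq0// gt_eqF.
have r0' : r != 0 by rewrite gt_eqF.
rewrite /green /green1 /green2 le_eqVlt => /predU1P[<-|rs]; last first.
  by rewrite leNgt rs/= expr1.
by rewrite lexx /c !exprS; split; field; rewrite ?rn0 ?r0' ?n2 ?n3.
Qed.

End cutoff.

(** * Integrals against the radial weight that vanish *)

Section cutoff_integrals.
Variables (R : realType) (n : nat) (b : R[i]).
Local Notation C := R[i].
Local Notation cl := (@complex_lebesgue R).
Local Notation sigma w := (normc (w - b) ^+ 2).
Implicit Types (F G : C -> C) (z w : C) (r : R).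

Lemma rdiff_sqr_normc z :
  rdiff (fun w => (sigma w)%:C) z (conjc (z - b) + (z - b)) ('i%C * (conjc (z - b) - (z - b))).
Proof.
have -> : (fun w => (sigma w)%:C) = (fun w => (w - b) * (conjc w - conjc b)).
  by apply/funext => w; rewrite sqr_normcJ conjcB.
have h1 := rdiffB (rdiff_id z) (rdiff_cst b z).
have h2 := rdiffB (rdiff_conj z) (rdiff_cst (conjc b) z).
by apply: rdiff_eq (rdiffM h1 h2) _ _; rewrite conjcB; ring.
Qed.

Lemma rdiff_radial (K dK : R -> R) z : is_derive (sigma z) 1 K (dK (sigma z)) ->
  rdiff (fun w => (K (sigma w))%:C) z ((dK (sigma z))%:C * (conjc (z - b) + (z - b)))
    ((dK (sigma z))%:C * ('i%C * (conjc (z - b) - (z - b)))).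
Proof. by move=> dKz; exact: (rdiff_compR (rdiff_sqr_normc z) dKz). Qed.

Lemma ccontinuous_cutoff r z : 0 < r -> ccontinuous (fun w => (cutoff n r (sigma w))%:C) z.
Proof.
move=> r0; pose k s : R := 1 + 0 * s + (- (r ^+ n.+1)^-1) * s ^+ n.+1.
(* On s >= 0 the cutoff is the positive part of a polynomial, and taking positive parts does not
   increase distances. *)
have kE s : 0 <= s -> cutoff n r s = Num.max 0 (k s).
  move=> s0; have kE : k s = 1 - (s / r) ^+ n.+1.
    by rewrite /k expr_div_n mul0r addr0 mulNr mulrC.
  rewrite /cutoff kE; case: ifPn => sr.
    rewrite max_r// subr_ge0 exprn_ile1// ?divr_ge0 ?(ltW r0)//.
    by rewrite ler_pdivrMr// mul1r.
  rewrite max_l// subr_le0 exprn_ege1// ler_pdivlMr// mul1r ltW//.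
  by rewrite ltNge.
have ck : ccontinuous (fun w => (k (sigma w))%:C) z.
  apply: rdiff_ccontinuous.
  apply: (@rdiff_radial k (fun s => 0 + (- (r ^+ n.+1)^-1) * (n.+1%:R * s ^+ n))).
  exact: is_derive_poly2.
move=> e /ck[d d0 Hd]; exists d => // w /Hd; rewrite -!rmorphB !normc_real.
apply: le_lt_trans; rewrite !kE ?sqr_ge0//.
set x := k _; set y := k _; rewrite /Num.max; case: ifPn; case: ifPn; rewrite -?leNgt => hx hy //.
- by rewrite subr0 (gtr0_norm hy); apply: le_trans (ler_norm _); lra.
- by rewrite sub0r normrN (gtr0_norm hx) distrC; apply: le_trans (ler_norm _); lra.
- by rewrite subrr normr0.
Qed.

Lemma supported_near r z : r < sigma z -> exists2 d, 0 < d &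
  forall w, normc (w - z) < d -> r <= sigma w.
Proof.
move=> rz; have := rdiff_ccontinuous (rdiff_sqr_normc z).
move=> /(_ (sigma z - r)); rewrite subr_gt0 => /(_ rz)[d d0 Hd]; exists d => // w /Hd.
by rewrite -rmorphB normc_real ltr_norml => /andP[]; lra.
Qed.

Lemma rdiff_supported F r z : (forall w, r <= sigma w -> F w = 0) ->
  r < sigma z -> rdiff F z 0 0.
Proof.
move=> F0 /supported_near[d d0 Hd]; apply: (rdiff_near d0 _ (rdiff_cst 0 z)).
by move=> w /Hd/F0 ->.
Qed.

Lemma ccontinuous_supported F r z : (forall w, r <= sigma w -> F w = 0) ->
  r < sigma z -> ccontinuous F z.
Proof.
move=> F0 rz; exact: rdiff_ccontinuous (rdiff_supported F0 rz).
Qed.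

(** With psi the primitive of the cutoff evaluated at |z - b| ^ 2, the integrand is the
    dbar-derivative of F psi, that is, the divergence of the compactly supported field (F psi / 2,
    'i F psi / 2). *)
Lemma cutoff_holomorphic F (dF : C -> C) r : 0 < r ->
  (forall z, sigma z <= r -> normc z < 1) ->
  (forall z, normc z < 1 -> rdiff F z (dF z) ('i%C * dF z)) ->
  \int[cl]_(z in @disk R) complex.Re (F z * ((z - b) * (cutoff n r (sigma z))%:C)) = 0.
Proof.
move=> r0 rD dFD; pose psi w := (cutoff_prim n r (sigma w))%:C.
have psi0 w : r <= sigma w -> psi w = 0 by move=> h; rewrite /psi cutoff_prim0.
have chi0 w : r <= sigma w -> (cutoff n r (sigma w))%:C = 0 by move=> h; rewrite cutoff0.
have out z : ~~ (normc z < 1) -> r < sigma z.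
  by move=> z1; rewrite ltNge; apply: contraNN z1; exact: rD.
pose chi z := (cutoff n r (sigma z))%:C.
(* Nothing is known of F outside the unit disk, but psi vanishes near every point there, so the
   field has derivative 0. *)
pose Px z := if normc z < 1 then 2^-1 * (dF z * psi z + F z * (chi z * (conjc (z - b) + (z - b)))) else 0.
pose Py z := if normc z < 1 then 2^-1 * ('i%C * dF z * psi z + F z * (chi z * ('i%C * (conjc (z - b) - (z - b))))) else 0.
have dP z : rdiff (fun w => 2^-1 * (F w * psi w)) z (Px z) (Py z).
  rewrite /Px /Py; case: ifPn => [z1|/out rz].
    apply: rdiffZ; apply: rdiffM (dFD z z1) _.
    by apply: (@rdiff_radial _ (cutoff n r)); exact: is_derive_cutoff_prim.
  by apply: (@rdiff_supported _ r) => // w /psi0 ->; rewrite !mulr0.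
apply: (@complex_divergence R (fun w => 2^-1 * (F w * psi w)) (fun w => 'i%C * (2^-1 * (F w * psi w))) _
  Px Py (fun z => 'i%C * Px z) (fun z => 'i%C * Py z)).
- exact: dP.
- by move=> z; exact/rdiffZ/dP.
- move=> z; rewrite /Px /Py; case: ifPn => [z1|/out/ltW/chi0 ->]; last by rewrite !mulr0 addr0.
  have i2 : 'i%C * 'i%C = -1 :> C by rewrite -expr2 sqr_i.
  rewrite -/(chi z) [LHS](_ : _ = 2^-1 * ((1 + 'i%C * 'i%C) * (dF z * psi z) +
     F z * chi z * ((conjc (z - b) + (z - b)) + ('i%C * 'i%C) * (conjc (z - b) - (z - b))))); last by ring.
  by rewrite i2; field.
- move=> z; case: (boolP (normc z < 1)) => [z1|/out rz]; last first.
    by apply: (@ccontinuous_supported _ r) => // w /chi0 ->; rewrite !mulr0.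
  apply: ccontinuousM; first exact: rdiff_ccontinuous (dFD z z1).
  apply: ccontinuousM; last exact: ccontinuous_cutoff.
  by apply: ccontinuousD; [exact: ccontinuous_id|exact: ccontinuous_cst].
- move=> z z1; have rz : r < sigma z by apply: out; rewrite -leNgt.
  by rewrite psi0 ?chi0 ?ltW// !mulr0.
Qed.

(** Green's second identity for G and p = (z - b) K0(|z - b| ^ 2): the field (G grad p - p grad G) /
    4 has divergence G Delta p / 4, which is the integrand. The conclusion says that \int G (z - b)
    chi / r ^ 2 is the same for all admissible radii. *)
Lemma cutoff_harmonic G (Gx Gy Gxx Gxy Gyx Gyy : C -> C) (r s : R) : 0 < s -> s <= r ->
  (forall z, sigma z <= r -> normc z < 1) ->
  (forall z, normc z < 1 -> [/\ rdiff G z (Gx z) (Gy z), rdiff Gx z (Gxx z) (Gxy z),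
     rdiff Gy z (Gyx z) (Gyy z) & Gxx z + Gyy z = 0]) ->
  \int[cl]_(z in @disk R) complex.Re (G z * ((z - b) *
     (cutoff n r (sigma z) / r ^+ 2 - cutoff n s (sigma z) / s ^+ 2)%:C)) = 0.
Proof.
move=> s0 sr rD hG; have r0 : 0 < r by exact: lt_le_trans sr.
have out z : ~~ (normc z < 1) -> r < sigma z.
  by move=> z1; rewrite ltNge; apply: contraNN z1; exact: rD.
(* The two Green functions have the same tail - c / t, so the difference vanishes from r on; a
   single one would not be supported in the disk. *)
pose K0 t := green n r t - green n s t.
pose K1 t := green1 n r t - green1 n s t.
pose K2 t := green2 n r t - green2 n s t.
have dK0 (t : R) : is_derive t 1 K0 (K1 t) by apply: is_deriveB; exact: is_derive_green.
have dK1 (t : R) : is_derive t 1 K1 (K2 t) by apply: is_deriveB; exact: is_derive_green1.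
have Kout t : r <= t -> [/\ K0 t = 0, K1 t = 0 & K2 t = 0].
  move=> rt; have [a1 a2 a3] := green_out n r0 rt.
  have [c1 c2 c3] := green_out n s0 (le_trans sr rt).
  by rewrite /K0 /K1 /K2 a1 a2 a3 c1 c2 c3 !subrr.
have KE t : 2 * K1 t + t * K2 t = cutoff n r t / r ^+ 2 - cutoff n s t / s ^+ 2.
  by rewrite -!green_eq// /K1 /K2; ring.
pose ka w := (K0 (sigma w))%:C; pose kb w := (K1 (sigma w))%:C; pose kc w := (K2 (sigma w))%:C.
pose ze w := w - b.
pose sx w := conjc (w - b) + (w - b); pose sy w := 'i%C * (conjc (w - b) - (w - b)).
pose p w := ze w * ka w.
pose px w := ka w + ze w * (kb w * sx w).
pose py w := 'i%C * ka w + ze w * (kb w * sy w).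
have dze z : rdiff ze z 1 'i%C.
  by apply: rdiff_eq (rdiffB (rdiff_id z) (rdiff_cst b z)) _ _; rewrite subr0.
have dzj z : rdiff (fun w => conjc (w - b)) z 1 (- 'i%C).
  have -> : (fun w => conjc (w - b)) = (fun w => conjc w - conjc b) by apply/funext => w; rewrite conjcB.
  by apply: rdiff_eq (rdiffB (rdiff_conj z) (rdiff_cst (conjc b) z)) _ _; rewrite subr0.
have i2 : 'i%C * 'i%C = -1 :> C by rewrite -expr2 sqr_i.
have dsx z : rdiff sx z 2 0.
  by apply: rdiff_eq (rdiffD (dzj z) (dze z)) _ _; ring.
have dsy z : rdiff sy z 0 2.
  apply: rdiff_eq (rdiffZ 'i%C (rdiffB (dzj z) (dze z))) _ _; first by ring.
  by rewrite [LHS](_ : _ = - 2 * ('i%C * 'i%C)); [rewrite i2; ring|ring].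
have dka z : rdiff ka z (kb z * sx z) (kb z * sy z) by exact: rdiff_radial.
have dkb z : rdiff kb z (kc z * sx z) (kc z * sy z) by exact: rdiff_radial.
have dp z : rdiff p z (px z) (py z).
  by apply: rdiff_eq (rdiffM (dze z) (dka z)) _ _; rewrite /px /py; ring.
pose pxx w := 2 * (kb w * sx w) + ze w * (kc w * sx w ^+ 2 + 2 * kb w).
pose pyy w := 2 * 'i%C * (kb w * sy w) + ze w * (kc w * sy w ^+ 2 + 2 * kb w).
(* The divergence involves the pure second derivatives; the mixed ones are left to unification. *)
have [pxy dpx] : exists pxy, forall z, rdiff px z (pxx z) (pxy z).
  eexists => z; apply: rdiff_eq; first exact: (rdiffD (dka z) (rdiffM (dze z) (rdiffM (dkb z) (dsx z)))).
    by rewrite /pxx; ring.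
  by [].
have [pyx dpy] : exists pyx, forall z, rdiff py z (pyx z) (pyy z).
  eexists => z; apply: rdiff_eq; first exact: (rdiffD (rdiffZ 'i%C (dka z)) (rdiffM (dze z) (rdiffM (dkb z) (dsy z)))).
    by [].
  by rewrite /pyy; ring.
have lap z : pxx z + pyy z = 4 * (ze z * (cutoff n r (sigma z) / r ^+ 2 - cutoff n s (sigma z) / s ^+ 2)%:C).
  have -> : (cutoff n r (sigma z) / r ^+ 2 - cutoff n s (sigma z) / s ^+ 2)%:C =
      2 * kb z + (ze z * conjc (ze z)) * kc z.
    by rewrite -KE -sqr_normcJ -rmorphM /kb -[2 in RHS](rmorph_nat (real_complex R)) -rmorphM -rmorphD.
  rewrite [LHS](_ : _ = 2 * kb z * (sx z + 'i%C * sy z) + ze z * (kc z * (sx z ^+ 2 + sy z ^+ 2) + 4 * kb z)); last by rewrite /pxx /pyy; ring.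
  have -> : sx z + 'i%C * sy z = 2 * ze z.
    rewrite /sx /sy mulrA i2 /ze; ring.
  have -> : sx z ^+ 2 + sy z ^+ 2 = 4 * (ze z * conjc (ze z)).
    rewrite /sy [LHS](_ : _ = sx z ^+ 2 + 'i%C * 'i%C * (conjc (z - b) - (z - b)) ^+ 2); last by ring.
    by rewrite i2 /sx /ze; ring.
  ring.
have p_out w : r <= sigma w -> [/\ p w = 0, px w = 0 & py w = 0].
  move=> /Kout[h1 h2 h3].
  by rewrite /p /px /py /ka /kb h1 h2 (_ : 0%:C = 0)// !mul0r !mulr0 !addr0.
pose Ax z := if normc z < 1 then 4^-1 * (Gx z * px z + G z * pxx z - (px z * Gx z + p z * Gxx z)) else 0.
pose Ay z := if normc z < 1 then 4^-1 * (Gy z * px z + G z * pxy z - (py z * Gx z + p z * Gxy z)) else 0.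
pose Bx z := if normc z < 1 then 4^-1 * (Gx z * py z + G z * pyx z - (px z * Gy z + p z * Gyx z)) else 0.
pose By z := if normc z < 1 then 4^-1 * (Gy z * py z + G z * pyy z - (py z * Gy z + p z * Gyy z)) else 0.
apply: (@complex_divergence R (fun w => 4^-1 * (G w * px w - p w * Gx w)) (fun w => 4^-1 * (G w * py w - p w * Gy w)) _
  Ax Ay Bx By).
- move=> z; rewrite /Ax /Ay; case: ifPn => [/hG[h1 h2 h3 _]|/out rz].
    apply: rdiffZ; apply: rdiffB; apply: rdiffM => //.
  by apply: (@rdiff_supported _ r) => // w /p_out[-> -> _]; rewrite mulr0 mul0r subr0 mulr0.
- move=> z; rewrite /Bx /By; case: ifPn => [/hG[h1 h2 h3 _]|/out rz].
    apply: rdiffZ; apply: rdiffB; apply: rdiffM => //.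
  by apply: (@rdiff_supported _ r) => // w /p_out[-> _ ->]; rewrite mulr0 mul0r subr0 mulr0.
- move=> z; rewrite /Ax /By; case: ifPn => [/hG[_ _ _ h]|/out/ltW rz]; last first.
    by rewrite !cutoff0 ?(le_trans sr rz)// !mul0r subrr !mulr0 addr0.
  rewrite [LHS](_ : _ = 4^-1 * (G z * (pxx z + pyy z) - p z * (Gxx z + Gyy z))); last by ring.
  by rewrite lap h /ze; move: (_ - _)%:C => X; field.
- move=> z; case: (boolP (normc z < 1)) => [/hG[h1 _ _ _]|/out rz]; last first.
    apply: (@ccontinuous_supported _ r) => // w rw.
    by rewrite !cutoff0 ?(le_trans sr rw)// !mul0r subrr !mulr0.
  apply: ccontinuousM; first exact: rdiff_ccontinuous h1.
  apply: ccontinuousM; first exact: rdiff_ccontinuous (dze z).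
  under [X in ccontinuous X]eq_fun do rewrite rmorphB !rmorphM.
  apply: ccontinuousD.
    by apply: ccontinuousM; [exact: ccontinuous_cutoff|exact: ccontinuous_cst].
  under [X in ccontinuous X]eq_fun do rewrite -mulN1r.
  apply: ccontinuousM; first exact: ccontinuous_cst.
  by apply: ccontinuousM; [exact: ccontinuous_cutoff|exact: ccontinuous_cst].
- move=> z z1; have /ltW rz : r < sigma z by apply: out; rewrite -leNgt.
  have [-> -> ->] := p_out z rz.
  by rewrite !cutoff0 ?(le_trans sr rz)// !mul0r subrr !mulr0 subrr mulr0.
Qed.

End cutoff_integrals.

(** * Moments of the unit disk and of the cutoff *)

Section disk_moments.
Variable R : realType.
Local Notation C := R[i].
Local Notation mu := (@lebesgue_measure R).
Local Notation m2 := (mu \x mu)%E.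
Local Notation cl := (@complex_lebesgue R).

Lemma ccontinuous_glue0 (f df : R -> R) (a : R) (s : C -> R) z :
  (forall t : R, is_derive t 1 f (df t)) -> f a = 0 ->
  ccontinuous (fun w => (s w)%:C) z ->
  ccontinuous (fun w => (if s w <= a then f (s w) else 0)%:C) z.
Proof.
move=> df1 fa cs e e0.
have cf : {for Num.min (s z) a, continuous f}.
  by apply: differentiable_continuous; apply/derivable1_diffP; have [] := df1 (Num.min (s z) a).
have gE t : (if t <= a then f t else 0) = f (Num.min t a).
  by rewrite /Num.min; case: ltgtP => [||->].
move: cf => /cvgrPdist_lt/(_ e e0) /nbhs_ballP[d d0 Hd]; rewrite /= in d0 Hd.
have [d' d'0 Hd'] := cs d d0; exists d' => // w wz.
have h : `|s w - s z| < d by rewrite -normc_real rmorphB; exact: Hd'.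
have -> (x y : R) : normc (x%:C - y%:C) = `|x - y| by rewrite -rmorphB normc_real.
rewrite !gE distrC; apply: Hd; rewrite /ball/=.
apply: le_lt_trans h; have := ler_norm (s w - s z); have := ler_norm (- (s w - s z)).
rewrite normrN ler_norml /Num.min => h1 h2.
by case: (ltP (s z) a) => h3; case: (ltP (s w) a) => h4; apply/andP; split; lra.
Qed.

Definition moment k : R := \int[cl]_(z in @disk R) (normc z ^+ 2) ^+ k.

Let rdiff_sqr (K dK : R -> R) z : is_derive (normc z ^+ 2) 1 K (dK (normc z ^+ 2)) ->
  rdiff (fun w => (K (normc w ^+ 2))%:C) z ((dK (normc z ^+ 2))%:C * (conjc z + z))
    ((dK (normc z ^+ 2))%:C * ('i%C * (conjc z - z))).
Proof.
move=> dKz; have := @rdiff_radial R 0 K dK z; rewrite subr0 => /(_ dKz).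
by under eq_fun do rewrite subr0.
Qed.

Lemma ccontinuous_sqr_normc z : ccontinuous (fun w => (normc w ^+ 2)%:C : C) z.
Proof.
exact: rdiff_ccontinuous (@rdiff_sqr id (fun=> 1) z (is_derive_id _ _)).
Qed.

Lemma integrable_moment k : cl.-integrable (@disk R) (fun z => ((normc z ^+ 2) ^+ k)%:E).
Proof.
have := @integrable_disk R (fun w => ((normc w ^+ 2) ^+ k)%:C); apply => z.
elim: k => [|k IH].
  by under eq_fun do rewrite expr0; exact: ccontinuous_cst.
under eq_fun do rewrite exprS rmorphM; apply: ccontinuousM => //.
exact: ccontinuous_sqr_normc.
Qed.

(** The polynomial f(s) = s ^ k (1 - s) ^ 2 has a double zero at 1, so z f(|z| ^ 2) stays
    differentiable when continued by 0 outside the disk. Its derivative in z is f + s f' at s = |z|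
    ^ 2, and the integral of that derivative vanishes. *)
Lemma moment_rec k :
  k.+1%:R * moment k - 2 * (k.+2%:R * moment k.+1) + k.+3%:R * moment k.+2 = 0.
Proof.
pose f (s : R) := s ^+ k - 2 * s ^+ k.+1 + s ^+ k.+2.
pose f1 (s : R) := k%:R * s ^+ k.-1 - 2 * (k.+1%:R * s ^+ k) + k.+2%:R * s ^+ k.+1.
have dX m (s : R) : is_derive s 1 (fun s => s ^+ m) (m%:R * s ^+ m.-1).
  by have := is_deriveX m (is_derive_id s (1 : R)); rewrite fctE /GRing.scale/= mulr1.
have df (s : R) : is_derive s 1 f (f1 s).
  have h1 := dX k s; have h2 := dX k.+1 s; have h3 := dX k.+2 s.
  by apply: is_derive_eq; rewrite /GRing.scale/= /f1; ring.
pose K s := if s <= 1 then f s else 0.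
pose K1 s := if s <= 1 then f1 s else 0.
have dK (s : R) : is_derive s 1 K (K1 s).
  apply: (@is_derive_glue R f (fun=> 0) f1 (fun=> 0) 1) => //.
  - by rewrite /f !expr1n; ring.
  - by rewrite /f1 !expr1n -!(natr1 k) -!(natr1 k.+1); ring.
pose g (s : R) := k.+1%:R * s ^+ k - 2 * (k.+2%:R * s ^+ k.+1) + k.+3%:R * s ^+ k.+2.
have gE (s : R) : (if s <= 1 then g s else 0) = K s + s * K1 s.
  rewrite /K /K1; case: ifP => _; last by rewrite mulr0 addr0.
  have skE : s * (k%:R * s ^+ k.-1) = k%:R * s ^+ k.
    by case: k {f f1 dX df K K1 dK g} => [|m]; [rewrite !mul0r mulr0|rewrite mulrCA -exprS].
  rewrite /f1 /f 2!mulrDr skE mulrN /g !exprS -!(natr1 k.+2) -!(natr1 k.+1) -!(natr1 k); ring.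
have dg (s : R) : exists dgs : R, is_derive s 1 g dgs.
  have h1 := dX k s; have h2 := dX k.+1 s; have h3 := dX k.+2 s.
  by eexists; apply: is_derive_eq.
have {dg}[dg Hdg] : exists dg : R -> R, forall s : R, is_derive s 1 g (dg s).
  by exists (fun s => projT1 (cid (dg s))) => s; case: cid.
have g1 : g 1 = 0 by rewrite /g !expr1n -!(natr1 k.+2) -!(natr1 k.+1) -!(natr1 k); ring.
have out z : 1 <= normc z -> K (normc z ^+ 2) = 0 /\ (if normc z ^+ 2 <= 1 then g (normc z ^+ 2) else 0) = 0.
  rewrite /K => z1; have : 1 <= normc z ^+ 2 by rewrite exprn_ege1.
  rewrite le_eqVlt => /predU1P[<-|h]; last by rewrite leNgt h.
  by rewrite lexx g1 /f !expr1n; split => //; ring.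
have I0 : \int[cl]_(z in @disk R) complex.Re (if normc z ^+ 2 <= 1 then g (normc z ^+ 2) else 0)%:C = 0.
  have dze (z : C) := rdiff_id z.
  apply: (@complex_divergence R (fun z => 2^-1 * (z * (K (normc z ^+ 2))%:C))
     (fun z => - 'i%C * (2^-1 * (z * (K (normc z ^+ 2))%:C)))).
  - by move=> z; apply: rdiffZ; apply: rdiffM (dze z) _; exact: rdiff_sqr.
  - by move=> z; apply: rdiffZ; apply: rdiffZ; apply: rdiffM (dze z) _; exact: rdiff_sqr.
  - move=> z; rewrite gE; set s := normc z ^+ 2.
    have -> : (K s + s * K1 s)%:C = (K s)%:C + (z * conjc z) * (K1 s)%:C.
      by rewrite -sqr_normcJ -rmorphM -rmorphD.
    have i2 : 'i%C * 'i%C = -1 :> C by rewrite -expr2 sqr_i.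
    move: (K s)%:C (K1 s)%:C => x y.
    rewrite [LHS](_ : _ = 2^-1 * (x * (1 - 'i%C * 'i%C) + z * y * (conjc z + z - 'i%C * 'i%C * (conjc z - z)))); last by ring.
    by rewrite i2; field.
  - by move=> z; apply: (ccontinuous_glue0 Hdg g1); exact: ccontinuous_sqr_normc.
  - by move=> z /out[-> ->]; rewrite (_ : 0%:C = 0)// !mulr0.
move: I0; rewrite (@eq_Rintegral _ _ _ _ _ (fun z : C => k.+1%:R * (normc z ^+ 2) ^+ k -
   (2 * k.+2%:R) * (normc z ^+ 2) ^+ k.+1 + k.+3%:R * (normc z ^+ 2) ^+ k.+2)); last first.
  move=> z; rewrite inE diskE => z1; rewrite ifT ?exprn_ile1 ?normc_ge0 1?ltW//.
  by rewrite /= /g mulrA.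
have mD := @measurable_disk R.
have iZ c m : cl.-integrable (@disk R) (EFin \o (fun z => c * (normc z ^+ 2) ^+ m)).
  by apply: (integrableZl mD c (integrable_moment m)).
rewrite RintegralD//; last by apply: (integrableB mD (iZ _ _) (iZ _ _)).
rewrite RintegralB// !RintegralZl//; try exact: integrable_moment.
by rewrite -/(moment k) -/(moment k.+1) -/(moment k.+2) mulrA.
Qed.

Lemma moment_cvg0 : moment k @[k --> \oo] --> 0.
Proof.
have mD := @measurable_disk R.
have z01 z k : @disk R z -> 0 <= (normc z ^+ 2) ^+ k <= 1.
  by rewrite diskE => /ltW z1; rewrite exprn_ge0 ?sqr_ge0//= !exprn_ile1 ?exprn_ge0 ?normc_ge0.
have h1 : {ae cl, forall z, @disk R z -> ((normc z ^+ 2) ^+ k)%:E @[k --> \oo] --> 0%E}.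
  apply: aeW => z; rewrite diskE => z1; apply: cvg_EFin; first by near=> k.
  apply: cvg_expr; rewrite ger0_norm ?sqr_ge0// exprn_ilt1// normc_ge0//.
have h2 : cl.-integrable (@disk R) (fun=> 1%:E).
  by have := integrable_moment 0; under eq_fun do rewrite expr0.
have h3 : {ae cl, forall z k, @disk R z -> (`|((normc z ^+ 2) ^+ k)%:E| <= 1%:E)%E}.
  apply: aeW => z k /(z01 _ k)/andP[z0 z1]; rewrite lee_fin ger0_norm//.
have [_ _ h] := dominated_convergence mD (fun k => measurable_int _ (integrable_moment k))
  (measurable_cst _) h1 h2 h3.
have i0 : (\int[cl]_(z in @disk R) (cst 0 z : \bar R) = 0%:E)%E by apply: integral0_eq.
by move: h; rewrite i0 => /fine_cvg.
Unshelve. all: by end_near. Qed.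

(** By the recurrence (k + 1) moment k is affine in k; its slope is the limit of moment k, which is
    0. The area [moment 0] stays unevaluated, as only ratios to it enter the final constant. *)
Lemma momentE k : moment k = moment 0 / k.+1%:R.
Proof.
pose a k := k.+1%:R * moment k.
have aE m : a m = a 0%N + m%:R * (a 1%N - a 0%N) /\ a m.+1 = a 0%N + m.+1%:R * (a 1%N - a 0%N).
  elim: m => [|m [IH1 IH2]]; first by rewrite mul0r mul1r addr0; split => //; ring.
  split => //; have := moment_rec m; rewrite -/(a m) -/(a m.+1) -/(a m.+2) => h.
  have -> : a m.+2 = 2 * a m.+1 - a m by lra.
  by rewrite IH1 IH2 -!(natr1 m.+1) -!(natr1 m); ring.
suff d0 : a 1%N - a 0%N = 0.
  have [+ _] := aE k; rewrite d0 mulr0 addr0 /a mul1r => <-.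
  by rewrite mulrAC divff ?mul1r// pnatr_eq0.
have mE m : moment m = (a 1%N - a 0%N) + (a 0%N - (a 1%N - a 0%N)) * harmonic m.
  have [+ _] := aE m; rewrite /harmonic/= -{1}[a m]/(m.+1%:R * moment m) => h.
  have m0 : m.+1%:R != 0 :> R by rewrite pnatr_eq0.
  by apply: (mulfI m0); rewrite h -(natr1 m); field; rewrite natr1.
have : moment m @[m --> \oo] --> (a 1%N - a 0%N) + (a 0%N - (a 1%N - a 0%N)) * 0.
  rewrite (funext mE); apply: cvgD; first exact: cvg_cst.
  by apply: cvgMr; exact: cvg_harmonic.
rewrite mulr0 addr0 => h; by apply: (cvg_unique _ h moment_cvg0); exact: Rhausdorff.
Qed.

Lemma affine_integral (G : R -> R) (b s : R) : 0 < s -> continuous G -> (forall x, 0 <= G x) ->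
  (\int[mu]_x (G x)%:E = \int[mu]_x (s * G (b + s * x))%:E)%E.
Proof.
move=> s0 cG G0; pose F (x : R) : R := b + s * x.
have dF (x : R) : is_derive x 1 F s.
  by apply: is_derive_eq; rewrite /GRing.scale/=; ring.
have F1 : derive1 F = cst s by apply/funext => x; rewrite derive1E; have [] := dF x.
rewrite (@increasing_ge0_integration_by_substitutionT R F G)//.
- by apply: eq_integral => x _; rewrite F1 fctE/= mulrC.
- by move=> x y xy; rewrite /F ltrD2l ltr_pM2l.
- by rewrite F1 => x; exact: cvg_cst.
- by rewrite F1; exact: is_cvg_cst.
- by rewrite F1; exact: is_cvg_cst.
- apply/cvgrNyPle => A; exists ((A - b) / s); split; first exact: num_real.
  by move=> x; rewrite ltr_pdivlMr// /F mulrC => h; lra.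
- apply/cvgryPge => A; exists ((A - b) / s); split; first exact: num_real.
  by move=> x; rewrite ltr_pdivrMr// /F mulrC => h; lra.
Qed.

Lemma affine_integral2 (h : R * R -> R) (b1 b2 s : R) : 0 < s -> pcontinuous h ->
  (forall p, 0 <= h p) ->
  (\int[m2]_p (h p)%:E = \int[m2]_p (s ^+ 2 * h (b1 + s * p.1, b2 + s * p.2))%:E)%E.
Proof.
move=> s0 ch h0.
have cB : pcontinuous (fun p => s ^+ 2 * h (b1 + s * p.1, b2 + s * p.2)).
  move=> p e e0; have s2 : 0 < s ^+ 2 by rewrite exprn_gt0.
  have [d d0 Hd] := ch (b1 + s * p.1, b2 + s * p.2) (e / s ^+ 2) ltac:(by rewrite divr_gt0).
  exists (d / s); first by rewrite divr_gt0.
  move=> q; rewrite gt_max !ltr_pdivlMr// => /andP[q1 q2].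
  rewrite -mulrBr normrM (gtr0_norm s2) mulrC -ltr_pdivlMr//; apply: Hd => /=.
  rewrite gt_max [X in `|X| < _](_ : _ = (q.1 - p.1) * s); last by ring.
  rewrite [X in _ && (`|X| < _)](_ : _ = (q.2 - p.2) * s); last by ring.
  by rewrite !normrM !(gtr0_norm s0) q1.
have mE (f : R * R -> R) : pcontinuous f -> measurable_fun setT (fun p : measurableTypeR R * measurableTypeR R => (f p)%:E).
  by move=> cf; apply/measurable_EFinP; exact: pcontinuous_measurable.
have ge0 x : 0 <= s * x = (0 <= x) by rewrite pmulr_rge0.
(* Half-way integrand, with only the second variable rescaled; Tonelli is used in one order before
   it and in the other after it. *)
pose H (p : R * R) := s * h (p.1, b2 + s * p.2).
have cH : pcontinuous H.
  move=> p e e0.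
  have [d d0 Hd] := ch (p.1, b2 + s * p.2) (e / s) ltac:(by rewrite divr_gt0).
  exists (Num.min d (d / s)); first by rewrite lt_min d0 divr_gt0.
  move=> q; rewrite lt_min gt_max => /andP[/andP[q1 _]]; rewrite gt_max ltr_pdivlMr// => /andP[_].
  rewrite ltr_pdivlMr// => q2.
  rewrite -mulrBr normrM (gtr0_norm s0) mulrC -ltr_pdivlMr//; apply: Hd => /=.
  rewrite gt_max q1 [X in (`|X| < _)](_ : _ = (q.2 - p.2) * s); last by ring.
  by rewrite normrM (gtr0_norm s0) q2.
have step1 : (\int[m2]_p (h p)%:E = \int[m2]_p (H p)%:E)%E.
  rewrite [LHS](fubini_tonelli1 _ (mE _ ch)) => [|p]; last by rewrite lee_fin.
  rewrite [RHS](fubini_tonelli1 _ (mE _ cH)) => [|p]; last by rewrite lee_fin ge0.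
  apply: eq_integral => x _; rewrite /fubini_F; apply: (affine_integral b2 s0) => //.
  exact: pcontinuous_slice1.
rewrite step1.
rewrite [LHS](fubini_tonelli2 _ (mE _ cH)) => [|p]; last by rewrite lee_fin ge0.
rewrite [RHS](fubini_tonelli2 _ (mE _ cB)) => [|p]; last by rewrite lee_fin mulr_ge0// sqr_ge0.
apply: eq_integral => y _; rewrite /fubini_G.
rewrite (@affine_integral (fun x => H (x, y)) b1 s s0).
- by apply: eq_integral => x _; rewrite /H/= mulrA.
- exact: pcontinuous_slice2.
- by move=> x; rewrite ge0.
Qed.

Lemma Rintegral_disk_plane (f : C -> C) : (forall z, ccontinuous f z) ->
  (forall z, 1 <= normc z -> f z = 0) ->
  \int[cl]_(z in @disk R) complex.Re (f z) =
  fine (\int[m2]_p (complex.Re (f (pair_complex p)))%:E)%E.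
Proof.
move=> cf f0; rewrite Rintegral_disk// Rintegral_mkcond /Rintegral; congr fine.
apply: eq_integral => p _; rewrite patchE; case: ifPn => // pr; congr EFin.
rewrite f0// leNgt; apply: contraNN pr => p1; rewrite inE.
by apply: preimage_disk_rect; rewrite /preimage/= diskE.
Qed.

Lemma cutoffM n (r u : R) : 0 < r -> cutoff n r (r * u) = cutoff n 1 u.
Proof.
move=> r0; rewrite /cutoff -[X in _ <= X]mulr1 ler_pM2l// divr1.
by rewrite mulrAC divff ?mul1r// gt_eqF.
Qed.

(** The substitution z = b + sqrt r u reduces to b = 0 and r = 1, where the integral is
    [moment 1 - moment n.+2]. Since the integrand vanishes off the disk, the substitution is made on
    the whole plane. *)
Lemma cutoff_moment n (b : C) r : 0 < r ->
  (forall z, normc (z - b) ^+ 2 <= r -> normc z < 1) ->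
  \int[cl]_(z in @disk R) (normc (z - b) ^+ 2 * cutoff n r (normc (z - b) ^+ 2)) =
  r ^+ 2 * moment 0 * (2^-1 - n.+3%:R^-1).
Proof.
move=> r0 rD.
pose f (c : C) t (z : C) := (normc (z - c) ^+ 2 * cutoff n t (normc (z - c) ^+ 2))%:C.
have cf c t z : 0 < t -> ccontinuous (f c t) z.
  move=> t0; rewrite /f; under eq_fun do rewrite rmorphM.
  apply: ccontinuousM; last exact: ccontinuous_cutoff.
  exact: rdiff_ccontinuous (rdiff_sqr_normc c z).
have -> : \int[cl]_(z in @disk R) (normc (z - b) ^+ 2 * cutoff n r (normc (z - b) ^+ 2)) =
   \int[cl]_(z in @disk R) complex.Re (f b r z) by [].
rewrite Rintegral_disk_plane; last 2 first.
- by move=> z; exact: cf.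
- move=> z z1; rewrite /f cutoff0 ?mulr0//; apply: ltW; rewrite ltNge; apply/negP => /rD.
  by rewrite ltNge z1.
rewrite (@affine_integral2 (fun p => complex.Re (f b r (pair_complex p))) (complex.Re b) (complex.Im b) (Num.sqrt r)); last 3 first.
- by rewrite sqrtr_gt0.
- by apply: ccontinuous_pcontinuous => z; exact: cf.
- by move=> p /=; rewrite mulr_ge0 ?sqr_ge0// cutoff_ge0// sqr_ge0.
have scE p : Num.sqrt r ^+ 2 * complex.Re (f b r (pair_complex (complex.Re b + Num.sqrt r * p.1, complex.Im b + Num.sqrt r * p.2))) =
    complex.Re ((r ^+ 2)%:C * f 0 1 (pair_complex p)).
  have key (c : C) : pair_complex (complex.Re c + Num.sqrt r * p.1, complex.Im c + Num.sqrt r * p.2) - c =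
      (Num.sqrt r)%:C * pair_complex p.
    case: c => c1 c2; apply/eqP; rewrite eq_complex/= !mul0r subr0 addr0.
    by apply/andP; split; apply/eqP; ring.
  rewrite /f -rmorphM subr0 key normcM normc_real exprMn (ger0_norm (sqrtr_ge0 _)) sqr_sqrtr ?(ltW r0)//.
  rewrite cutoffM// -[LHS]/(r * (_ * _)) -[RHS]/(r ^+ 2 * (_ * _)); ring.
rewrite (_ : (\int[m2]_p _ = \int[m2]_p (complex.Re ((r ^+ 2)%:C * f 0 1 (pair_complex p)))%:E)%E); last first.
  by apply: eq_integral => p _; rewrite scE.
rewrite -(@Rintegral_disk_plane (fun z => (r ^+ 2)%:C * f 0 1 z)); last 2 first.
- by move=> z; apply: ccontinuousM; [exact: ccontinuous_cst|exact: cf].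
- move=> z z1; rewrite /f subr0 cutoff0// ?exprn_ege1//.
  by rewrite (_ : (_ * 0)%:C = 0) ?mulr0//; rewrite mulr0.
rewrite (@eq_Rintegral _ _ _ _ _ (fun z : C => r ^+ 2 * ((normc z ^+ 2) ^+ 1 - (normc z ^+ 2) ^+ n.+2))); last first.
  move=> z; rewrite inE diskE => z1; rewrite /f -rmorphM subr0 /cutoff divr1 ifT.
    by rewrite /= expr1; congr (_ * _); rewrite !exprS; ring.
  by rewrite exprn_ile1 ?normc_ge0 ?ltW.
have mD := @measurable_disk R.
rewrite RintegralZl//; last exact: (integrableB mD (integrable_moment 1) (integrable_moment n.+2)).
rewrite RintegralB//; try exact: integrable_moment.
rewrite -/(moment 1) -/(moment n.+2) (momentE 1) (momentE n.+2); field.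
by rewrite -natrD pnatr_eq0.
Qed.

End disk_moments.

(** * Pairing a harmonic function with the cutoff *)

Section harmonic_functions.
Variables (R : realType).
Local Notation C := R[i].
Local Notation cl := (@complex_lebesgue R).
Implicit Types (F g : C -> C) (b c z w : C) (r : R).

Lemma disk_near z : normc z < 1 -> forall w, normc (w - z) < 1 - normc z -> @disk R w.
Proof.
move=> z1 w wz; rewrite diskE; have := normcB_tri w z 0; rewrite !subr0; lra.
Qed.

Lemma disk_C1_rdiff g z : C1_on (@disk R) g -> normc z < 1 ->
  rdiff g z (partial_x g z) (partial_y g z).
Proof.
move=> gC1 z1; apply: (C1_rdiff gC1 _ (disk_near z1)); lra.
Qed.

Lemma disk_derivable_rdiff F : (forall z, @disk R z -> derivable F z 1) ->
  forall z, normc z < 1 -> rdiff F z (derive1 F z) ('i%C * derive1 F z).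
Proof. by move=> dF z z1; apply: rdiff_holomorphic; apply: dF; rewrite diskE. Qed.

Lemma ccontinuous_cutoff_mul n b r F : 0 < r ->
  (forall z, normc (z - b) ^+ 2 <= r -> normc z < 1) ->
  (forall z, normc z < 1 -> ccontinuous F z) ->
  forall z, ccontinuous (fun z => F z * ((z - b) * (cutoff n r (normc (z - b) ^+ 2))%:C)) z.
Proof.
move=> r0 rD cF z; case: (boolP (normc z < 1)) => [z1|z1].
  apply: ccontinuousM; first exact: cF.
  apply: ccontinuousM; last exact: ccontinuous_cutoff.
  by apply: ccontinuousD; [exact: ccontinuous_id|exact: ccontinuous_cst].
apply: (@ccontinuous_supported _ b _ r) => [w rw|]; first by rewrite cutoff0// !mulr0.
by rewrite ltNge; apply: contraNN z1; exact: rD.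
Qed.

(** By [cutoff_harmonic], A s / s ^ 2 does not depend on s and may be estimated for small s. There c
    g is within e |z - b| of its first-order part at b. The holomorphic half of that part is
    annihilated by [cutoff_holomorphic], and the conjugate-linear half gives D \int |z - b| ^ 2 chi.
    Division by s ^ 2 leaves an error e M1, for every e > 0. *)
Lemma cutoff_dbar n b r g c : 0 < r ->
  (forall z, normc (z - b) ^+ 2 <= r -> normc z < 1) ->
  harmonic_on (@disk R) g ->
  \int[cl]_(z in @disk R) complex.Re (c * g z * ((z - b) * (cutoff n r (normc (z - b) ^+ 2))%:C)) =
  complex.Re (c * dbar g b) *
  \int[cl]_(z in @disk R) (normc (z - b) ^+ 2 * cutoff n r (normc (z - b) ^+ 2)).
Proof.
move=> r0 rD [g1 gx1 gy1 lap].
have mD := @measurable_disk R.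
pose G z := c * g z.
have dG z : normc z < 1 -> rdiff G z (c * partial_x g z) (c * partial_y g z).
  by move=> z1; exact/rdiffZ/disk_C1_rdiff.
have cG z : normc z < 1 -> ccontinuous G z by move=> /dG /rdiff_ccontinuous.
have b1 : normc b < 1 by apply: rD; rewrite subrr normc0 expr0n ltW.
have sD s : s <= r -> forall z, normc (z - b) ^+ 2 <= s -> normc z < 1.
  by move=> sr z zs; apply: rD; exact: le_trans sr.
pose q s z := G z * ((z - b) * (cutoff n s (normc (z - b) ^+ 2))%:C).
have cq s : 0 < s -> s <= r -> forall z, ccontinuous (q s) z.
  by move=> s0 sr; apply: ccontinuous_cutoff_mul => //; exact: sD.
pose A s := \int[cl]_(z in @disk R) complex.Re (q s z).
pose M1 := moment R 0 * (2^-1 - n.+3%:R^-1).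
have Mom s : 0 < s -> s <= r ->
    \int[cl]_(z in @disk R) (normc (z - b) ^+ 2 * cutoff n s (normc (z - b) ^+ 2)) = s ^+ 2 * M1.
  by move=> s0 sr; rewrite cutoff_moment ?mulrA//; exact: sD.
have hG z : normc z < 1 -> [/\ rdiff G z (c * partial_x g z) (c * partial_y g z),
    rdiff (fun z => c * partial_x g z) z (c * partial_x (partial_x g) z) (c * partial_y (partial_x g) z),
    rdiff (fun z => c * partial_y g z) z (c * partial_x (partial_y g) z) (c * partial_y (partial_y g) z) &
    c * partial_x (partial_x g) z + c * partial_y (partial_y g) z = 0].
  move=> z1; split; [exact: dG|exact/rdiffZ/disk_C1_rdiff|exact/rdiffZ/disk_C1_rdiff|].
  by rewrite -mulrDr lap ?mulr0// diskE.
have ReM (a : C) (x : R) : complex.Re a * x = complex.Re (a * x%:C).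
  by case: a => u v /=; rewrite mulr0 subr0.
have ReB (x y : C) : complex.Re (x - y) = complex.Re x - complex.Re y by rewrite raddfB.
have Ascale s : 0 < s -> s <= r -> A s / s ^+ 2 = A r / r ^+ 2.
  move=> s0 sr; apply/esym/eqP; rewrite -subr_eq0; apply/eqP.
  have := cutoff_harmonic n s0 sr rD hG.
  have -> : (fun z => complex.Re (G z * ((z - b) *
    (cutoff n r (normc (z - b) ^+ 2) / r ^+ 2 - cutoff n s (normc (z - b) ^+ 2) / s ^+ 2)%:C))) =
    (fun z => complex.Re (q r z) * (r ^+ 2)^-1 - complex.Re (q s z) * (s ^+ 2)^-1).
    by apply/funext => z; rewrite /q !ReM -ReB; congr complex.Re; rewrite rmorphB !rmorphM; ring.
  have iq t : 0 < t -> t <= r -> cl.-integrable (@disk R) (EFin \o (fun z => complex.Re (q t z))).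
    by move=> t0 tr; apply: integrable_disk; exact: cq.
  have iqZ t (k : R) : 0 < t -> t <= r -> cl.-integrable (@disk R) (EFin \o (fun z => complex.Re (q t z) * k)).
    by move=> t0 tr; apply: (integrableZr mD k (iq t t0 tr)).
  rewrite (RintegralB mD (iqZ r _ r0 (lexx r)) (iqZ s _ s0 sr)).
  by rewrite (RintegralZr _ mD (iq r r0 (lexx r))) (RintegralZr _ mD (iq s s0 sr)).
pose Gx := c * partial_x g b; pose Gy := c * partial_y g b.
pose D : C := c * dbar g b.
have DE : D = 2^-1 * (Gx + 'i%C * Gy).
  by rewrite /D /dbar /Gx /Gy complexiE; ring.
pose gz : C := 2^-1 * (Gx - 'i%C * Gy).
(* Holomorphic half of the first-order expansion of G at b; the other half is D conj(z - b). *)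
pose L z := G b + gz * (z - b).
have dL z : rdiff L z gz ('i%C * gz).
  apply: rdiff_eq (rdiffD (rdiff_cst (G b) z) (rdiffZ gz (rdiffB (rdiff_id z) (rdiff_cst b z)))) _ _.
    by rewrite add0r subr0 mulr1.
  by rewrite add0r subr0 mulrC.
have M10 : 0 <= M1.
  rewrite /M1 mulr_ge0//; first by apply: Rintegral_ge0 => z _; rewrite expr0.
  by rewrite subr_ge0 lef_pV2 ?posrE// ler_nat.
suff E e : 0 < e -> `|A r / r ^+ 2 - complex.Re D * M1| <= e * M1.
  have : A r / r ^+ 2 = complex.Re D * M1.
    apply/eqP; rewrite -subr_eq0 -normr_le0; apply/ler_addgt0Pr => e e0; rewrite add0r.
    have M11 : 0 < M1 + 1 by lra.
    apply: le_trans (E (e / (M1 + 1)) _) _; first by rewrite divr_gt0.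
    by rewrite mulrAC ler_pdivrMr// ler_pM2l//; lra.
  rewrite Mom// -/(A r) => /(congr1 ( *%R^~ (r ^+ 2))); rewrite divfK ?expf_neq0 ?gt_eqF// => ->.
  by rewrite -mulrA [M1 * _]mulrC.
move=> e0; have [d d0 Hd] := (rdiffP G b Gx Gy).1 (dG b b1) e e0.
(* On the support of the cutoff |z - b| <= d / 2, strictly inside the range of the expansion. *)
pose s := Num.min r ((d / 2) ^+ 2).
have s0 : 0 < s by rewrite lt_min r0 exprn_gt0// divr_gt0.
have sr : s <= r by rewrite ge_min lexx.
pose chi z := cutoff n s (normc (z - b) ^+ 2).
have chi0 z : 0 <= chi z by apply: cutoff_ge0 => //; exact: sqr_ge0.
have cchi z : ccontinuous (fun z => (chi z)%:C) z by exact: ccontinuous_cutoff.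
have csq z : ccontinuous (fun z => (normc (z - b) ^+ 2)%:C) z.
  exact: rdiff_ccontinuous (rdiff_sqr_normc b z).
pose l z := L z * ((z - b) * (chi z)%:C).
pose m z : R := normc (z - b) ^+ 2 * chi z.
have iq : cl.-integrable (@disk R) (EFin \o (fun z => complex.Re (q s z))).
  by apply: integrable_disk; exact: cq.
have il : cl.-integrable (@disk R) (EFin \o (fun z => complex.Re (l z))).
  apply: integrable_disk => z; apply: ccontinuousM; first exact: rdiff_ccontinuous (dL z).
  apply: ccontinuousM => //.
  by apply: ccontinuousD; [exact: ccontinuous_id|exact: ccontinuous_cst].
have im : cl.-integrable (@disk R) (EFin \o m).
  have := @integrable_disk R (fun z => (m z)%:C); apply => z; rewrite /m.
  by under eq_fun do rewrite rmorphM; exact: ccontinuousM.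
have imZ k : cl.-integrable (@disk R) (EFin \o (fun z => k * m z)).
  exact: (integrableZl mD k im).
have l0 : \int[cl]_(z in @disk R) complex.Re (l z) = 0.
  by apply: (cutoff_holomorphic n s0 (sD s sr)) => z _; exact: dL.
pose X z := complex.Re (q s z) - complex.Re (l z) - complex.Re D * m z.
have iql := integrableB mD iq il.
have iX : cl.-integrable (@disk R) (EFin \o X) by exact: (integrableB mD iql (imZ _)).
have XE : \int[cl]_(z in @disk R) X z = A s - complex.Re D * (s ^+ 2 * M1).
  rewrite (RintegralB mD iql (imZ _)) (RintegralB mD iq il) l0 subr0 (RintegralZl _ mD im).
  by rewrite Mom.
have Xle z : `|X z| <= e * m z.
  rewrite /X ReM -!ReB; apply: le_trans (normRe_le _) _.
  have -> : q s z - l z - D * (m z)%:C =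
      (G z - G b - Gx * (complex.Re (z - b))%:C - Gy * (complex.Im (z - b))%:C) * ((z - b) * (chi z)%:C).
    have -> : (m z)%:C = (z - b) * conjc (z - b) * (chi z)%:C by rewrite rmorphM -sqr_normcJ.
    have zE := complex_ReIm (z - b).
    have zcE : conjc (z - b) = (complex.Re (z - b))%:C - 'i%C * (complex.Im (z - b))%:C.
      by case: (z - b) => u v; apply/eqP; rewrite eq_complex/=; apply/andP; split; apply/eqP; ring.
    have key : Gx * (complex.Re (z - b))%:C + Gy * (complex.Im (z - b))%:C = gz * (z - b) + D * conjc (z - b).
      rewrite zcE {3}zE DE /gz.
      have i2 : 'i%C * 'i%C = -1 :> C by rewrite -expr2 sqr_i.
      move: (complex.Re _)%:C (complex.Im _)%:C => x y.
      rewrite [RHS](_ : _ = Gx * x - ('i%C * 'i%C) * Gy * y); last by field.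
      by rewrite i2; ring.
    rewrite /q /l /L -/(chi z).
    rewrite [RHS](_ : _ = (G z - G b - (Gx * (complex.Re (z - b))%:C + Gy * (complex.Im (z - b))%:C)) * ((z - b) * (chi z)%:C)); last by ring.
    by rewrite key; ring.
  rewrite !normcM normc_real (ger0_norm (chi0 z)) /m.
  have [zs|zs] := leP (normc (z - b) ^+ 2) s; last first.
    by rewrite /chi cutoff0 ?(ltW zs)// !mulr0.
  rewrite [leRHS](_ : _ = (e * normc (z - b)) * (normc (z - b) * chi z)); last by ring.
  apply: ler_wpM2r; first by rewrite mulr_ge0// normc_ge0.
  apply: Hd; have : normc (z - b) ^+ 2 <= (d / 2) ^+ 2.
    by apply: le_trans zs _; rewrite ge_min lexx orbT.
  by rewrite ler_sqr ?nnegrE ?normc_ge0// ?divr_ge0 ?(ltW d0)//; lra.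
have : `|A s - complex.Re D * (s ^+ 2 * M1)| <= e * (s ^+ 2 * M1).
  rewrite -XE; apply: le_trans (le_normr_Rintegral mD iX) _.
  rewrite -(Mom s)// -(RintegralZl _ mD im); apply: le_Rintegral => //.
  by apply: (integrable_abse iX).
rewrite -(Ascale s)// => h; have s2 : 0 < s ^+ 2 by rewrite exprn_gt0.
have -> : A s / s ^+ 2 - complex.Re D * M1 = (A s - complex.Re D * (s ^+ 2 * M1)) / s ^+ 2.
  by field; rewrite gt_eqF.
rewrite normrM normfV (gtr0_norm s2) ler_pdivrMr//.
by apply: le_trans h _; rewrite le_eqVlt; apply/orP; left; apply/eqP; ring.
Qed.

End harmonic_functions.

(** * Lower bounds for Hankel operators modulo compact ones *)

Section pairing.
Variable R : realType.
Local Notation C := R[i].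
Local Notation C2 := (R[i] * R[i])%type.
Local Notation V := (@volume R).
Local Notation D2 := (@bidisk R).
Implicit Types f g e : C2 -> C.
Local Open Scope quotient_scope.

(** The real part suffices: a phase built into the tests makes the real part of the main term equal
    to its modulus. *)
Definition rpair f e : R := \int[V]_(p in D2) complex.Re (f p * e p).

Definition sqnorm f : R := fine (sq_integral f).

Lemma sqnorm_ge0 f : 0 <= sqnorm f.
Proof. by apply/fine_ge0/sq_integral_ge0. Qed.

Lemma measurable_ReM f g :
  measurable_fun D2 (fun p => complex.Re (f p)) -> measurable_fun D2 (fun p => complex.Im (f p)) ->
  measurable_fun D2 (fun p => complex.Re (g p)) -> measurable_fun D2 (fun p => complex.Im (g p)) ->
  measurable_fun D2 (fun p => complex.Re (f p * g p)).
Proof.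
move=> fr fi gr gi; rewrite (_ : (fun p => _) = fun p =>
  complex.Re (f p) * complex.Re (g p) - complex.Im (f p) * complex.Im (g p)).
  by apply: measurable_funB; exact: measurable_funM.
by apply/funext => p; case: (f p); case: (g p).
Qed.

Lemma integrable_sqnorm f : f \in @square_integrable R ->
  V.-integrable D2 (fun p => (normc (f p) ^+ 2)%:E).
Proof.
move=> /asboolP[fr fi foo]; apply/integrableP; split.
  by apply/measurable_EFinP; exact: measurable_normc2.
under eq_integral => p _ do rewrite gee0_abs ?lee_fin ?sqr_ge0//.
exact: foo.
Qed.

Lemma normRe_young (t : R) (z w : C) : 0 < t ->
  `|complex.Re (z * w)| <= (t * normc z ^+ 2 + t^-1 * normc w ^+ 2) / 2.
Proof.
move=> t0; apply: le_trans (normRe_le _) _; rewrite normcM.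
have tn : t != 0 by rewrite gt_eqF.
rewrite -subr_ge0 [leRHS](_ : _ = t^-1 * (t * normc z - normc w) ^+ 2 / 2); last by field.
by rewrite divr_ge0// mulr_ge0 ?sqr_ge0// invr_ge0 ltW.
Qed.

Lemma integrable_rpair f e : f \in @square_integrable R -> e \in @square_integrable R ->
  V.-integrable D2 (EFin \o (fun p => complex.Re (f p * e p))).
Proof.
move=> sf se; have mD := @measurable_bidisk R.
have if1 := integrable_sqnorm sf; have ie1 := integrable_sqnorm se.
have /asboolP[fr fi _] := sf; have /asboolP[er ei _] := se.
apply: (le_integrable mD _ _ (integrableD mD if1 ie1)).
  by apply/measurable_EFinP; exact: measurable_ReM.
move=> p _; rewrite /= lee_fin; apply: le_trans (normRe_young _ _ ltr01) _.
rewrite invr1 !mul1r [leRHS]ger0_norm ?addr_ge0 ?sqr_ge0//.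
by have := sqr_ge0 (normc (f p)); have := sqr_ge0 (normc (e p)); lra.
Qed.

Lemma rpairB f g e : f \in @square_integrable R -> g \in @square_integrable R ->
  e \in @square_integrable R -> rpair (f - g) e = rpair f e - rpair g e.
Proof.
move=> sf sg se; rewrite -(RintegralB (@measurable_bidisk R) (integrable_rpair sf se) (integrable_rpair sg se)).
apply: eq_Rintegral => p _; rewrite -[(f - g) p]/(f p - g p).
by rewrite mulrBl raddfB.
Qed.

(** Optimizing Young's inequality over t turns it into the Cauchy-Schwarz bound. *)
Lemma young_CS (r a b : R) : 0 <= a -> 0 <= b ->
  (forall t, 0 < t -> r <= (t * a + t^-1 * b) / 2) -> r <= Num.sqrt a * Num.sqrt b.
Proof.
move=> a0 b0 H; set u := Num.sqrt a; set v := Num.sqrt b.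
have u0 : 0 <= u by exact: sqrtr_ge0.
have v0 : 0 <= v by exact: sqrtr_ge0.
have au : a = u ^+ 2 by rewrite sqr_sqrtr.
have bv : b = v ^+ 2 by rewrite sqr_sqrtr.
have Hh h : 0 < h -> r <= (u + h) * (v + h).
  move=> h0; have uh : 0 < u + h by lra.
  have vh : 0 < v + h by lra.
  (* The optimal t is v / u; both terms are shifted by h because either may vanish. *)
  apply: le_trans (H ((v + h) / (u + h)) _) _; first by rewrite divr_gt0.
  have i1 : (v + h) / (u + h) * a <= (v + h) * (u + h).
    by rewrite mulrAC ler_pdivrMr// -mulrA ler_pM2l// au -expr2 ler_sqr ?nnegrE; lra.
  have i2 : ((v + h) / (u + h))^-1 * b <= (v + h) * (u + h).
    rewrite invf_div mulrAC ler_pdivrMr// mulrAC mulrC ler_pM2r// bv -expr2 ler_sqr ?nnegrE; lra.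
  lra.
apply/ler_addgt0Pr => e e0; pose h := Num.min 1 (e / (u + v + 1)).
have uv : 0 < u + v + 1 by lra.
have h0 : 0 < h by rewrite lt_min ltr01 divr_gt0.
have h1 : h <= 1 by rewrite ge_min lexx.
have he : h * (u + v + 1) <= e by rewrite -ler_pdivlMr// ge_min lexx orbT.
by apply: le_trans (Hh h h0) _; nra.
Qed.

Lemma rpair_CS f e : f \in @square_integrable R -> e \in @square_integrable R ->
  `|rpair f e| <= Num.sqrt (sqnorm f) * Num.sqrt (sqnorm e).
Proof.
move=> sf se; have mD := @measurable_bidisk R.
have if1 := integrable_sqnorm sf; have ie1 := integrable_sqnorm se.
apply: young_CS; [exact: sqnorm_ge0|exact: sqnorm_ge0|] => t t0.
apply: le_trans (le_normr_Rintegral mD (integrable_rpair sf se)) _.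
have itf : V.-integrable D2 (EFin \o (fun p => (t / 2) * normc (f p) ^+ 2)) by exact: (integrableZl mD (t / 2) if1).
have ite : V.-integrable D2 (EFin \o (fun p => (t^-1 / 2) * normc (e p) ^+ 2)) by exact: (integrableZl mD (t^-1 / 2) ie1).
apply: (@le_trans _ _ (\int[V]_(p in D2) ((t / 2) * normc (f p) ^+ 2 + (t^-1 / 2) * normc (e p) ^+ 2))).
  apply: le_Rintegral => //.
  - exact: (integrable_abse (integrable_rpair sf se)).
  - exact: (integrableD mD itf ite).
  - move=> p _; apply: le_trans (normRe_young _ _ t0) _.
    by rewrite le_eqVlt; apply/orP; left; apply/eqP; field; rewrite gt_eqF.
rewrite (RintegralD mD itf ite) (RintegralZl _ mD if1) (RintegralZl _ mD ie1).
have -> : \int[V]_(p in D2) normc (f p) ^+ 2 = sqnorm f by [].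
have -> : \int[V]_(p in D2) normc (e p) ^+ 2 = sqnorm e by [].
by rewrite le_eqVlt; apply/orP; left; apply/eqP; field; rewrite gt_eqF.
Qed.

Lemma eq_rpair f g e : f \in @square_integrable R -> g \in @square_integrable R ->
  e \in @square_integrable R -> f = g %[ae V in D2] -> rpair f e = rpair g e.
Proof.
move=> sf sg se fg; congr fine; apply: ae_eq_integral.
- exact: measurable_bidisk.
- exact: measurable_int (integrable_rpair sf se).
- exact: measurable_int (integrable_rpair sg se).
- by apply: filterS fg => p fgp Dp; rewrite fgp.
Qed.

Definition L2pair (x : L2 R) e : R := rpair (repr x) e.

Lemma L2pair_pi (f : L2fun R) e : e \in @square_integrable R ->
  L2pair (\pi_(L2 R) f) e = rpair f e.
Proof.
move=> se; apply: eq_rpair => //; [exact: L2fun_valP|exact: L2fun_valP|].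
exact: L2reprP.
Qed.

Lemma L2pairB (x y : L2 R) e : e \in @square_integrable R ->
  L2pair (x - y) e = L2pair x e - L2pair y e.
Proof.
move=> se; elim/quotW: x => f; elim/quotW: y => g.
have -> : \pi_(L2 R) f - \pi_(L2 R) g = \pi_(L2 R) (f - g).
  by rewrite (L2_piD f (- g)) -(L2oppE g).
by rewrite !L2pair_pi// -rpairB//; exact: L2fun_valP.
Qed.

Lemma L2pair_CS (x : L2 R) e : e \in @square_integrable R ->
  `|L2pair x e| <= L2norm x * Num.sqrt (sqnorm e).
Proof. by move=> se; apply: rpair_CS => //; exact: L2fun_valP. Qed.

Lemma op_norm_ge (T : A2 R -> L2 R) (f : A2 R) : `|f| <= 1 ->
  ((L2norm (T f))%:E <= op_norm T)%E.
Proof.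
move=> f1; apply: ereal_sup_ubound; exists f => //.
Qed.

(** The images have a cluster point in the compact closure. Coming close to it for arbitrarily large
    j replaces the extraction of a subsequence. *)
Lemma compact_cluster_seq (K : A2 R -> L2 R) (f_ : nat -> A2 R) :
  compact_operator K -> (forall j, `|f_ j| <= 1) ->
  exists y : L2 R, forall (e : R) (j0 : nat), 0 < e ->
    exists2 j, (j0 <= j)%N & L2norm (K (f_ j) - y) < e.
Proof.
move=> [_ cK] f1.
have [|y [_ cly]] := cK ((K \o f_) @ \oo) _.
  exists 0%N => // j _; apply: subset_closure; exists (f_ j) => //; exact: f1.
exists y => e j0 e0.
have [||x [[j /= jj0 <-] yx]] := cly ([set K (f_ j) | j in [set j | (j0 <= j)%N]]) (ball y e%:C).
- by exists j0 => // j /= jj0; exists j.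
- by apply: nbhsx_ballx; rewrite -[0]/(0%:C) ltcR.
exists j => //; move: yx; rewrite -ball_normE/= distrC.
by rewrite -[`|_|]/((L2norm (K (f_ j) - y))%:C) ltcR.
Qed.

(** Weak nullity is asked of the [e_] alone: K f_j comes close to a fixed y for arbitrarily large j,
    and the pairing of y with e_j tends to 0. *)
Lemma op_norm_hankel_ge (phi : C2 -> C) (K : A2 R -> L2 R) (M N : R)
    (f_ : nat -> A2 R) (e_ : nat -> C2 -> C) :
  compact_operator K -> 0 < N -> (forall j, `|f_ j| <= 1) ->
  (forall j, e_ j \in @square_integrable R) -> (forall j, Num.sqrt (sqnorm (e_ j)) <= N) ->
  (forall j (h : A2 R), L2pair h (e_ j) = 0) ->
  (forall x : L2 R, L2pair x (e_ j) @[j --> \oo] --> 0) ->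
  (\forall j \near \oo, M <= L2pair (to_L2 (fun p => phi p * repr (A2_val (f_ j)) p)) (e_ j)) ->
  ((M / N)%:E <= op_norm (hankel phi \- K)%R)%E.
Proof.
move=> cK N0 f1 se eN orth wnull [j0 _ HM].
have [y Hy] := compact_cluster_seq cK f1.
apply/lee_addgt0Pr => d d0.
(* Solves e N + e = d N: the distance to y costs e N in the pairing, and y itself costs e. *)
pose e := d * N / (N + 1).
have N1 : 0 < N + 1 by lra.
have e0 : 0 < e by rewrite divr_gt0// mulr_gt0.
have [j1 _ Hj1] : \forall j \near \oo, `|L2pair y (e_ j)| < e.
  have := wnull y => /cvgrPdist_lt/(_ e e0); apply: filterS => j; by rewrite sub0r normrN.
have [j jj jy] := Hy e (maxn j0 j1) e0.
have /HM {HM} hM : (j0 <= j)%N by rewrite (leq_trans _ jj)// leq_maxl.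
have /Hj1 {Hj1} /= hy : (j1 <= j)%N by rewrite (leq_trans _ jj)// leq_maxr.
pose g := to_L2 (fun p => phi p * repr (A2_val (f_ j)) p).
have T1 : L2pair (hankel phi (f_ j)) (e_ j) = L2pair g (e_ j).
  by rewrite /hankel L2pairB// orth subr0.
have T2 : L2pair (hankel phi (f_ j)) (e_ j) =
    L2pair ((hankel phi \- K) (f_ j)) (e_ j) + L2pair (K (f_ j) - y) (e_ j) + L2pair y (e_ j).
  by rewrite [(_ \- _) _]/(hankel phi (f_ j) - K (f_ j)) !L2pairB//; ring.
have b1 := L2pair_CS ((hankel phi \- K) (f_ j)) (se j).
have b2 := L2pair_CS (K (f_ j) - y) (se j).
set T := (hankel phi \- K) in T2 b1 *.
have n0 x : 0 <= @L2norm R x by exact: sqrtr_ge0.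
have c1 : L2pair (T (f_ j)) (e_ j) <= L2norm (T (f_ j)) * N.
  apply: le_trans (ler_norm _) _; apply: le_trans b1 _.
  by rewrite ler_wpM2l.
have c2 : L2pair (K (f_ j) - y) (e_ j) <= e * N.
  apply: le_trans (ler_norm _) _; apply: le_trans b2 _.
  by apply: ler_pM => //; exact: ltW.
have c3 : L2pair y (e_ j) <= e by apply: le_trans (ler_norm _) (ltW hy).
have : M <= L2norm (T (f_ j)) * N + e * N + e.
  by apply: le_trans hM _; rewrite -/g -T1 T2 !lerD.
have eE : e * N + e = d * N by rewrite /e; field; rewrite gt_eqF.
rewrite -addrA eE -mulrDl -ler_pdivrMr// => h.
apply: (@le_trans _ _ (L2norm (T (f_ j)) + d)%:E); first by rewrite lee_fin.
by rewrite EFinD leeD2r// op_norm_ge.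
Qed.

End pairing.

(** * Topology and integration on the bidisk *)

Section bidisk_topology.
Variable R : realType.
Local Notation C := R[i].
Local Notation C2 := (R[i] * R[i])%type.
Local Notation V := (@volume R).
Local Notation D2 := (@bidisk R).

Lemma nbhs_complexP (z : C) (U : set C) : nbhs z U <->
  exists2 d : R, 0 < d & forall w, normc (w - z) < d -> U w.
Proof.
split=> [/nbhs_ballP[d d0 Hd]|[d d0 Hd]].
  rewrite /= in d0; have d1 : d = (complex.Re d)%:C by rewrite RRe_real// gtr0_real.
  exists (complex.Re d) => [|w wz]; first by rewrite -ltcR -d1.
  by apply: Hd; rewrite -ball_normE/= complex_normrE d1 ltcR normcB_sym.
apply/nbhs_ballP; exists d%:C => /=; first by rewrite -[0]/(0%:C) ltcR.
by move=> w; rewrite -ball_normE/= complex_normrE ltcR normcB_sym; exact: Hd.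
Qed.

Lemma nbhs_complex2P (p : C2) (U : set C2) : nbhs p U <->
  exists2 d : R, 0 < d & forall q, normc (q.1 - p.1) < d -> normc (q.2 - p.2) < d -> U q.
Proof.
split=> [[[A B]/= [/nbhs_complexP[d1 d10 H1] /nbhs_complexP[d2 d20 H2]] AB]|[d d0 Hd]].
  exists (Num.min d1 d2); first by rewrite lt_min d10.
  move=> q; rewrite !lt_min => /andP[q1 _] /andP[_ q2]; apply: AB; split; [exact: H1|exact: H2].
exists ([set z | normc (z - p.1) < d], [set z | normc (z - p.2) < d]) => /=.
  by split; apply/nbhs_complexP; exists d.
by move=> q [/= q1 q2]; exact: Hd.
Qed.

Lemma bidiskE (p : C2) : D2 p <-> normc p.1 < 1 /\ normc p.2 < 1.
Proof. by rewrite /bidisk /setX/= !diskE. Qed.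

Lemma closure_bidisk (p : C2) : closure D2 p <-> normc p.1 <= 1 /\ normc p.2 <= 1.
Proof.
split=> [cp|[p1 p2]].
  have H (e : R) : 0 < e -> normc p.1 < 1 + e /\ normc p.2 < 1 + e.
    move=> e0; have [|q [/bidiskE[q1 q2] [h1 h2]]] := cp [set q | normc (q.1 - p.1) < e /\ normc (q.2 - p.2) < e].
      by apply/nbhs_complex2P; exists e.
    have := normcB_tri p.1 q.1 0; have := normcB_tri p.2 q.2 0; rewrite !subr0.
    by rewrite (normcB_sym p.1) (normcB_sym p.2); split; lra.
  split; apply/ler_addgt0Pr => e /H[]; lra.
move=> U /nbhs_complex2P[d d0 Hd].
(* Points of the closed bidisk are moved into the open one by a dilation of ratio t < 1, which
   displaces them by at most d / 2. *)
pose t := 1 - Num.min (1 / 2) (d / 2).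
have [m0 m1] : 0 < Num.min (1 / 2) (d / 2) /\ Num.min (1 / 2) (d / 2) <= 1 / 2.
  by split; [rewrite lt_min; apply/andP; split; lra|rewrite ge_min lexx].
have md : Num.min (1 / 2) (d / 2) <= d / 2 by rewrite ge_min lexx orbT.
have t0 : 0 <= t by rewrite /t; lra.
have close (z : C) : normc z <= 1 -> normc (t%:C * z) < 1 /\ normc (t%:C * z - z) < d.
  move=> z1; rewrite normcM normc_real ger0_norm//; split.
    by have := normc_ge0 z; rewrite /t; nra.
  have -> : t%:C * z - z = (t - 1)%:C * z by rewrite (rmorphB _ t 1) rmorph1 mulrBl mul1r.
  rewrite normcM normc_real ler0_norm; last by rewrite /t; lra.
  by have := normc_ge0 z; rewrite /t; nra.
exists (t%:C * p.1, t%:C * p.2); split.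
  by apply/bidiskE => /=; split; [case: (close _ p1)|case: (close _ p2)].
by apply: Hd => /=; [case: (close _ p1)|case: (close _ p2)].
Qed.

Lemma bidisk_closed (p : C2) : D2 p -> closure D2 p.
Proof. exact: subset_closure. Qed.

Lemma pair_complex_continuous : continuous (@pair_complex R).
Proof.
move=> p U /nbhs_complexP[d d0 Hd].
exists (ball p.1 (d / 2), ball p.2 (d / 2)) => /=.
  by split; apply: nbhsx_ballx; rewrite divr_gt0.
move=> q [/=]; rewrite /ball/= => q1 q2; apply: Hd.
apply: le_lt_trans (normc_le_ReIm _) _ => /=.
by rewrite distrC [`|_ - p.2|]distrC; lra.
Qed.

Lemma compact_disk : compact [set z : C | normc z <= 1].
Proof.
have cQ : compact (`[-1, 1] `*` `[-1, 1] : set (R * R)).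
  by apply: compact_setX; exact: segment_compact.
have cI := continuous_compact (continuous_subspaceT pair_complex_continuous) cQ.
apply: (subclosed_compact _ cI).
  rewrite -openC openE => z /=; rewrite /interior => /negP; rewrite -ltNge => z1.
  apply/nbhs_complexP; exists (normc z - 1); first by rewrite subr_gt0.
  move=> w wz; apply/negP; rewrite -ltNge.
  by have := normcB_tri z w 0; rewrite !subr0 normcB_sym; lra.
move=> z z1; exists (complex_pair z); last exact: complex_pairK.
have h1 := le_trans (normRe_le z) z1; have h2 := le_trans (normIm_le z) z1.
by split; rewrite /= in_itv/= -ler_norml.
Qed.

Lemma compact_ball (b : C) (r : R) : (forall z, normc (z - b) ^+ 2 <= r -> normc z < 1) ->
  compact [set z : C | normc (z - b) ^+ 2 <= r].
Proof.
move=> rD; apply: subclosed_compact compact_disk _; last by move=> z /rD/ltW.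
rewrite -openC openE => z /=; rewrite /interior => /negP; rewrite -ltNge => z1.
have := rdiff_ccontinuous (rdiff_sqr_normc b z).
move=> /(_ (normc (z - b) ^+ 2 - r)); rewrite subr_gt0 => /(_ z1)[d d0 Hd].
apply/nbhs_complexP; exists d => // w /Hd; rewrite -rmorphB normc_real => h.
by apply/negP; rewrite -ltNge; move: h; rewrite ltr_norml => /andP[]; lra.
Qed.

Variable phi : C2 -> C.
Hypothesis cphi : {within closure D2, continuous phi}.

Lemma within_closure_eps (p : C2) (e : R) : closure D2 p -> 0 < e ->
  exists2 d : R, 0 < d & forall q, closure D2 q ->
    normc (q.1 - p.1) < d -> normc (q.2 - p.2) < d -> normc (phi q - phi p) < e.
Proof.
move=> cp e0; have /subspace_continuousP/(_ p cp) h := cphi.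
have : nbhs p (fun q => closure D2 q -> normc (phi q - phi p) < e).
  by apply: (h [set z | normc (z - phi p) < e]); apply/nbhs_complexP; exists e.
by move=> /nbhs_complex2P[d d0 Hd]; exists d => // q cq q1 q2; exact: Hd.
Qed.

Lemma closure_bounded : exists B : R, forall p, D2 p -> normc (phi p) <= B.
Proof.
have cD : compact (closure D2).
  have -> : closure D2 = [set z : C | normc z <= 1] `*` [set z : C | normc z <= 1].
    by apply/seteqP; split => p; rewrite /setX/= closure_bidisk.
  by apply: compact_setX; exact: compact_disk.
have := (compact_near_coveringP (closure D2)).1 cD R (+oo)%R
  (fun B p => closure D2 p -> normc (phi p) <= B).
case=> [p cp|B [_ HB]].
  have [d d0 Hd] := within_closure_eps cp ltr01.
  exists ([set q | normc (q.1 - p.1) < d /\ normc (q.2 - p.2) < d], [set B | normc (phi p) + 1 < B]) => /=.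
    split; first by apply/nbhs_complex2P; exists d.
    by exists (normc (phi p) + 1); split; first exact: num_real.
  move=> [q B] /= [[q1 q2] hB] cq; have := Hd q cq q1 q2.
  by have := normcB_tri (phi q) (phi p) 0; rewrite !subr0; lra.
exists (B + 1) => p /bidisk_closed cp; apply: (HB (B + 1)) => //; lra.
Qed.

Lemma measurable_phi : measurable_fun D2 (fun p => complex.Re (phi p)) /\
  measurable_fun D2 (fun p => complex.Im (phi p)).
Proof.
have mB := measurable_basisX (@measurable_basisC R) (@measurable_basisC R).
split; apply: (measurable_basis_fun mB (@measurable_bidisk R)) => p Dp e e0;
  have [d d0 Hd] := within_closure_eps (bidisk_closed Dp) e0; exists d => // q Dq;
  rewrite gt_max => /andP[q1 q2]; apply: le_lt_trans (Hd q (bidisk_closed Dq) q1 q2).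
  by rewrite -raddfB; exact: normRe_le.
by rewrite -raddfB; exact: normIm_le.
Qed.

(* [sw] selects which of the two coordinates carries the analytic disk. *)
Definition mkpt (sw : bool) (z w : C) : C2 := if sw then (w, z) else (z, w).

(** Continuity at the boundary points over [om] gives a radius for each z; compactness of the disk
    |z - b| ^ 2 <= r gives a common one. *)
Lemma phi_uniform (sw : bool) (om b : C) (r e : R) : normc om = 1 -> 0 < e ->
  (forall z, normc (z - b) ^+ 2 <= r -> normc z < 1) ->
  exists2 d : R, 0 < d & forall z w, normc (z - b) ^+ 2 <= r -> normc w < 1 ->
    normc (w - om) < d -> normc (phi (mkpt sw z w) - phi (mkpt sw z om)) < e.
Proof.
move=> om1 e0 rD; have om1' : normc om <= 1 by rewrite om1.
have cl z w : normc z <= 1 -> normc w <= 1 -> closure D2 (mkpt sw z w).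
  by move=> z1 w1; apply/closure_bidisk; rewrite /mkpt; case: sw.
have := (compact_near_coveringP _).1 (compact_ball rD) R (0^'+)%R
  (fun d z => normc (z - b) ^+ 2 <= r -> forall w, normc w < 1 -> normc (w - om) < d ->
    normc (phi (mkpt sw z w) - phi (mkpt sw z om)) < e).
move=> H; have {H}H := H _ _; have {}H : \forall d \near (0 : R)^'+, [set z : C | normc (z - b) ^+ 2 <= r] `<=`
    (fun z => normc (z - b) ^+ 2 <= r -> forall w, normc w < 1 -> normc (w - om) < d ->
    normc (phi (mkpt sw z w) - phi (mkpt sw z om)) < e).
  apply: H => z /= zr.
  have e2 : 0 < e / 2 by rewrite divr_gt0.
  have z1 := ltW (rD z zr).
  have [d d0 Hd] := within_closure_eps (cl z om z1 om1') e2.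
  have close z' w : normc (z' - z) < d -> normc (w - om) < d -> normc z' <= 1 -> normc w <= 1 ->
      normc (phi (mkpt sw z' w) - phi (mkpt sw z om)) < e / 2.
    by move=> h1 h2 h3 h4; apply: Hd; [exact: cl| |]; rewrite /mkpt; case: (sw).
  exists ([set z' | normc (z' - z) < d], [set d' | d' < d]) => /=.
    split; first by apply/nbhs_complexP; exists d.
    exact: nbhs_right_lt.
  move=> [z' d'] /= [hz hd] zr' w w1 wd.
  have h1 := close z' w hz (lt_trans wd hd) (ltW (rD _ zr')) (ltW w1).
  have h2 := close z' om hz _ (ltW (rD _ zr')) om1'.
  have := normcB_tri (phi (mkpt sw z' w)) (phi (mkpt sw z om)) (phi (mkpt sw z' om)).
  rewrite (normcB_sym (phi (mkpt sw z om))); have := h2 _; rewrite subrr normc0 => /(_ d0); lra.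
have [d [Hd d0]] := filter_ex (filterI H (nbhs_right_gt 0)).
exists d => // z w zr w1 wd; exact: (Hd z zr zr w w1 wd).
Qed.

End bidisk_topology.

(** * Iterated integrals on the bidisk *)

Section bidisk_fubini.
Variable R : realType.
Local Notation C := R[i].
Local Notation C2 := (R[i] * R[i])%type.
Local Notation V := (@volume R).
Local Notation D1 := (@disk R).
Local Notation D2 := (@bidisk R).
Local Notation cl := (@complex_lebesgue R).
Variable sw : bool.

Definition zpart (p : C2) := if sw then p.2 else p.1.
Definition wpart (p : C2) := if sw then p.1 else p.2.

Lemma mkptK p : mkpt sw (zpart p) (wpart p) = p.
Proof. by case: p => x y; rewrite /mkpt /zpart /wpart; case: sw. Qed.

Lemma zpart_mkpt z w : zpart (mkpt sw z w) = z.
Proof. by rewrite /mkpt /zpart; case: sw. Qed.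

Lemma wpart_mkpt z w : wpart (mkpt sw z w) = w.
Proof. by rewrite /mkpt /wpart; case: sw. Qed.

Lemma bidisk_mkpt z w : D2 (mkpt sw z w) <-> D1 z /\ D1 w.
Proof. by rewrite /mkpt; case: sw; split=> -[]. Qed.

Lemma measurable_zpart : measurable_fun setT zpart.
Proof. by rewrite /zpart; case: sw; [exact: measurable_snd|exact: measurable_fst]. Qed.

Lemma measurable_wpart : measurable_fun setT wpart.
Proof. by rewrite /wpart; case: sw; [exact: measurable_fst|exact: measurable_snd]. Qed.

Lemma measurable_fun_zpart (u : C -> R) : measurable_fun D1 u -> measurable_fun D2 (u \o zpart).
Proof.
move=> mu; apply: (measurable_comp (@measurable_disk R)) mu _.
  by move=> _ [p [p1 p2] <-]; rewrite /zpart; case: sw.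
by apply: measurable_funS measurable_zpart.
Qed.

Lemma measurable_fun_wpart (u : C -> R) : measurable_fun D1 u -> measurable_fun D2 (u \o wpart).
Proof.
move=> mu; apply: (measurable_comp (@measurable_disk R)) mu _.
  by move=> _ [p [p1 p2] <-]; rewrite /wpart; case: sw.
by apply: measurable_funS measurable_wpart.
Qed.

Let slice_restrict (h : C2 -> \bar R) w :
  (\int[cl]_z (h \_ D2) (mkpt sw z w) = ((fun w => \int[cl]_(z in D1) h (mkpt sw z w)) \_ D1) w)%E.
Proof.
rewrite [in RHS]patchE; case: ifPn => wD.
  rewrite [RHS]integral_mkcond; apply: eq_integral => z _; rewrite !patchE.
  have -> : (mkpt sw z w \in D2) = (z \in D1); last by [].
  apply/idP/idP; rewrite !inE => h'; first by have [] := (bidisk_mkpt z w).1 h'.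
  by apply/bidisk_mkpt; split => //; rewrite inE in wD.
apply: integral0_eq => z _; rewrite patchE ifF//; apply: contraNF wD.
by rewrite !inE => /bidisk_mkpt[].
Qed.

(** The variable z of the analytic disk is always the inner one, whichever coordinate it is, so that
    identities on slices apply. *)
Lemma bidisk_fubini (h : C2 -> \bar R) : V.-integrable D2 h ->
  (\int[V]_(p in D2) h p = \int[cl]_(w in D1) \int[cl]_(z in D1) h (mkpt sw z w))%E.
Proof.
move=> ih; rewrite integral_mkcond.
have ih' : (cl \x cl)%E.-integrable setT (h \_ D2).
  exact: (integrable_mkcond _ (@measurable_bidisk R)).1 ih.
rewrite [RHS]integral_mkcond.
transitivity (\int[cl]_w \int[cl]_z (h \_ D2) (mkpt sw z w))%E; last first.
  by apply: eq_integral => w _; rewrite slice_restrict.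
rewrite /mkpt; case: sw.
  exact: (esym (integral12_prod_meas1 ih')).
exact: (esym (integral21_prod_meas1 ih')).
Qed.

Lemma bidisk_tonelli (h : C2 -> \bar R) : measurable_fun D2 h -> (forall p, 0 <= h p)%E ->
  (\int[V]_(p in D2) h p = \int[cl]_(w in D1) \int[cl]_(z in D1) h (mkpt sw z w))%E.
Proof.
move=> mh h0; rewrite integral_mkcond.
have mh' : measurable_fun setT (h \_ D2).
  exact: (measurable_restrictT _ (@measurable_bidisk R)).1 mh.
have h0' p : (0 <= (h \_ D2) p)%E by rewrite patchE; case: ifP.
rewrite [RHS]integral_mkcond.
transitivity (\int[cl]_w \int[cl]_z (h \_ D2) (mkpt sw z w))%E; last first.
  by apply: eq_integral => w _; rewrite slice_restrict.
rewrite /mkpt; case: sw.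
  exact: (fubini_tonelli1 _ mh' h0').
exact: (fubini_tonelli2 _ mh' h0').
Qed.

Lemma ge0_integral_prod (u v : C -> R) : measurable_fun D1 u -> measurable_fun D1 v ->
  (forall z, 0 <= u z) -> (forall w, 0 <= v w) ->
  (\int[V]_(p in D2) (u (zpart p) * v (wpart p))%:E =
   (\int[cl]_(z in D1) (u z)%:E) * (\int[cl]_(w in D1) (v w)%:E))%E.
Proof.
move=> mu mv u0 v0; have mD := @measurable_disk R.
rewrite bidisk_tonelli; last 2 first.
- apply/measurable_EFinP; apply: measurable_funM.
    exact: measurable_fun_zpart.
  exact: measurable_fun_wpart.
- by move=> p; rewrite lee_fin mulr_ge0.
transitivity (\int[cl]_(w in D1) ((\int[cl]_(z in D1) (u z)%:E) * (v w)%:E))%E.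
  apply: eq_integral => w _.
  rewrite -ge0_integralZr ?lee_fin//; first last.
  - by move=> z _; rewrite lee_fin.
  - exact/measurable_EFinP.
  - by apply: eq_integral => z _; rewrite zpart_mkpt wpart_mkpt EFinM.
rewrite ge0_integralZl//.
- exact/measurable_EFinP.
- by move=> w _; rewrite lee_fin.
- by apply: integral_ge0 => z _; rewrite lee_fin.
Qed.

Lemma integrable_prod (u v : C -> R) : cl.-integrable D1 (EFin \o u) -> cl.-integrable D1 (EFin \o v) ->
  V.-integrable D2 (fun p => (u (zpart p) * v (wpart p))%:E).
Proof.
move=> iu iv; have mu : measurable_fun D1 u by apply/measurable_EFinP; exact: measurable_int iu.
have mv : measurable_fun D1 v by apply/measurable_EFinP; exact: measurable_int iv.
apply/integrableP; split.
  apply/measurable_EFinP; apply: measurable_funM.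
    exact: measurable_fun_zpart.
  exact: measurable_fun_wpart.
rewrite (eq_integral (fun p => (`|u (zpart p)| * `|v (wpart p)|)%:E)); last first.
  by move=> p _; rewrite /= normrM.
rewrite (@ge0_integral_prod (fun z => `|u z|) (fun w => `|v w|))//; last 2 first.
- exact: measurableT_comp.
- exact: measurableT_comp.
have /integrableP[_ uoo] := iu; have /integrableP[_ voo] := iv.
by apply: lte_mul_pinfty => //; [apply: integral_ge0 => z _; rewrite lee_fin|rewrite ge0_fin_numE//; apply: integral_ge0 => z _; rewrite lee_fin].
Qed.

Lemma Rintegral_prod (u v : C -> R) : cl.-integrable D1 (EFin \o u) -> cl.-integrable D1 (EFin \o v) ->
  \int[V]_(p in D2) (u (zpart p) * v (wpart p)) =
  (\int[cl]_(z in D1) u z) * (\int[cl]_(w in D1) v w).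
Proof.
move=> iu iv; have mD := @measurable_disk R.
rewrite {1}/Rintegral bidisk_fubini; last exact: integrable_prod.
rewrite -(RintegralZl _ mD iv) /Rintegral; congr fine; apply: eq_integral => w _.
transitivity (\int[cl]_(z in D1) ((u z)%:E * (v w)%:E))%E.
  by apply: eq_integral => z _; rewrite zpart_mkpt wpart_mkpt EFinM.
by rewrite integralZr// EFinM fineK//; exact: integrable_fin_num.
Qed.

Lemma bidisk_slice_zero (h : C2 -> R) : V.-integrable D2 (EFin \o h) ->
  (forall w, D1 w -> (\int[cl]_(z in D1) (h (mkpt sw z w))%:E = 0)%E) ->
  \int[V]_(p in D2) h p = 0.
Proof.
move=> ih h0; rewrite /Rintegral bidisk_fubini//.
by rewrite integral0_eq// => w wD; exact: h0.
Qed.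

End bidisk_fubini.

(** * Test functions *)

Section peak_functions.
Variable R : realType.
Local Notation C := R[i].
Local Notation D1 := (@disk R).
Local Notation cl := (@complex_lebesgue R).
Local Notation mu := (@lebesgue_measure R).
Local Notation m2 := (mu \x mu)%E.
Variable om : C.
Hypothesis om1 : normc om = 1.

Definition peak (w : C) : R := normc ((w + om) / 2) ^+ 2.

Lemma peakE w : peak w = normc (w + om) ^+ 2 / 4.
Proof.
rewrite /peak normcM normcV (_ : 2 = (2 : R)%:C); last by rewrite rmorph_nat.
by rewrite normc_real ger0_norm// exprMn exprVn -natrX.
Qed.

Lemma peak_ge0 w : 0 <= peak w.
Proof. exact: sqr_ge0. Qed.

(** Parallelogram law for w and [om]; on the unit disk it bounds [peak] by 1 - |w - om| ^ 2 / 4. *)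
Lemma peak_parallelogram w : 4 * peak w + normc (w - om) ^+ 2 = 2 * normc w ^+ 2 + 2.
Proof.
have -> : 4 * peak w = normc (w + om) ^+ 2 by rewrite peakE; field.
have : normc om ^+ 2 = 1 by rewrite om1 expr1n.
rewrite !sqr_normcE; case: w om => a b [c d] /= h; nra.
Qed.

Lemma ccontinuous_peakX m z : ccontinuous (fun w => (peak w ^+ m)%:C) z.
Proof.
have cp : ccontinuous (fun w => (peak w)%:C) z.
  have -> : (fun w => (peak w)%:C) = (fun w => (normc (w - (- om)) ^+ 2)%:C * (4^-1 : R)%:C).
    by apply/funext => w; rewrite peakE opprK rmorphM.
  apply: ccontinuousM; last exact: ccontinuous_cst.
  exact: rdiff_ccontinuous (rdiff_sqr_normc (- om) z).
elim: m => [|m IH].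
  by under eq_fun do rewrite expr0; exact: ccontinuous_cst.
by under eq_fun do rewrite exprS rmorphM; exact: ccontinuousM.
Qed.

Lemma integrable_peakX m : cl.-integrable D1 (EFin \o (fun w => peak w ^+ m)).
Proof. exact: (@integrable_disk R (fun w => (peak w ^+ m)%:C) (ccontinuous_peakX m)). Qed.

Definition cap (d : R) : set C := [set w | normc (w - om) < d].

Lemma measurable_cap d : measurable (cap d).
Proof.
pose f (w : C) : R := normc (w - om) ^+ 2.
have mf : measurable_fun setT f.
  apply: (ccontinuous_measurable (f := fun w => (f w)%:C)) => // z _.
  exact: rdiff_ccontinuous (rdiff_sqr_normc om z).
have [d0|d0] := leP d 0.
  rewrite (_ : cap d = set0)//; apply/seteqP; split => // w; rewrite /cap/= => wd.
  by have := normc_ge0 (w - om); lra.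
have -> : cap d = f @^-1` `]-oo, (d ^+ 2)[%classic.
  by apply/seteqP; split=> w; rewrite /cap /f/= in_itv/= ltr_sqr ?nnegrE ?normc_ge0// ltW.
by rewrite -[X in measurable X]setTI; exact: mf.
Qed.

Lemma integrable_indicM (A : set C) (u : C -> R) : measurable A ->
  cl.-integrable D1 (EFin \o u) -> cl.-integrable D1 (EFin \o (fun w => u w * \1_A w)).
Proof.
move=> mA iu; have mD := @measurable_disk R.
have mu_ : measurable_fun D1 u by apply/measurable_EFinP; exact: measurable_int iu.
apply: (le_integrable mD _ _ iu).
  by apply/measurable_EFinP; apply: measurable_funM => //; exact: measurable_indic.
move=> w _; rewrite lee_fin normrM ler_piMr// indicE.
by case: (_ \in _); rewrite ?normr1 ?normr0.
Qed.

Lemma integrable_disk_cst (k : R) : cl.-integrable D1 (EFin \o (fun=> k)).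
Proof. exact: (@integrable_disk R (fun=> k%:C) (ccontinuous_cst _)). Qed.

(** The bound is the contribution of a small square near [om] on which [peak] is at least 1 - d ^ 2
    / 8; [s] is the area of that square, the same for all m. *)
Lemma peak_mass (d : R) : 0 < d -> d <= 1 -> exists2 s : R, 0 < s &
  forall m, (1 - d ^+ 2 / 8) ^+ m * s <= \int[cl]_(w in D1) peak w ^+ m.
Proof.
move=> d0 d1; pose d' := d ^+ 2 / 8.
have d'0 : 0 < d' by rewrite divr_gt0// exprn_gt0.
have d'1 : d' <= 1 / 8 by rewrite /d'; nra.
(* The centre lies at depth d' / 2 on the radius through [om]; a square of side d' / 4 around it
   stays in the disk and within d' of [om]. *)
pose w0 := (1 - d' / 2)%:C * om; pose l := d' / 4.
have l0 : 0 < l by rewrite divr_gt0.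
pose S : set C := @complex_pair R @^-1` rect (complex.Re w0 - l / 2) (complex.Im w0 - l / 2) l.
have mS : measurable S.
  by rewrite -[X in measurable X]setTI; exact: measurable_complex_pair (measurable_rect _ _ _).
have clS : cl S = (l ^+ 2)%:E.
  by rewrite -(rect_measure (complex.Re w0 - l / 2) (complex.Im w0 - l / 2) l0).
have SE w : S w -> normc (w - w0) <= l.
  move=> [/=]; rewrite !in_itv/= => /andP[a1 a2] /andP[b1 b2].
  apply: le_trans (normc_le_ReIm _) _.
  have -> : complex.Re (w - w0) = complex.Re w - complex.Re w0 by rewrite raddfB.
  have -> : complex.Im (w - w0) = complex.Im w - complex.Im w0 by rewrite raddfB.
  have : `|complex.Re w - complex.Re w0| <= l / 2 by rewrite ler_norml; apply/andP; split; lra.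
  have : `|complex.Im w - complex.Im w0| <= l / 2 by rewrite ler_norml; apply/andP; split; lra.
  lra.
have w0n : normc w0 = 1 - d' / 2.
  by rewrite normcM om1 mulr1 normc_real ger0_norm//; lra.
have w0om : normc (w0 - om) = d' / 2.
  rewrite (_ : w0 - om = (- (d' / 2))%:C * om); last first.
    by rewrite /w0 rmorphB rmorphN rmorph1; ring.
  by rewrite normcM om1 mulr1 normc_real normrN ger0_norm//; lra.
have SD : S `<=` D1.
  move=> w /SE h; rewrite diskE; have := normcB_tri w w0 0; rewrite !subr0 w0n /l in h *; lra.
have mD := @measurable_disk R.
have Speak w : S w -> 1 - d' <= peak w.
  move=> Sw; have h := SE w Sw; rewrite peakE.
  have h1 : normc (w - om) <= d'.
    by apply: le_trans (normcB_tri w w0 om) _; rewrite w0om; rewrite /l in h; lra.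
  have h2 : 2 - d' <= normc (w + om).
    have : normc (2 * om) <= normc (w + om) + normc (om - w).
      by have := le_normcD (w + om) (om - w); rewrite (_ : w + om + (om - w) = 2 * om)//; ring.
    have n2 : normc (2 : C) = 2.
      rewrite -[2 in LHS](rmorph_nat (real_complex R)) normc_real ger0_norm//.
    rewrite normcM om1 mulr1 n2.
    by rewrite normcB_sym; lra.
  nra.
exists (l ^+ 2) => [|m]; first by rewrite exprn_gt0.
have -> : (1 - d ^+ 2 / 8) ^+ m * l ^+ 2 = \int[cl]_(w in D1) ((1 - d') ^+ m * \1_S w).
  rewrite RintegralZl//; last first.
    have := integrable_indicM mS (integrable_disk_cst 1).
    by under eq_fun do rewrite mul1r.
  have hI : (\int[cl]_(w in D1) (\1_S w)%:E = cl (S `&` D1))%E by exact: integral_indic.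
  by congr (_ * _); rewrite /Rintegral hI (setIidl SD) clS.
apply: le_Rintegral => //.
- have := integrable_indicM mS (integrable_disk_cst ((1 - d') ^+ m)); exact.
- exact: integrable_peakX.
move=> w _; rewrite indicE; case: (boolP (w \in S)) => [|_]; last first.
  by rewrite mulr0 exprn_ge0// peak_ge0.
rewrite inE mulr1 => /Speak h; apply: lerXn2r => //; rewrite nnegrE ?peak_ge0//.
lra.
Qed.

(** Off the cap [peak] is at most r1 = 1 - d ^ 2 / 4, while the total mass is at least s r2 ^ m with
    r2 = 1 - d ^ 2 / 8; the ratio of the two decays like (r1 / r2) ^ m. *)
Lemma peak_concentration (d eta : R) : 0 < d -> d <= 1 -> 0 < eta -> exists m,
  0 < \int[cl]_(w in D1) peak w ^+ m /\
  (1 - eta) * \int[cl]_(w in D1) peak w ^+ m <= \int[cl]_(w in D1) (peak w ^+ m * \1_(cap d) w).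
Proof.
move=> d0 d1 eta0; have [s s0 Hs] := peak_mass d0 d1.
have mD := @measurable_disk R.
pose r1 := 1 - d ^+ 2 / 4; pose r2 := 1 - d ^+ 2 / 8.
have dd : 0 < d ^+ 2 <= 1 by rewrite exprn_gt0//= exprn_ile1// ltW.
have /andP[dd0 dd1] := dd.
have r10 : 0 < r1 by rewrite /r1; lra.
have r12 : r1 < r2 by rewrite /r1 /r2; lra.
have r20 : 0 < r2 by exact: lt_trans r12.
pose area := moment R 0.
have area0 : 0 <= area by apply: Rintegral_ge0 => z _; rewrite expr0.
pose k := eta * s / (area + 1).
have k0 : 0 < k by rewrite divr_gt0 ?mulr_gt0//; lra.
have [m Hm] : exists m, (r1 / r2) ^+ m < k.
  have [m _ Hm] : \forall m \near \oo, (r1 / r2) ^+ m < k.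
    have : (fun m => (r1 / r2) ^+ m) @ \oo --> (0 : R).
      apply: cvg_expr; rewrite ger0_norm ?divr_ge0 ?ltW//.
      by rewrite ltr_pdivrMr// mul1r.
    move=> /cvgrPdist_lt/(_ k k0); apply: filterS => m.
    by rewrite sub0r normrN ger0_norm// exprn_ge0// divr_ge0// ltW.
  by exists m; apply: Hm => /=.
exists m.
have P0 : 0 < \int[cl]_(w in D1) peak w ^+ m.
  by apply: lt_le_trans (Hs m); rewrite mulr_gt0// exprn_gt0.
split => //.
have icap := integrable_indicM (measurable_cap d) (integrable_peakX m).
have iB := integrableB mD (integrable_peakX m) icap.
have off : \int[cl]_(w in D1) (peak w ^+ m - peak w ^+ m * \1_(cap d) w) <= r1 ^+ m * area.
  have -> : r1 ^+ m * area = \int[cl]_(w in D1) (r1 ^+ m).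
    rewrite /area /moment -(RintegralZl _ mD (integrable_moment R 0)).
    by apply: eq_Rintegral => z _; rewrite expr0 mulr1.
  apply: le_Rintegral => //; first exact: integrable_disk_cst.
  move=> w; rewrite diskE => w1; rewrite indicE; case: (boolP (w \in cap d)) => [_|].
    by rewrite mulr1 subrr exprn_ge0// ltW.
  rewrite notin_setE /cap/= => /negP; rewrite -leNgt => wd; rewrite mulr0 subr0.
  apply: lerXn2r; rewrite ?nnegrE ?peak_ge0 ?(ltW r10)//.
  have := peak_parallelogram w; have : d ^+ 2 <= normc (w - om) ^+ 2.
    by rewrite ler_sqr ?nnegrE ?normc_ge0// ltW.
  have : normc w ^+ 2 <= 1 by rewrite exprn_ile1 ?normc_ge0// ltW.
  by rewrite /r1; lra.
rewrite (RintegralB mD (integrable_peakX m) icap) in off.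
have : r1 ^+ m * area <= eta * \int[cl]_(w in D1) peak w ^+ m.
  have r2m : 0 < r2 ^+ m by rewrite exprn_gt0.
  have h1 : r1 ^+ m < k * r2 ^+ m by move: Hm; rewrite expr_div_n ltr_pdivrMr.
  apply: le_trans (_ : eta * (r2 ^+ m * s) <= _); last by rewrite ler_pM2l//; exact: Hs.
  apply: le_trans (_ : (k * r2 ^+ m) * area <= _); first by rewrite ler_wpM2r// ltW.
  rewrite /k [leLHS](_ : _ = eta * (r2 ^+ m * s) * (area / (area + 1))); last first.
    by field; rewrite gt_eqF//; lra.
  rewrite ler_piMr ?mulr_ge0 ?(ltW eta0) ?(ltW r2m) ?(ltW s0)//.
  by rewrite ler_pdivrMr ?mul1r//; lra.
lra.
Qed.

End peak_functions.

(** * Measurability of complex-valued functions *)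

Section complex_measurability.
Variables (R : realType) (d : measure_display) (T : measurableType d) (D : set T).
Local Notation C := R[i].

Definition cmeasurable (f : T -> C) :=
  measurable_fun D (fun p => complex.Re (f p)) /\ measurable_fun D (fun p => complex.Im (f p)).

Lemma cmeasurableM f g : cmeasurable f -> cmeasurable g -> cmeasurable (fun p => f p * g p).
Proof.
move=> [fr fi] [gr gi]; split.
  rewrite (_ : (fun p => _) = fun p =>
    complex.Re (f p) * complex.Re (g p) - complex.Im (f p) * complex.Im (g p)).
    by apply: measurable_funB; exact: measurable_funM.
  by apply/funext => p; case: (f p); case: (g p).
rewrite (_ : (fun p => _) = fun p =>
  complex.Re (f p) * complex.Im (g p) + complex.Im (f p) * complex.Re (g p)).
  by apply: measurable_funD; exact: measurable_funM.
by apply/funext => p; case: (f p); case: (g p).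
Qed.

Lemma cmeasurable_conj f : cmeasurable f -> cmeasurable (fun p => conjc (f p)).
Proof.
move=> [fr fi]; split.
  by rewrite (_ : (fun p => _) = fun p => complex.Re (f p))//; apply/funext => p; case: (f p).
rewrite (_ : (fun p => _) = fun p => - complex.Im (f p)); first exact: measurableT_comp.
by apply/funext => p; case: (f p).
Qed.

Lemma cmeasurable_real (f : T -> R) : measurable_fun D f -> cmeasurable (fun p => (f p)%:C).
Proof. by move=> mf; split => //=; exact: measurable_cst. Qed.

End complex_measurability.

Section cmeasurable_bidisk.
Variable R : realType.
Local Notation C := R[i].
Local Notation C2 := (R[i] * R[i])%type.
Local Notation V := (@volume R).
Local Notation D1 := (@disk R).
Local Notation D2 := (@bidisk R).

Lemma cmeasurable_ccontinuous (u : C -> C) : (forall z, ccontinuous u z) -> cmeasurable D1 u.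
Proof.
move=> cu; split; first by apply: ccontinuous_measurable => //; exact: measurable_disk.
have := @ccontinuous_measurable R D1 (fun z => - 'i%C * u z) (@measurable_disk R).
rewrite (_ : (fun z => complex.Re (- 'i%C * u z)) = fun z => complex.Im (u z)); last first.
  by apply/funext => z; case: (u z) => x y /=; ring.
by apply => z _; apply: ccontinuousM => //; exact: ccontinuous_cst.
Qed.

Lemma cmeasurable_zpart sw (u : C -> C) : cmeasurable D1 u -> cmeasurable D2 (u \o zpart sw).
Proof. by move=> [ur ui]; split; [exact: (measurable_fun_zpart sw ur)|exact: (measurable_fun_zpart sw ui)]. Qed.

Lemma cmeasurable_wpart sw (u : C -> C) : cmeasurable D1 u -> cmeasurable D2 (u \o wpart sw).
Proof. by move=> [ur ui]; split; [exact: (measurable_fun_wpart sw ur)|exact: (measurable_fun_wpart sw ui)]. Qed.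

Lemma square_integrable_le (f : C2 -> C) (h : C2 -> R) : cmeasurable D2 f ->
  V.-integrable D2 (EFin \o h) -> (forall p, D2 p -> normc (f p) ^+ 2 <= h p) ->
  f \in @square_integrable R.
Proof.
move=> [fr fi] ih fh; apply/asboolP; split => //.
have /integrableP[_] := ih; apply: le_lt_trans; apply: ge0_le_integral => //.
- exact: measurable_bidisk.
- by move=> p _; rewrite lee_fin sqr_ge0.
- by apply/measurable_EFinP; exact: measurable_normc2.
- by apply: measurableT_comp => //; exact: measurable_int ih.
- by move=> p /fh h1; rewrite lee_fin; apply: le_trans h1 (ler_norm _).
Qed.

Lemma square_integrable_cmeasurable (f : C2 -> C) : f \in @square_integrable R -> cmeasurable D2 f.
Proof. by move=> /asboolP[fr fi _]. Qed.

(** Square integrability excludes the default value of [to_L2]. *)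
Lemma to_L2_val (f : C2 -> C) : f \in @square_integrable R ->
  exists2 F : L2fun R, to_L2 f = \pi_(L2 R)%qT F & F = f :> (C2 -> C).
Proof.
by move=> sf; exists (insubd (0 : L2fun R) f) => //; rewrite insubdK.
Qed.

End cmeasurable_bidisk.

(** * The two families of tests and the bound on one disk *)

Section test_functions.
Variable R : realType.
Local Notation C := R[i].
Local Notation C2 := (R[i] * R[i])%type.
Local Notation V := (@volume R).
Local Notation D1 := (@disk R).
Local Notation D2 := (@bidisk R).
Local Notation cl := (@complex_lebesgue R).

Variables (phi : C2 -> C) (sw : bool) (om b : C) (r : R) (n : nat).
Hypothesis cphi : {within closure D2, continuous phi}.
Hypothesis om1 : normc om = 1.
Hypothesis r0 : 0 < r.
Hypothesis rD : forall z, normc (z - b) ^+ 2 <= r -> normc z < 1.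

Let g z := phi (mkpt sw z om).
Hypothesis harm_g : harmonic_on D1 g.

Let area := moment R 0.
Let chi z := cutoff n r (normc (z - b) ^+ 2).
Let mass := \int[cl]_(z in D1) (normc (z - b) ^+ 2 * chi z).

Let mD := @measurable_disk R.

Lemma area_gt0 : 0 < area.
Proof.
have [s s0 Hs] := peak_mass om1 ltr01 (lexx 1).
have := Hs 0%N; rewrite expr0 mul1r => h; apply: lt_le_trans s0 _.
apply: le_trans h _; rewrite le_eqVlt; apply/orP; left; apply/eqP.
by apply: eq_Rintegral => z _; rewrite !expr0.
Qed.

(** The square root of [mass / area]. It bounds the norms of the [teste], while the pairings tend to
    at least [dg * radius ^+ 2]; the quotient is the bound sought. *)
Let radius := r * Num.sqrt (2^-1 - n.+3%:R^-1).

Let n3 : 0 < 2^-1 - n.+3%:R^-1 :> R.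
Proof. by rewrite subr_gt0 ltf_pV2 ?posrE// ltr_nat. Qed.

Lemma radius_gt0 : 0 < radius.
Proof. by rewrite mulr_gt0// sqrtr_gt0. Qed.

Lemma massE : mass = radius ^+ 2 * area.
Proof.
rewrite /mass /chi cutoff_moment// /radius exprMn sqr_sqrtr ?(ltW n3)// /area.
by ring.
Qed.

Lemma exists_phase (z : C) : exists2 c, normc c = 1 & complex.Re (c * z) = normc z.
Proof.
have [->|z0] := eqVneq z 0; first by exists 1; rewrite ?normc1// mulr0 normc0.
have nz : normc z != 0 by rewrite gt_eqF// normc_gt0.
exists (conjc z * ((normc z)^-1)%:C).
  by rewrite normcM normc_conj normc_real ger0_norm ?invr_ge0 ?normc_ge0// mulfV.
rewrite mulrAC [conjc z * z]mulrC -sqr_normcJ -rmorphM /=.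
by rewrite expr2 -mulrA mulfV// mulr1.
Qed.

Let dg := normc (dbar g b).

Let Q m := \int[cl]_(w in D1) peak om w ^+ m.

Section fixed_phase.
Variable c : C.
Hypothesis c1 : normc c = 1.
Hypothesis cdg : complex.Re (c * dbar g b) = dg.

Let A z := c * ((z - b) * (chi z)%:C).

Let cA z : ccontinuous A z.
Proof.
apply: ccontinuousM; first exact: ccontinuous_cst.
apply: ccontinuousM; last exact: ccontinuous_cutoff.
by apply: ccontinuousD; [exact: ccontinuous_id|exact: ccontinuous_cst].
Qed.

Let chi01 z : 0 <= chi z <= 1.
Proof. by rewrite /chi cutoff_ge0 ?cutoff_le1 ?sqr_ge0. Qed.

(** Replacing chi ^ 2 by chi brings the norm of the test back to the integral [mass] that also
    governs the pairing; the loss disappears as n grows. *)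
Lemma sqr_normA z : normc (A z) ^+ 2 <= normc (z - b) ^+ 2 * chi z.
Proof.
have /andP[h0 h1] := chi01 z.
rewrite /A !normcM c1 mul1r normc_real ger0_norm// exprMn ler_wpM2l ?sqr_ge0//.
by rewrite expr2 ler_piMl.
Qed.

Lemma integral_gA : \int[cl]_(z in D1) complex.Re (g z * A z) = dg * mass.
Proof.
rewrite -cdg -(cutoff_dbar n c r0 rD harm_g); apply: eq_Rintegral => z _.
by congr complex.Re; rewrite /A; ring.
Qed.

(** On a slice, the w-dependent part of the test is a constant [k], which joins F as a holomorphic
    factor. *)
Lemma test_orthogonal (F : C2 -> C) (w k : C) : holomorphic_on_bidisk F -> D1 w ->
  (\int[cl]_(z in D1) (complex.Re (F (mkpt sw z w) * (A z * k)))%:E = 0)%E.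
Proof.
move=> hF wD; pose G z := (c * k) * F (mkpt sw z w).
have dF z : D1 z -> derivable (fun z => F (mkpt sw z w)) z 1.
  move=> zD; have dp : differentiable F (mkpt sw z w) by apply: hF; apply/bidisk_mkpt.
  have := @diff_derivable _ _ _ F (mkpt sw z w) (mkpt sw 1 0) dp.
  rewrite /derivable (_ : (fun h => h^-1 *: (F (h *: mkpt sw 1 0 + mkpt sw z w) - F (mkpt sw z w))) =
    (fun h => h^-1 *: (F (mkpt sw (h *: 1 + z) w) - F (mkpt sw z w))))//.
  apply/funext => h; congr (_ *: (F _ - _)); rewrite /mkpt.
  by case: (sw); congr pair; rewrite /= scaler0 add0r.
have rF := disk_derivable_rdiff dF.
have rG z : normc z < 1 -> rdiff G z ((c * k) * derive1 (fun z => F (mkpt sw z w)) z)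
   ('i%C * ((c * k) * derive1 (fun z => F (mkpt sw z w)) z)).
  by move=> z1; apply: rdiff_eq (rdiffZ (c * k) (rF z z1)) _ _ => //; ring.
have := cutoff_holomorphic n r0 rD rG.
have cG z : normc z < 1 -> ccontinuous G z by move=> /rG/rdiff_ccontinuous.
have := integrable_disk (ccontinuous_cutoff_mul n r0 rD cG) => /(integrable_fin_num mD) fn.
have E : (\int[cl]_(z in D1) (complex.Re (F (mkpt sw z w) * (A z * k)))%:E =
   \int[cl]_(z in D1) (complex.Re (G z * ((z - b) * (cutoff n r (normc (z - b) ^+ 2))%:C)))%:E)%E.
  by apply: eq_integral => z _; congr (complex.Re _)%:E; rewrite /G /A /chi; ring.
by rewrite E -(fineK fn) => h; congr EFin.
Qed.

Section peak_power.
Variables (m : nat) (d eta : R).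
Hypothesis Q0 : 0 < Q m.
Hypothesis hcap : (1 - eta) * Q m <= \int[cl]_(w in D1) (peak om w ^+ m * \1_(cap om d) w).

(** Normalized for the bidisk and not for the disk: [area] is the contribution of the variable on
    which [testf] does not depend. *)
Definition kern (w : C) : C := ((Num.sqrt (area * Q m))^-1)%:C * ((w + om) / 2) ^+ m.

Let I (w : C) : R := \1_(cap om d) w.

Definition kern2 (w : C) : R := normc (kern w) ^+ 2 * I w.

Let aQ0 : 0 < area * Q m.
Proof. by rewrite mulr_gt0// area_gt0. Qed.

Lemma sqr_kern w : normc (kern w) ^+ 2 = (area * Q m)^-1 * peak om w ^+ m.
Proof.
rewrite /kern normcM normc_real exprMn normcX ger0_norm ?invr_ge0 ?sqrtr_ge0//.
by rewrite exprVn sqr_sqrtr ?(ltW aQ0)// /peak -!exprM mulnC.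
Qed.

Lemma kern_ccontinuous w : ccontinuous kern w.
Proof.
apply: ccontinuousM; first exact: ccontinuous_cst.
elim: m => [|k IH]; first by under eq_fun do rewrite expr0; exact: ccontinuous_cst.
under eq_fun do rewrite exprS; apply: ccontinuousM => //.
apply: ccontinuousM; last exact: ccontinuous_cst.
by apply: ccontinuousD; [exact: ccontinuous_id|exact: ccontinuous_cst].
Qed.

Definition testf (p : C2) : C := kern (wpart sw p).

Lemma testf_holomorphic : holomorphic_on_bidisk testf.
Proof.
move=> p _; have dw : differentiable (wpart sw : C2 -> C) p.
  rewrite /wpart; case: (sw).
    by apply: (@linear_differentiable _ _ _ fst) => q; exact: cvg_fst.
  by apply: (@linear_differentiable _ _ _ snd) => q; exact: cvg_snd.
have du : differentiable (fun q : C2 => (wpart sw q + om) * 2^-1 : C) p.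
  apply: (@differentiableM _ _ (fun q : C2 => wpart sw q + om : C) (fun=> 2^-1)).
    by apply: (@differentiableD _ _ _ (wpart sw : C2 -> C) (fun=> om)) => //; exact: differentiable_cst.
  exact: differentiable_cst.
have dX k : differentiable (fun q : C2 => ((wpart sw q + om) * 2^-1) ^+ k : C) p.
  elim: k => [|k IH]; first by under eq_fun do rewrite expr0; exact: differentiable_cst.
  under eq_fun do rewrite exprS.
  exact: (@differentiableM _ _ (fun q : C2 => (wpart sw q + om) * 2^-1 : C) _ _ du IH).
apply: (@differentiableM _ _ (fun=> ((Num.sqrt (area * Q m))^-1)%:C : C) _ _ _ (dX m)).
exact: differentiable_cst.
Qed.

Let mkern : cmeasurable D1 kern := cmeasurable_ccontinuous kern_ccontinuous.

Lemma integrable_sqr_kern : cl.-integrable D1 (EFin \o (fun w => normc (kern w) ^+ 2)).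
Proof.
have := integrableZl mD (area * Q m)^-1 (integrable_peakX om m).
by apply: eq_integrable => // w _ /=; rewrite sqr_kern EFinM.
Qed.

Lemma integrable_kern2 : cl.-integrable D1 (EFin \o kern2).
Proof. exact: (integrable_indicM (measurable_cap om d) integrable_sqr_kern). Qed.

Lemma integral_sqr_kern : \int[cl]_(w in D1) normc (kern w) ^+ 2 = area^-1.
Proof.
have -> : \int[cl]_(w in D1) normc (kern w) ^+ 2 =
    \int[cl]_(w in D1) ((area * Q m)^-1 * peak om w ^+ m).
  by apply: eq_Rintegral => w _; rewrite sqr_kern.
rewrite (RintegralZl _ mD (integrable_peakX om m)) -/(Q m) invfM -mulrA mulVf ?mulr1// gt_eqF//.
Qed.

Lemma integral_kern2_ge : (1 - eta) / area <= \int[cl]_(w in D1) kern2 w.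
Proof.
have -> : \int[cl]_(w in D1) kern2 w = (area * Q m)^-1 * \int[cl]_(w in D1) (peak om w ^+ m * I w).
  rewrite -(RintegralZl _ mD (integrable_indicM (measurable_cap om d) (integrable_peakX om m))).
  by apply: eq_Rintegral => w _; rewrite /kern2 sqr_kern mulrA.
rewrite ler_pdivlMl// (le_trans _ hcap)// le_eqVlt; apply/orP; left; apply/eqP.
by field; rewrite gt_eqF// area_gt0.
Qed.

Lemma integral_kern2_le : \int[cl]_(w in D1) kern2 w <= area^-1.
Proof.
rewrite -integral_sqr_kern; apply: le_Rintegral => //; [exact: integrable_kern2|exact: integrable_sqr_kern|].
move=> w _; rewrite /kern2 ler_piMr ?sqr_ge0// /I indicE; case: (_ \in _) => //.
Qed.

Lemma testf_square_integrable : testf \in @square_integrable R.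
Proof.
apply: (@square_integrable_le _ _ (fun p => 1 * normc (kern (wpart sw p)) ^+ 2)).
- exact: cmeasurable_wpart.
- exact: (integrable_prod sw (integrable_disk_cst 1) integrable_sqr_kern).
- by move=> p _; rewrite mul1r.
Qed.

Lemma sqnorm_testf : sqnorm testf = 1.
Proof.
have -> : sqnorm testf = \int[V]_(p in D2) (1 * normc (kern (wpart sw p)) ^+ 2).
  by apply: eq_Rintegral => p _; rewrite mul1r.
rewrite (Rintegral_prod sw (integrable_disk_cst 1) integrable_sqr_kern) integral_sqr_kern.
have -> : \int[cl]_(z in D1) 1 = area by apply: eq_Rintegral => z _; rewrite expr0.
by rewrite mulfV// gt_eqF// area_gt0.
Qed.

Definition teste (p : C2) : C := A (zpart sw p) * (conjc (kern (wpart sw p)) * (I (wpart sw p))%:C).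

Let iM : cl.-integrable D1 (EFin \o (fun z => normc (z - b) ^+ 2 * chi z)).
Proof.
apply: (@integrable_disk R (fun z => (normc (z - b) ^+ 2 * chi z)%:C)) => z.
under eq_fun do rewrite rmorphM; apply: ccontinuousM; last exact: ccontinuous_cutoff.
exact: rdiff_ccontinuous (rdiff_sqr_normc b z).
Qed.

Let sqI w : I w ^+ 2 = I w.
Proof. by rewrite /I indicE; case: (_ \in _); rewrite ?expr1n ?expr0n. Qed.

Let I01 w : 0 <= I w <= 1.
Proof. by rewrite /I indicE; case: (_ \in _); rewrite /= ?lexx ler01. Qed.

Lemma sqr_teste p : normc (teste p) ^+ 2 <=
  (normc (zpart sw p - b) ^+ 2 * chi (zpart sw p)) * kern2 (wpart sw p).
Proof.
have /andP[I0 _] := I01 (wpart sw p).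
rewrite /teste (normcM (A _)) (normcM (conjc _)) normc_conj [normc (I _)%:C]normc_real.
rewrite (ger0_norm I0) !exprMn sqI.
by rewrite ler_wpM2r ?sqr_normA// mulr_ge0// sqr_ge0.
Qed.

Lemma teste_square_integrable : teste \in @square_integrable R.
Proof.
apply: (square_integrable_le _ (integrable_prod sw iM integrable_kern2)).
  apply: cmeasurableM; first by apply: cmeasurable_zpart; exact: cmeasurable_ccontinuous.
  apply: (@cmeasurable_wpart _ sw (fun w => conjc (kern w) * (I w)%:C)); apply: cmeasurableM.
    exact: cmeasurable_conj.
  by apply: cmeasurable_real; apply: measurable_indic; exact: measurable_cap.
by move=> p _; exact: sqr_teste.
Qed.

Lemma sqnorm_teste_le : Num.sqrt (sqnorm teste) <= radius.
Proof.
rewrite -(ger0_norm (ltW radius_gt0)) -sqrtr_sqr ler_wsqrtr//.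
apply: (@le_trans _ _ (\int[V]_(p in D2) ((normc (zpart sw p - b) ^+ 2 * chi (zpart sw p)) * kern2 (wpart sw p)))).
  apply: le_Rintegral.
  - exact: measurable_bidisk.
  - exact: integrable_sqnorm teste_square_integrable.
  - exact: (integrable_prod sw iM integrable_kern2).
  - by move=> p _; exact: sqr_teste.
rewrite (Rintegral_prod sw iM integrable_kern2) -/mass massE -mulrA ler_piMr ?sqr_ge0//.
by rewrite mulrC -ler_pdivlMr ?area_gt0// mul1r; exact: integral_kern2_le.
Qed.

Lemma teste_orthogonal (h : A2 R) : L2pair h teste = 0.
Proof.
have /asboolP[F hF ->] := A2_valP h.
rewrite L2pair_pi; last exact: teste_square_integrable.
apply: (@bidisk_slice_zero R sw).
  exact: (integrable_rpair (L2fun_valP F) teste_square_integrable).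
move=> w wD; rewrite -(test_orthogonal (conjc (kern w) * (I w)%:C) hF wD).
by apply: eq_integral => z _; rewrite /teste zpart_mkpt wpart_mkpt.
Qed.

Let A1 := \int[cl]_(z in D1) normc (A z).

Let inA : cl.-integrable D1 (EFin \o (fun z => normc (A z))).
Proof.
apply: (@integrable_disk R (fun z => (normc (A z))%:C)) => z e /(cA z)[d' d'0 Hd].
exists d' => // w /Hd; apply: le_lt_trans; rewrite -rmorphB normc_real.
exact: le_dist_normc.
Qed.

Let igA : cl.-integrable D1 (EFin \o (fun z => complex.Re (g z * A z))).
Proof.
apply: (@integrable_disk R (fun z => g z * A z)) => z.
have cg z' : normc z' < 1 -> ccontinuous (fun z => c * g z) z'.
  move=> z1; apply: ccontinuousM; first exact: ccontinuous_cst.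
  have [g1 _ _ _] := harm_g; exact: rdiff_ccontinuous (disk_C1_rdiff g1 z1).
have -> : (fun z => g z * A z) = (fun z => c * g z * ((z - b) * (cutoff n r (normc (z - b) ^+ 2))%:C)).
  by apply/funext => z'; rewrite /A /chi; ring.
exact: ccontinuous_cutoff_mul.
Qed.

Let phi_mul_square_integrable (f : C2 -> C) : f \in @square_integrable R ->
  (fun p => phi p * f p) \in @square_integrable R.
Proof.
move=> sf; have [B HB] := closure_bounded cphi.
apply: (square_integrable_le (h := fun p => B ^+ 2 * normc (f p) ^+ 2)).
- apply: cmeasurableM; last exact: square_integrable_cmeasurable.
  exact: (measurable_phi cphi).
- exact: (integrableZl (@measurable_bidisk R) (B ^+ 2) (integrable_sqnorm sf)).
- move=> p /HB hB; rewrite normcM exprMn ler_wpM2r ?sqr_ge0//.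
  by apply: lerXn2r; rewrite ?nnegrE ?normc_ge0// (le_trans (normc_ge0 _) hB).
Qed.

(** On the support of the test, phi is replaced by its boundary value g at the price e |A z|. The
    integrand is then a product of functions of z and of w: the first integrates to dg mass - e A1,
    and the mass of [kern2] lies between (1 - eta) / area and 1 / area. *)
Lemma pairing_ge (fA : A2 R) (e : R) :
  A2_val fA = \pi_(L2 R)%qT (MkL2fun testf_square_integrable) -> 0 <= e ->
  (forall z w, normc (z - b) ^+ 2 <= r -> normc w < 1 -> normc (w - om) < d ->
     normc (phi (mkpt sw z w) - phi (mkpt sw z om)) <= e) ->
  dg * mass * (1 - eta) / area - e * A1 / area <=
  L2pair (to_L2 (fun p => phi p * repr (A2_val fA) p)) teste.
Proof.
move=> fE e0 He.
have sf := testf_square_integrable; have st := teste_square_integrable.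
have sr := L2fun_valP (repr (A2_val fA)).
have [F1 -> F1E] := to_L2_val (phi_mul_square_integrable sr).
rewrite L2pair_pi// F1E.
rewrite (eq_rpair (phi_mul_square_integrable sr) (phi_mul_square_integrable sf) st); last first.
  have := L2reprP (MkL2fun testf_square_integrable); rewrite -fE; apply: filterS => p hp Dp.
  by rewrite hp.
have iu : cl.-integrable D1 (EFin \o (fun z => complex.Re (g z * A z) - e * normc (A z))).
  exact: (integrableB mD igA (integrableZl mD e inA)).
apply: (@le_trans _ _ (\int[V]_(p in D2) ((complex.Re (g (zpart sw p) * A (zpart sw p)) -
    e * normc (A (zpart sw p))) * kern2 (wpart sw p)))).
  rewrite (Rintegral_prod sw iu integrable_kern2).
  rewrite (RintegralB mD igA (integrableZl mD e inA)) (RintegralZl _ mD inA) integral_gA -/A1.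
  have M0 : 0 <= dg * mass.
    by rewrite mulr_ge0 ?normc_ge0// massE mulr_ge0 ?sqr_ge0// ltW// area_gt0.
  have A10 : 0 <= e * A1 by rewrite mulr_ge0//; apply: Rintegral_ge0 => z _; exact: normc_ge0.
  have h1 := ler_wpM2l M0 integral_kern2_ge; have h2 := ler_wpM2l A10 integral_kern2_le.
  by rewrite [leRHS]mulrBl; rewrite mulrA in h1; lra.
apply: le_Rintegral.
- exact: measurable_bidisk.
- exact: (integrable_prod sw iu integrable_kern2).
- exact: (integrable_rpair (phi_mul_square_integrable sf) st).
move=> p /bidiskE Dp; set z := zpart sw p; set w := wpart sw p.
have pE : p = mkpt sw z w by rewrite mkptK.
have zw1 : normc z < 1 /\ normc w < 1.
  by rewrite /z /w /zpart /wpart; case: Dp; case: (sw).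
have -> : phi p * testf p * teste p = (phi p * A z) * (kern2 w)%:C.
  have -> : (kern2 w)%:C = kern w * conjc (kern w) * (I w)%:C by rewrite -sqr_normcJ -rmorphM.
  by rewrite /testf /teste -/z -/w; ring.
have ReM (a' : C) (x : R) : complex.Re (a' * x%:C) = complex.Re a' * x.
  by case: a' => u v /=; rewrite mulr0 subr0.
rewrite ReM; have [Iw|Iw] := boolP (w \in cap om d); last first.
  by rewrite /kern2 /I indicE (negbTE Iw) !mulr0.
have k20 : 0 <= kern2 w by have /andP[i0 _] := I01 w; rewrite mulr_ge0 ?sqr_ge0.
apply: ler_wpM2r => //.
(* The closeness of phi to g is available only for |z - b| ^ 2 <= r; beyond it A vanishes. *)
have [zr|zr] := leP (normc (z - b) ^+ 2) r; last first.
  have -> : A z = 0 by rewrite /A /chi cutoff0 ?(ltW zr)// !mulr0.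
  by rewrite !mulr0 normc0 mulr0 subr0.
have h := He z w zr zw1.2 _; rewrite inE /cap/= in Iw.
have := normRe_le ((phi p - g z) * A z); rewrite normcM.
have -> : complex.Re ((phi p - g z) * A z) = complex.Re (phi p * A z) - complex.Re (g z * A z).
  by rewrite mulrBl raddfB.
have : normc (phi p - g z) * normc (A z) <= e * normc (A z).
  by rewrite ler_wpM2r ?normc_ge0// {1}pE; exact: h.
by move=> h1 /ler_normlP[h2 _]; lra.
Qed.

End peak_power.

Section weak_limit.
Variables (m_ : nat -> nat) (eta_ : nat -> R).
Let d_ (j : nat) : R := j.+1%:R^-1.
Hypothesis Q0 : forall j, 0 < Q (m_ j).

(** The indicator of the cap is idempotent, so a copy of it can be moved onto x. The truncated x
    tends to 0 in norm by dominated convergence, each point of the open bidisk leaving the caps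
    eventually, while the norms of the tests stay below [radius]. *)
Lemma teste_weak_null (x : L2 R) : L2pair x (teste (m_ j) (d_ j)) @[j --> \oo] --> 0.
Proof.
pose f := repr x; have sf := L2fun_valP f.
pose I j w : R := \1_(cap om (d_ j)) w.
pose X j (p : C2) : C := f p * (I j (wpart sw p))%:C.
have I01 j w : 0 <= I j w <= 1 by rewrite /I indicE; case: (_ \in _); rewrite /= ?lexx ler01.
have sqI j w : I j w ^+ 2 = I j w by rewrite /I indicE; case: (_ \in _); rewrite ?expr1n ?expr0n.
have XE j p : normc (X j p) ^+ 2 = normc (f p) ^+ 2 * I j (wpart sw p).
  by have /andP[h _] := I01 j (wpart sw p); rewrite normcM normc_real (ger0_norm h) exprMn sqI.
have X_le j p : normc (X j p) ^+ 2 <= normc (f p) ^+ 2.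
  by have /andP[_ h] := I01 j (wpart sw p); rewrite XE ler_piMr// sqr_ge0.
have sX j : X j \in @square_integrable R.
  apply: (square_integrable_le _ (integrable_sqnorm sf)); last by move=> p _; exact: X_le.
  apply: cmeasurableM; first exact: square_integrable_cmeasurable.
  apply: (@cmeasurable_wpart _ sw (fun w => (I j w)%:C)); apply: cmeasurable_real.
  by apply: measurable_indic; exact: measurable_cap.
have X0 : sqnorm (X j) @[j --> \oo] --> 0.
  have cvX : {ae V, forall p, D2 p -> (normc (X j p) ^+ 2)%:E @[j --> \oo] --> 0%E}.
    apply: aeW => p /bidiskE Dp; have w1 : normc (wpart sw p) < 1.
      by rewrite /wpart; case: Dp; case: (sw).
    apply: cvg_near_cst; pose t := normc (wpart sw p - om).
    have t0 : 0 < t.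
      rewrite normc_gt0 subr_eq0; apply/eqP => E; move: w1; rewrite E om1 ltxx//.
    have : \forall j \near \oo, d_ j < t.
      have := @cvg_harmonic R => /cvgrPdist_lt/(_ t t0); apply: filterS => j.
      by rewrite sub0r normrN ger0_norm// /harmonic/= invr_ge0.
    apply: filterS => j dj; rewrite XE /I indicE memNset ?mulr0//.
    by rewrite /cap/= => h; have := lt_trans dj h; rewrite ltxx.
  have domX : {ae V, forall p j, D2 p -> (`|(normc (X j p) ^+ 2)%:E| <= (normc (f p) ^+ 2)%:E)%E}.
    by apply: aeW => p j _; rewrite lee_fin ger0_norm ?sqr_ge0.
  have [_ _ h] := dominated_convergence (@measurable_bidisk R)
    (fun j => measurable_int _ (integrable_sqnorm (sX j))) (measurable_cst _) cvX (integrable_sqnorm sf) domX.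
  have i0 : (\int[V]_(p in D2) (cst 0 p : \bar R) = 0%:E)%E by apply: integral0_eq.
  by move: h; rewrite i0 => /fine_cvg.
have bound j : `|L2pair x (teste (m_ j) (d_ j))| <= Num.sqrt (sqnorm (X j)) * radius.
  have st := teste_square_integrable (d_ j) (Q0 j).
  have -> : L2pair x (teste (m_ j) (d_ j)) = rpair (X j) (teste (m_ j) (d_ j)).
    apply: eq_Rintegral => p _; congr complex.Re; rewrite /X /teste -/(I j (wpart sw p)).
    rewrite -[in LHS]sqI expr2 rmorphM; ring.
  apply: le_trans (rpair_CS (sX j) st) _.
  by rewrite ler_wpM2l ?sqrtr_ge0//; exact: sqnorm_teste_le.
apply/cvgrPdist_lt => e e0.
have e1 : 0 < (e / radius) ^+ 2 by rewrite exprn_gt0// divr_gt0// radius_gt0.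
move: X0 => /cvgrPdist_lt/(_ _ e1); apply: filterS => j.
rewrite !sub0r !normrN (ger0_norm (sqnorm_ge0 _)) => h.
apply: le_lt_trans (bound j) _; rewrite -ltr_pdivlMr ?radius_gt0//.
rewrite -ltr_sqr ?nnegrE ?sqrtr_ge0 ?divr_ge0 ?(ltW e0) ?(ltW radius_gt0)//.
by rewrite sqr_sqrtr// sqnorm_ge0.
Qed.

Hypothesis eta0 : eta_ j @[j --> \oo] --> 0.
Hypothesis hcap : forall j, (1 - eta_ j) * Q (m_ j) <=
  \int[cl]_(w in D1) (peak om w ^+ m_ j * \1_(cap om (d_ j)) w).

Let fL j := \pi_(L2 R)%qT (MkL2fun (testf_square_integrable (Q0 j))).

Let fL_bergman j : fL j \in @bergman R.
Proof.
apply/asboolP; exists (MkL2fun (testf_square_integrable (Q0 j))); last by rewrite /fL.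
exact (@testf_holomorphic (m_ j)).
Qed.

Let fA j : A2 R := MkA2 (fL_bergman j).

Let fA_le1 j : `|fA j| <= 1.
Proof.
have -> : `|fA j| = (L2norm (fL j))%:C by [].
by rewrite /fL L2normE -/(sqnorm _) sqnorm_testf// sqrtr1.
Qed.

Lemma op_norm_hankel_phase (K : A2 R -> L2 R) : compact_operator K ->
  ((dg * radius)%:E <= op_norm (hankel phi \- K)%R)%E.
Proof.
move=> cK; apply/lee_addgt0Pr => eps eps0.
(* A loss t in the pairing becomes eps after division by [radius]. One half of it pays for replacing
   phi by g, the other for the mass outside the caps. *)
pose t := eps * radius; have t0 : 0 < t by rewrite mulr_gt0// radius_gt0.
pose B1 := \int[cl]_(z in D1) normc (A z).
have B10 : 0 <= B1 by apply: Rintegral_ge0 => z _; exact: normc_ge0.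
pose e := t * area / (2 * (B1 + 1)).
have B11 : 0 < B1 + 1 by lra.
have ar0 := area_gt0.
have e0 : 0 < e by apply: divr_gt0; [exact: mulr_gt0|apply: mulr_gt0].
have [dl dl0 Hdl] := phi_uniform cphi sw om1 e0 rD.
have near_d : \forall j \near \oo, d_ j < dl.
  have := @cvg_harmonic R => /cvgrPdist_lt/(_ dl dl0); apply: filterS => j.
  by rewrite sub0r normrN ger0_norm// /harmonic/= invr_ge0.
have dr0 : 0 <= dg * radius ^+ 2 by rewrite mulr_ge0 ?normc_ge0 ?sqr_ge0.
have near_eta : \forall j \near \oo, eta_ j * (dg * radius ^+ 2) <= t / 2.
  have k0 : 0 < t / 2 / (dg * radius ^+ 2 + 1) by rewrite !divr_gt0//; lra.
  move: eta0 => /cvgrPdist_lt/(_ _ k0); apply: filterS => j.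
  rewrite sub0r normrN => /(le_lt_trans (ler_norm _)) h.
  have dr1 : 0 < dg * radius ^+ 2 + 1 by lra.
  move: h; rewrite ltr_pdivlMr// => h; have [ej|ej] := leP 0 (eta_ j); first nra.
  by apply: (@le_trans _ _ 0); [rewrite nmulr_rle0|lra].
have eB : e * B1 / area <= t / 2.
  rewrite /e [leLHS](_ : _ = t / 2 * (B1 / (B1 + 1))); last by field; rewrite !gt_eqF.
  by rewrite ler_piMr ?divr_ge0 ?(ltW t0)// ler_pdivrMr// mul1r; lra.
have H := @op_norm_hankel_ge R phi K (dg * radius ^+ 2 - t) radius fA (fun j => teste (m_ j) (d_ j)) cK
  radius_gt0 fA_le1 (fun j => teste_square_integrable (d_ j) (Q0 j))
  (fun j => sqnorm_teste_le (d_ j) (Q0 j)) (fun j => teste_orthogonal (d_ j) (Q0 j)) teste_weak_null.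
have r1 := radius_gt0.
have -> : dg * radius = (dg * radius ^+ 2 - t) / radius + eps.
  by rewrite /t; field; rewrite gt_eqF.
rewrite EFinD leeD2r//; apply: H.
near=> j; have hd : d_ j < dl by near: j.
have he : eta_ j * (dg * radius ^+ 2) <= t / 2 by near: j.
have Hz z w : normc (z - b) ^+ 2 <= r -> normc w < 1 -> normc (w - om) < d_ j ->
    normc (phi (mkpt sw z w) - phi (mkpt sw z om)) <= e.
  by move=> zr w1 wd; apply/ltW/Hdl => //; exact: lt_trans wd hd.
apply: (le_trans _ (pairing_ge (hcap j) (Q0 := Q0 j) (fA := fA j) (erefl _) (ltW e0) Hz)).
rewrite massE -/B1.
rewrite [X in _ <= X - _](_ : _ = dg * radius ^+ 2 - eta_ j * (dg * radius ^+ 2)); last first.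
  by field; rewrite gt_eqF.
lra.
Unshelve. all: by end_near. Qed.

End weak_limit.

End fixed_phase.

Theorem op_norm_hankel_disk (K : A2 R -> L2 R) : compact_operator K ->
  ((normc (dbar g b) * (r * Num.sqrt (2^-1 - n.+3%:R^-1)))%:E <= op_norm (hankel phi \- K)%R)%E.
Proof.
have [c c1 cdg] := exists_phase (dbar g b).
(* The radius of the cap and the mass allowed outside it are both 1 / (j + 1); the exponent is
   whatever concentration then requires. *)
have hm j : exists m, 0 < Q m /\ (1 - j.+1%:R^-1) * Q m <=
    \int[cl]_(w in D1) (peak om w ^+ m * \1_(cap om j.+1%:R^-1) w).
  by apply: peak_concentration => //; rewrite ?invr_gt0// invf_le1// ler1n.
have [m_ Hm] := choice hm.
apply: (@op_norm_hankel_phase c c1 cdg m_ (fun j => j.+1%:R^-1)).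
- by move=> j; have [] := Hm j.
- exact: cvg_harmonic.
- by move=> j; have [] := Hm j.
Qed.

End test_functions.

(** * Disks in the boundary *)

Section boundary_disks.
Variable R : realType.
Local Notation C := R[i].
Local Notation C2 := (R[i] * R[i])%type.
Local Notation D1 := (@disk R).
Local Notation D2 := (@bidisk R).

Lemma boundary_bidisk (p : C2) : boundary D2 p ->
  [/\ normc p.1 <= 1, normc p.2 <= 1 & normc p.1 = 1 \/ normc p.2 = 1].
Proof.
move=> [/closure_bidisk[p1 p2] ip]; split => //.
have [q1|q1] := ltP (normc p.1) 1; last by left; apply/le_anti; rewrite p1.
have [q2|q2] := ltP (normc p.2) 1; last by right; apply/le_anti; rewrite p2.
case: ip; apply/nbhs_complex2P; exists (Num.min (1 - normc p.1) (1 - normc p.2)).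
  by rewrite lt_min !subr_gt0 q1.
move=> q; rewrite !lt_min => /andP[h1 _] /andP[_ h2]; apply/bidiskE.
have := normcB_tri q.1 p.1 0; have := normcB_tri q.2 p.2 0; rewrite !subr0; split; lra.
Qed.

(** Maximum principle for an affine map: the mean of |b + a / 2| ^ 2 and |b - a / 2| ^ 2 is 1 + |a|
    ^ 2 / 4, yet both are at most 1. *)
Lemma affine_disk_const (a b : C) : normc b = 1 ->
  (forall xi, normc xi < 1 -> normc (xi * a + b) <= 1) -> a = 0.
Proof.
move=> b1 H; apply: eq0_normc; apply/eqP; rewrite -sqrf_eq0 eq_le sqr_ge0 andbT.
have half (s : R) : `|s| <= 1 / 2 -> normc (s%:C * a + b) ^+ 2 <= 1.
  move=> hs; rewrite expr_le1 ?normc_ge0//; apply: H; rewrite normc_real; lra.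
have := half (1 / 2); have := half (- (1 / 2)); rewrite normrN ger0_norm; last by lra.
move=> /(_ (lexx _)) h1 /(_ (lexx _)) h2.
have := sqr_normcE b; rewrite b1 expr1n.
move: h1 h2; rewrite !sqr_normcE; case: a {H half} => x y; case: b {b1} => u v /=.
nra.
Qed.

(** The image is the open disk of radius |a| about b. If it contained a point z with |z| >= 1, a
    slight outward push of z would remain in the image and leave the closed unit disk. *)
Lemma affine_disk_ball (a b : C) (r : R) :
  (forall xi, normc xi < 1 -> normc (xi * a + b) <= 1) -> r < normc a ^+ 2 ->
  forall z, normc (z - b) ^+ 2 <= r -> normc z < 1.
Proof.
move=> H ra z zr; rewrite ltNge; apply/negP => z1.
have za : normc (z - b) < normc a.
  by rewrite -ltr_sqr ?nnegrE ?normc_ge0//; exact: le_lt_trans ra.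
have a0 : 0 < normc a by exact: le_lt_trans (normc_ge0 _) za.
have an0 : a != 0 by rewrite -normc_gt0.
(* The push eta z uses half of the distance from z to the edge of the image disk. *)
pose eta := (normc a - normc (z - b)) / (2 * normc z).
have z0 : 0 < normc z by lra.
have e0 : 0 < eta by rewrite divr_gt0 ?mulr_gt0// subr_gt0.
have ez : eta * normc z = (normc a - normc (z - b)) / 2.
  by rewrite /eta; move: (normc z) z0 => Z Z0; field; rewrite gt_eqF.
have /H : normc ((z - b + eta%:C * z) / a) < 1.
  rewrite -(ltr_pM2r a0) -normcM divfK// mul1r.
  apply: le_lt_trans (le_normcD _ _) _; rewrite normcM normc_real (ger0_norm (ltW e0)) ez; lra.
rewrite divfK// addrAC subrK.
have -> : z + eta%:C * z = (1 + eta)%:C * z by rewrite rmorphD rmorph1 mulrDl mul1r.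
rewrite normcM normc_real ger0_norm; last by lra.
nra.
Qed.

Lemma unit_cis (om : C) : normc om = 1 -> exists2 t : R, 0 <= t <= 2 * pi & om = cis t.
Proof.
move=> om1; have := sqr_normcE om; have := normRe_le om; rewrite om1 expr1n.
case: om {om1} => x y /=; rewrite ler_norml => xb xy.
have p0 := pi_ge0 R; have a0 := acos_ge0 xb; have a1 := acos_lepi xb.
have cx : cos (acos x) = x by apply: acosK; rewrite in_itv.
have sx : sin (acos x) = `|y|.
  by rewrite sin_acos// (_ : 1 - _ = y ^+ 2) ?sqrtr_sqr//; lra.
have [y0|y0] := leP 0 y.
  by exists (acos x); [lra|rewrite /cis cx sx ger0_norm].
exists (- acos x + pi *+ 2); first by rewrite mulr2n; lra.
by rewrite /cis cosD2pi sinD2pi cosN sinN cx sx ltr0_norm// opprK.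
Qed.

Lemma derive1_affine (z p : C2) : derive1 (fun xi : C => xi *: z + p) 0 = z.
Proof.
apply/cvg_lim => //; apply: cvg_near_cst; near=> h.
have h0 : h != 0 by near: h; exact: nbhs_dnbhs_neq.
by rewrite addr0 scale0r add0r addrK scalerA mulVf// scale1r.
Unshelve. all: by end_near. Qed.

Lemma has_dderiv_derive (f : C -> C) z v D : has_dderiv f z v D ->
  'D_(v : Rcomplex R) (f : Rcomplex R -> Rcomplex R) z = D.
Proof.
move=> fD; apply/cvg_lim => //; apply/cvgrPdist_le => e e0.
have [d d0 Hd] := fD e e0; exists d => // h /=; rewrite sub0r normrN => hd h0.
have scE (x : R) (y : C) : x%:C * y = (x *: (y : Rcomplex R)).
  by case: y => a b; apply/eqP; rewrite eq_complex/= !mul0r subr0 addr0 !eqxx.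
have nh : 0 < `|h| by rewrite normr_gt0.
have hC : h%:C != 0 by apply/eqP => -[/eqP]; rewrite (negbTE h0).
rewrite -[leLHS]/(normc _) [X in normc X](_ : _ =
    - ((h^-1)%:C * (f (z + h%:C * v) - f z - h%:C * D))); last first.
  by rewrite -scE -scE [_ + z]addrC rmorphV ?unitfE//; field.
rewrite normcN normcM normc_real normfV ler_pdivrMl// [leRHS]mulrC; exact: Hd.
Qed.

(** The derivative along v is the differential of g applied to v a; multiplication by a being
    complex linear, only the conjugate-linear half of that differential survives, with factor conj
    a. *)
Lemma dbar_affine (g : C -> C) (a b gx gy : C) : rdiff g b gx gy ->
  dbar (fun xi => g (xi * a + b)) 0 = conjc a * (2^-1 * (gx + 'i%C * gy)).
Proof.
move=> /rdiffP dg.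
have H v : has_dderiv (fun xi => g (xi * a + b)) 0 v
    (gx * (complex.Re (v * a))%:C + gy * (complex.Im (v * a))%:C).
  move=> e e0; have n0 := normc_ge0 (v * a).
  have e1 : 0 < e / (normc (v * a) + 1) by rewrite divr_gt0//; lra.
  have [d d0 Hd] := dg _ e1; exists (d / (normc (v * a) + 1)) => [|h hd].
    by rewrite divr_gt0//; lra.
  have hE : (0 + h%:C * v) * a + b - b = h%:C * (v * a) by rewrite add0r addrK mulrA.
  have := Hd ((0 + h%:C * v) * a + b); rewrite hE normcM normc_real.
  have -> : complex.Re (h%:C * (v * a)) = h * complex.Re (v * a).
    by case: (v * a) => x y /=; rewrite mul0r subr0.
  have -> : complex.Im (h%:C * (v * a)) = h * complex.Im (v * a).
    by case: (v * a) => x y /=; rewrite mul0r addr0.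
  have hn := normr_ge0 h.
  have n1 : 0 < normc (v * a) + 1 by lra.
  have hd' : `|h| * normc (v * a) < d by move: hd; rewrite ltr_pdivlMr//; nra.
  move=> /(_ hd') h1; have -> : normc (g ((0 + h%:C * v) * a + b) - g (0 * a + b) -
      h%:C * (gx * (complex.Re (v * a))%:C + gy * (complex.Im (v * a))%:C)) =
      normc (g ((0 + h%:C * v) * a + b) - g b - gx * (h * complex.Re (v * a))%:C -
      gy * (h * complex.Im (v * a))%:C).
    by congr normc; rewrite mul0r !add0r !rmorphM; ring.
  apply: le_trans h1 _; have -> (N : R) : e / (N + 1) * (`|h| * N) = e * `|h| * (N / (N + 1)) by ring.
  by rewrite ler_piMr ?mulr_ge0 ?(ltW e0)// ler_pdivrMr// mul1r; lra.
rewrite /dbar /partial_x /partial_y (has_dderiv_derive (H _)) (has_dderiv_derive (H _)) complexiE.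
move: (complexiE R) => <-; have ii : 'i%C * 'i%C = -1 :> C by rewrite -expr2 sqr_i.
have -> : conjc a = (complex.Re a)%:C - 'i%C * (complex.Im a)%:C.
  by rewrite {1}[a]complex_ReIm; case: (a) => x y; apply/eqP; rewrite eq_complex/=; apply/andP; split; apply/eqP; ring.
have -> : complex.Re ('i%C * a) = - complex.Im a by case: (a) => x y /=; ring.
have -> : complex.Im ('i%C * a) = complex.Re a by case: (a) => x y /=; ring.
rewrite mul1r rmorphN.
have -> : gy * (complex.Im a)%:C = - ('i%C * 'i%C) * (gy * (complex.Im a)%:C) by rewrite ii opprK mul1r.
by ring.
Qed.

(** For u = 1 - 2 t in [0, 1] one has u <= sqrt u; the square root becomes a loss linear in t. *)
Lemma sqrt_half_sub (t : R) : 0 < t -> t <= 1 / 3 ->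
  (1 - 2 * t) / Num.sqrt 2 <= Num.sqrt (2^-1 - t).
Proof.
move=> t0 t3; have u0 : 0 <= 1 - 2 * t by lra.
have -> : 2^-1 - t = (1 - 2 * t) / 2 by field.
rewrite (sqrtrM _ u0) sqrtrV// ler_wpM2r ?invr_ge0 ?sqrtr_ge0//.
rewrite -ler_sqr ?nnegrE ?sqrtr_ge0// sqr_sqrtr// expr2 ler_piMl//; lra.
Qed.

Lemma op_norm_hankel_affine (phi : C2 -> C) (sw : bool) (a b om : C) (K : A2 R -> L2 R) :
  {within closure D2, continuous phi} -> normc om = 1 ->
  harmonic_on D1 (fun z => phi (mkpt sw z om)) -> a != 0 ->
  (forall xi, normc xi < 1 -> normc (xi * a + b) <= 1) -> compact_operator K ->
  ((normc a / Num.sqrt 2 * normc (dbar (fun xi => phi (mkpt sw (xi * a + b) om)) 0))%:E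
    <= op_norm (hankel phi \- K)%R)%E.
Proof.
move=> cphi om1 hg a0 aD cK; set g := fun z => phi (mkpt sw z om).
have na : 0 < normc a by rewrite normc_gt0.
have na2 : 0 < normc a ^+ 2 by rewrite exprn_gt0.
have b1 : normc b < 1.
  apply: (@affine_disk_ball a b 0 aD na2); by rewrite subrr normc0 expr0n.
have [gC1 _ _ _] := hg.
have -> : dbar (fun xi => g (xi * a + b)) 0 = conjc a * dbar g b.
  by rewrite (dbar_affine a (disk_C1_rdiff gC1 b1)) /dbar complexiE.
rewrite normcM normc_conj; set d := normc (dbar g b); pose N := normc a / Num.sqrt 2 * (normc a * d).
have d0 : 0 <= d := normc_ge0 _.
have s2 : 0 < Num.sqrt 2 :> R by rewrite sqrtr_gt0.
have N0 : 0 <= N by rewrite !mulr_ge0 ?invr_ge0 ?(ltW s2) ?(ltW na).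
rewrite -/N; apply/lee_addgt0Pr => e e0.
(* One parameter t governs both losses, that of the cutoff and that of the radius r = |a| ^ 2 (1 - 2
   t). Together they leave N (1 - 2 t) ^ 2 >= N - 4 N t, and n is large enough for 4 N t <= e. *)
pose n := Num.truncn (4 * N / e); pose t : R := n.+3%:R^-1.
have t0 : 0 < t by rewrite invr_gt0.
have t3 : t <= 1 / 3 by rewrite /t div1r lef_pV2 ?posrE// (ler_nat _ 3).
have Nt : 4 * N * t <= e.
  rewrite /t ler_pdivrMr// [leRHS]mulrC -ler_pdivrMr//.
  by apply/ltW/(lt_le_trans (truncnS_gt _)); rewrite ler_nat -/n -(addn2 n.+1) leq_addr.
pose r := normc a ^+ 2 * (1 - 2 * t).
have r0 : 0 < r by rewrite mulr_gt0//; lra.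
have ra : r < normc a ^+ 2 by rewrite /r; nra.
have := @op_norm_hankel_disk R phi sw om b r n cphi om1 r0 (affine_disk_ball aD ra) hg K cK.
rewrite -/d -/t => H; apply: le_trans (leeD H (lexx _)); rewrite -EFinD lee_fin.
have sE := sqrt_half_sub t0 t3.
apply: (@le_trans _ _ (d * (r * ((1 - 2 * t) / Num.sqrt 2)) + e)); last first.
  by rewrite lerD2r ler_wpM2l// ler_wpM2l// ltW.
have -> : d * (r * ((1 - 2 * t) / Num.sqrt 2)) = N * (1 - 2 * t) ^+ 2 by rewrite /r /N; ring.
have Nt2 : 0 <= N * (2 * t) ^+ 2 by rewrite mulr_ge0// sqr_ge0.
rewrite -subr_ge0 (_ : _ - N = e - 4 * N * t + N * (2 * t) ^+ 2); last by ring.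
by rewrite addr_ge0// subr_ge0.
Qed.

End boundary_disks.

Theorem theorem2 (R : realType) (phi : R[i] * R[i] -> R[i])
    (phiC1 : C1_closed_bidisk phi)
    (phi_harm1 : forall theta : R, 0 <= theta <= 2 * pi ->
       harmonic_on (@disk R) (fun z => phi (z, cis theta)))
    (phi_harm2 : forall theta : R, 0 <= theta <= 2 * pi ->
       harmonic_on (@disk R) (fun w => phi (cis theta, w))) :
  (ereal_sup [set (euclidean_norm (derive1 F 0) / Num.sqrt 2)%:E *
                  ereal_inf [set (normc (dbar (phi \o F) xi))%:E
                            | xi in @disk R]
             | F in @circular_disks R]
   <= essential_norm (hankel phi))%E.
Proof.
apply: ge_ereal_sup => _ [F [p [z [bp z0 FE FD]]] <-].
apply: le_ereal_inf_tmp => _ [K cK <-].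
have {}FE : F = fun xi => xi *: z + p by [].
have dF : derive1 F 0 = z by rewrite FE derive1_affine.
have FD' xi : normc xi < 1 -> [/\ normc (xi * z.1 + p.1) <= 1, normc (xi * z.2 + p.2) <= 1 &
    normc (xi * z.1 + p.1) = 1 \/ normc (xi * z.2 + p.2) = 1].
  move=> x1; have /boundary_bidisk : boundary (@bidisk R) (F xi) by apply: FD; exists xi => //; rewrite diskE.
  by rewrite FE.
have [cphi _] := phiC1; have [_ _ p1] := boundary_bidisk bp.
(* The infimum is at most the value at the centre, where the lower bound is proved. *)
rewrite dF; apply: (@le_trans _ _ ((euclidean_norm z / Num.sqrt 2)%:E * (normc (dbar (phi \o F) 0))%:E)%E).
  apply: lee_wpmul2l; first by rewrite lee_fin divr_ge0 ?sqrtr_ge0.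
  by apply: ereal_inf_lbound; exists 0 => //; rewrite diskE normc0.
rewrite -EFinM.
have zE : z = (z.1, z.2) by case: (z).
(* Here [om] is a unimodular coordinate of the centre [p]. The disk cannot move in that coordinate,
   so a' = 0 and the Euclidean norm of z is |a|. *)
have side sw (a b a' om : R[i]) : normc om = 1 -> z = mkpt sw a a' -> p = mkpt sw b om ->
  (forall theta : R, 0 <= theta <= 2 * pi ->
       harmonic_on (@disk R) (fun z => phi (mkpt sw z (cis theta)))) ->
  ((euclidean_norm z / Num.sqrt 2 * normc (dbar (phi \o F) 0))%:E <= op_norm (hankel phi \- K)%R)%E.
  move=> om1 zsw psw harm.
  have ball xi : normc xi < 1 -> normc (xi * a + b) <= 1 /\ normc (xi * a' + om) <= 1.
    by move=> /FD'; rewrite zsw psw /mkpt; case: (sw) => /= -[].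
  have a'0 : a' = 0 by apply: (affine_disk_const om1) => xi /ball[].
  have a0 : a != 0.
    by apply: contra_neq z0 => a0; rewrite zsw a0 a'0 /mkpt; case: (sw).
  have [t t2 omE] := unit_cis om1.
  have hg : harmonic_on (@disk R) (fun z => phi (mkpt sw z om)) by rewrite omE; exact: harm.
  have -> : euclidean_norm z = normc a.
    rewrite zsw a'0 /euclidean_norm /mkpt; case: (sw); cbv beta iota;
    by rewrite normc0 expr0n /= ?addr0 ?add0r sqrtr_sqr ger0_norm// normc_ge0.
  have -> : F = fun xi => mkpt sw (xi * a + b) om.
    rewrite FE; apply/funext => xi; rewrite zsw psw a'0 /mkpt.
    by case: (sw); congr pair; rewrite /= scaler0 add0r.
  by apply: op_norm_hankel_affine => // xi /ball[].
have pE : p = (p.1, p.2) by case: (p).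
case: p1 => h; first exact: (side true z.2 p.2 z.1 p.1 h zE pE phi_harm2).
exact: (side false z.1 p.1 z.2 p.2 h zE pE phi_harm1).
Qed.
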